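(* Let $\Omega\subset\mathbb{R}^2$ be a bounded polygonal domain, let $f\in L^2(\Omega)$ and let $\chi\in H^2(\Omega)$ with $\max_{x\in\partial\Omega}\chi(x)<0$. Let $K:=\{\varphi\in H^2_0(\Omega):\varphi\ge\chi \text{ a.e. in }\Omega\}$. Then the functional $$j(\xi):=\tfrac12|\!|\!|\xi|\!|\!|^2+\tfrac12|\!|\!|G(\xi)|\!|\!|^2-(f,\xi)_{L^2(\Omega)},\qquad \xi\in K,$$ has a minimizer in $K$. Moreover, for each minimizer $u$ of $j$ in $K$, the pair $(u,v)$ with $v:=G(u)$ solves the von Kármán obstacle problem: $(u,v)\in K\times H^2_0(\Omega)$ and $$a(u,u-\varphi_1)+2b(u,v,u-\varphi_1)\le (f,u-\varphi_1)_{L^2(\Omega)}\ \ \forall\varphi_1\in K,\qquad a(v,\varphi_2)-b(u,u,\varphi_2)=0\ \ \forall \varphi_2\in H^2_0(\Omega).$$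
   Context: $|\!|\!|\varphi|\!|\!|:=\|D^2\varphi\|_{L^2(\Omega)}$ (energy norm on $H^2_0(\Omega)$, $D^2$ the Hessian). For $\varphi_1,\varphi_2,\varphi_3\in H^2_0(\Omega)$: $a(\varphi_1,\varphi_2):=(D^2\varphi_1,D^2\varphi_2)_{L^2(\Omega)}$, $b(\varphi_1,\varphi_2,\varphi_3):=-\tfrac12([\varphi_1,\varphi_2],\varphi_3)_{L^2(\Omega)}$, where $[\varphi_1,\varphi_2]:=\varphi_{1,xx}\varphi_{2,yy}+\varphi_{1,yy}\varphi_{2,xx}-2\varphi_{1,xy}\varphi_{2,xy}$ is the von Kármán bracket. $G:H^2_0(\Omega)\to H^2_0(\Omega)$ is defined by $a(G(\varphi),\psi)=b(\varphi,\varphi,\psi)$ for all $\psi\in H^2_0(\Omega)$ (Riesz representation of $b(\varphi,\varphi,\cdot)$). *)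

(* Defs.v *)
From HB Require Import structures.
From mathcomp Require Import all_boot all_order all_algebra.
From mathcomp Require Import all_classical all_reals all_analysis.
Set Implicit Arguments. Unset Strict Implicit. Unset Printing Implicit Defensive.
Import Order.TTheory GRing.Theory Num.Theory.
Import numFieldNormedType.Exports.
Local Open Scope classical_set_scope.
Local Open Scope ring_scope.

Section VK.
Variable R : realType.
Local Notation P := (R * R)%type.

Definition leb2 := ((@lebesgue_measure R) \x (@lebesgue_measure R))%E.

Definition Rint (D : set P) (g : P -> R) : R := Rintegral leb2 D g.

Definition dir (i : bool) : P := if i then (1, 0) else (0, 1).

Fixpoint pder (l : seq bool) (g : P -> R) : P -> R :=
  match l with
  | [::] => g
  | i :: l' => fun x => derive (pder l' g) x (dir i)
  end.

Definition smooth (g : P -> R) : Prop :=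
  forall l : seq bool, continuous (pder l g) /\
    forall (i : bool) (x : P), derivable (pder l g) x (dir i).

Definition test_fun (Om : set P) (g : P -> R) : Prop :=
  smooth g /\ exists C : set P, compact C /\ C `<=` Om /\
    (forall x, ~ C x -> g x = 0).

Definition L2 (Om : set P) (g : P -> R) : Prop :=
  measurable_fun Om g /\ leb2.-integrable Om (fun x => ((g x) ^+ 2)%:E).

Definition ip (Om : set P) (g h : P -> R) : R := Rint Om (fun x => g x * h x).

Definition wder (Om : set P) (l : seq bool) (u h : P -> R) : Prop :=
  L2 Om h /\ forall psi, test_fun Om psi ->
    Rint Om (fun x => u x * pder l psi x) =
    (-1) ^+ size l * Rint Om (fun x => h x * psi x).

Definition H2 (Om : set P) (u : P -> R) : Prop :=
  L2 Om u /\ forall l : seq bool, (size l <= 2)%N -> exists h, wder Om l u h.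

Definition H20 (Om : set P) (u : P -> R) : Prop :=
  H2 Om u /\ exists phi : nat -> P -> R, (forall n, test_fun Om (phi n)) /\
    forall l : seq bool, (size l <= 2)%N -> forall h, wder Om l u h ->
      (fun n => Rint Om (fun x => (pder l (phi n) x - h x) ^+ 2)) @ \oo --> (0 : R).

Definition hess (Om : set P) (u : P -> R) (i j : bool) : P -> R :=
  xget (fun _ => 0) (wder Om [:: i; j] u).

Definition aform (Om : set P) (u w : P -> R) : R :=
  \sum_(i : bool) \sum_(j : bool) ip Om (hess Om u i j) (hess Om w i j).

Definition enorm (Om : set P) (u : P -> R) : R := Num.sqrt (aform Om u u).

Definition vkb (Om : set P) (u w : P -> R) : P -> R := fun x =>
  hess Om u true true x * hess Om w false false x
  + hess Om u false false x * hess Om w true true x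
  - 2 * (hess Om u true false x * hess Om w true false x).

Definition bform (Om : set P) (u w z : P -> R) : R :=
  - (1 / 2) * ip Om (vkb Om u w) z.

Definition Gop (Om : set P) (u : P -> R) : P -> R :=
  xget (fun _ => 0) [set w | H20 Om w /\
     forall psi, H20 Om psi -> aform Om w psi = bform Om u u psi].

Definition segment (a b : P) : set P :=
  [set x | exists2 t : R, 0 <= t <= 1 &
     x = (a.1 + t * (b.1 - a.1), a.2 + t * (b.2 - a.2))].

Definition boundary (A : set P) : set P := closure A `\` interior A.

Definition polygonal_domain (Om : set P) : Prop :=
  [/\ open Om, connected Om, Om !=set0,
      (exists M : R, forall x, Om x -> `|x.1| <= M /\ `|x.2| <= M) &
      exists s : seq (P * P),
        boundary Om = \bigcup_(k in [set k | k \in s]) segment k.1 k.2].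

Definition Kset (Om : set P) (chi : P -> R) : set (P -> R) :=
  [set phi | H20 Om phi /\ {ae leb2, forall x, Om x -> chi x <= phi x}].

Definition jfun (Om : set P) (f xi : P -> R) : R :=
  (1 / 2) * enorm Om xi ^+ 2 + (1 / 2) * enorm Om (Gop Om xi) ^+ 2 - ip Om f xi.

End VK.

(* Main.v *)
(** The Hessian form [a] is a complete inner product on [H20] (evaluation at a
    point is the pairing of [u_xy] with the indicator of a quadrant, which gives
    a sup bound and hence a Poincare inequality).  The bracket is the divergence
    of the cofactor matrix of the Hessian applied to a gradient, so by density
    of test functions [b] is symmetric, and it satisfies
    [|b u v w| <= 2 |||u||| |||v||| ess sup |w|].  Bounded sequences of [H20]
    that converge weakly converge uniformly; hence, along a weakly convergent
    minimising sequence, [b] passes to the limit, [|||G u|||^2] is weakly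
    lower semicontinuous and the constraint is preserved.  [K] is not
    empty because on the compact closure of the domain the obstacle lies below
    a finite sum of multiples of bumps.  The variational
    inequality is the first order term of the energy along segments of [K]; its
    factor [2] comes from the derivative [2 b(u, w, G u) = 2 b(u, G u, w)] of
    [1/2 |||G u|||^2] in the direction [w], by symmetry. *)
Require Import Defs.
From HB Require Import structures.
From mathcomp Require Import all_boot all_order all_algebra.
From mathcomp Require Import all_classical all_reals all_analysis.
From mathcomp Require Import measurable_realfun.
From mathcomp Require Import ring lra.
Set Implicit Arguments. Unset Strict Implicit. Unset Printing Implicit Defensive.
Import Order.TTheory GRing.Theory Num.Theory.
Import numFieldNormedType.Exports.
Local Open Scope classical_set_scope.
Local Open Scope ring_scope.

(** * Positive semidefinite forms and the abstract obstacle problem *)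

(** Functions are not identified almost everywhere, and [hess] and [Gop] are chosen by [xget]. The
    forms are therefore only semidefinite, a chosen Hessian is linear only up to null sets, and a
    Riesz representative is used only through its pairings with the space. The obstacle is that [b]
    multiplies second derivatives, which converge only weakly along a minimising sequence. The way
    out is that the bracket is bounded in L1 by the energy: if the difference [u_n - u] stands in
    the third argument, its uniform convergence is enough. Symmetry of [b] is what moves it there,
    so symmetry serves existence as well as the variational inequality. Hence the abstract part
    keeps only two facts about the plane: a bound of [b] by a size of its third argument, and
    smallness in that size of bounded sequences that converge weakly to zero. *)

Record psd_form (R : realType) (V : lmodType R) (H : set V) (a : V -> V -> R) :
    Prop := PsdForm {
  psd_0 : H 0;
  psd_lin : forall c u v, H u -> H v -> H (c *: u + v);
  psd_l : forall c u v w, H u -> H v -> H w ->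
    a (c *: u + v) w = c * a u w + a v w;
  psd_sym : forall u v, H u -> H v -> a u v = a v u;
  psd_ge0 : forall u, H u -> 0 <= a u u }.

Definition seminorm (R : realType) (V : lmodType R) (a : V -> V -> R) (u : V) : R :=
  Num.sqrt (a u u).

Definition form_complete (R : realType) (V : lmodType R) (H : set V)
    (a : V -> V -> R) : Prop :=
  forall u_ : nat -> V, (forall n, H (u_ n)) ->
    (forall e : R, 0 < e -> exists N, forall m n, (N <= m)%N -> (N <= n)%N ->
       seminorm a (u_ m - u_ n) <= e) ->
  exists2 u, H u & forall e : R, 0 < e -> exists N, forall n, (N <= n)%N ->
       seminorm a (u_ n - u) <= e.

(** For small [t] of sign opposite to [x] the linear term wins. The witness divides by [|y| + 1]
    because the sign of [y] is not known and the divisor must be positive. *)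
Lemma quadratic_ge0_lin0 (R : realType) (x y : R) :
  (forall t, 0 <= 2 * t * x + t ^+ 2 * y) -> x = 0.
Proof.
move=> h; apply/eqP/negP => /negP x0.
have y1 : 0 < `|y| + 1 by rewrite ltr_wpDl.
have x2 : 0 < x ^+ 2 by rewrite exprn_even_gt0.
have := h (- x / (`|y| + 1)).
have -> : 2 * (- x / (`|y| + 1)) * x + (- x / (`|y| + 1)) ^+ 2 * y
   = x ^+ 2 / (`|y| + 1) ^+ 2 * (y - 2 * (`|y| + 1)).
  by field; rewrite gt_eqF.
have xp : 0 < x ^+ 2 / (`|y| + 1) ^+ 2 by exact: divr_gt0 x2 (exprn_gt0 2 y1).
rewrite (pmulr_rge0 _ xp).
by have := ler_norm y; have := normr_ge0 y; lra.
Qed.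

Section PsdTheory.
Variables (R : realType) (V : lmodType R) (H : set V) (a : V -> V -> R).
Hypothesis ha : psd_form H a.
Local Notation N := (seminorm a).

Lemma psdZ c u : H u -> H (c *: u).
Proof. by move=> Hu; rewrite -[_ *: _]addr0; apply: (psd_lin ha) => //; exact: (psd_0 ha). Qed.

Lemma psdD u v : H u -> H v -> H (u + v).
Proof. by move=> Hu Hv; rewrite -[u]scale1r; exact: (psd_lin ha). Qed.

Lemma psdN u : H u -> H (- u).
Proof. by move=> Hu; rewrite -scaleN1r; exact: psdZ. Qed.

Lemma psdB u v : H u -> H v -> H (u - v).
Proof. by move=> Hu Hv; apply: psdD => //; exact: psdN. Qed.

Lemma form0l w : H w -> a 0 w = 0.
Proof.
move=> Hw; have H0 := psd_0 ha.
have := psd_l ha 1 H0 H0 Hw; rewrite scale1r addr0 mul1r => h.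
by apply: (addrI (a 0 w)); rewrite addr0 -h.
Qed.

Lemma formDl u v w : H u -> H v -> H w -> a (u + v) w = a u w + a v w.
Proof. by move=> Hu Hv Hw; have := psd_l ha 1 Hu Hv Hw; rewrite scale1r mul1r. Qed.

Lemma formZl c u w : H u -> H w -> a (c *: u) w = c * a u w.
Proof.
move=> Hu Hw; have := psd_l ha c Hu (psd_0 ha) Hw.
by rewrite addr0 form0l // addr0.
Qed.

Lemma formNl u w : H u -> H w -> a (- u) w = - a u w.
Proof. by move=> Hu Hw; rewrite -scaleN1r formZl // mulN1r. Qed.

Lemma formBl u v w : H u -> H v -> H w -> a (u - v) w = a u w - a v w.
Proof. by move=> Hu Hv Hw; rewrite formDl ?formNl//; exact: psdN. Qed.

Lemma formDr u v w : H u -> H v -> H w -> a w (u + v) = a w u + a w v.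
Proof.
move=> Hu Hv Hw; rewrite (psd_sym ha)// ?formDl//; last exact: psdD.
by rewrite (psd_sym ha Hu Hw) (psd_sym ha Hv Hw).
Qed.

Lemma formZr c u w : H u -> H w -> a w (c *: u) = c * a w u.
Proof.
move=> Hu Hw; rewrite (psd_sym ha)// ?formZl//; last exact: psdZ.
by rewrite (psd_sym ha Hu Hw).
Qed.

Lemma formBr u v w : H u -> H v -> H w -> a w (u - v) = a w u - a w v.
Proof.
move=> Hu Hv Hw; rewrite (psd_sym ha)// ?formBl//; last exact: psdB.
by rewrite (psd_sym ha Hu Hw) (psd_sym ha Hv Hw).
Qed.

Lemma form_quad t u w : H u -> H w ->
  a (u + t *: w) (u + t *: w) = a u u + 2 * t * a u w + t ^+ 2 * a w w.
Proof.
move=> Hu Hw; have Htw := psdZ t Hw; have Huw := psdD Hu Htw.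
rewrite formDl// !formDr// !formZl// !formZr// (psd_sym ha Hw Hu).
by ring.
Qed.

Lemma form_CS u v : H u -> H v -> `|a u v| <= N u * N v.
Proof.
move=> Hu Hv.
rewrite -sqrtrM ?(psd_ge0 ha)// -sqrtr_sqr ler_wsqrtr//.
(* The form is only semidefinite, so [a v v = 0] does not give [v = 0]. The quadratic in [t] is then
   affine, and a nonzero slope would let it reach [-1]. *)
have [v0|v0] := eqVneq (a v v) 0.
  rewrite v0 mulr0 le_eqVlt; apply/orP; left; rewrite sqrf_eq0; apply/eqP.
  have [uu0|uu0] := eqVneq (a u v) 0 => //.
  have h : forall t, 0 <= a u u + 2 * t * a u v.
    move=> t; have := psd_ge0 ha (psdD Hu (psdZ t Hv)).
    by rewrite form_quad// v0 mulr0 addr0.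
  have := h (- (a u u + 1) / (2 * a u v)).
  have -> : a u u + 2 * (- (a u u + 1) / (2 * a u v)) * a u v = -1.
    by field; rewrite uu0.
  by rewrite ler0N1.
have vp : 0 < a v v by rewrite lt_neqAle eq_sym v0 (psd_ge0 ha).
have := psd_ge0 ha (psdD Hu (psdZ (- a u v / a v v) Hv)).
rewrite form_quad//.
have -> : a u u + 2 * (- a u v / a v v) * a u v + (- a u v / a v v) ^+ 2 * a v v
   = (a u u * a v v - a u v ^+ 2) / a v v by field.
by rewrite pmulr_lge0 ?invr_gt0// subr_ge0.
Qed.

Lemma seminorm_ge0 u : 0 <= N u. Proof. exact: sqrtr_ge0. Qed.

Lemma sqr_seminorm u : H u -> N u ^+ 2 = a u u.
Proof. by move=> Hu; rewrite sqr_sqrtr// (psd_ge0 ha). Qed.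

Lemma seminormZ c u : H u -> N (c *: u) = `|c| * N u.
Proof.
move=> Hu; rewrite /seminorm formZl// ?formZr//; last exact: psdZ.
by rewrite mulrA -expr2 sqrtrM ?sqr_ge0// sqrtr_sqr.
Qed.

Lemma seminormN u : H u -> N (- u) = N u.
Proof. by move=> Hu; rewrite -scaleN1r seminormZ// normrN1 mul1r. Qed.

Lemma seminorm_triangle u v : H u -> H v -> N (u + v) <= N u + N v.
Proof.
move=> Hu Hv; rewrite -(@ler_pXn2r _ 2)// ?nnegrE ?addr_ge0 ?seminorm_ge0//.
rewrite sqr_seminorm; last exact: psdD.
have := form_quad 1 Hu Hv; rewrite scale1r => ->.
rewrite sqrrD !sqr_seminorm// expr1n mul1r mulr1.
have := le_trans (ler_norm _) (form_CS Hu Hv); lra.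
Qed.

Lemma seminormBC u v : H u -> H v -> N (u - v) = N (v - u).
Proof. by move=> Hu Hv; rewrite -[LHS]seminormN ?opprB//; exact: psdB. Qed.

(* Any minimising sequence of [a w w - 2 L w] is Cauchy by the parallelogram
   identity, and its limit represents [L]. *)
Lemma riesz (L : V -> R) (C : R) : form_complete H a ->
  (forall c u v, H u -> H v -> L (c *: u + v) = c * L u + L v) ->
  (forall u, H u -> `|L u| <= C * N u) ->
  exists2 w, H w & forall z, H z -> a w z = L z.
Proof.
move=> cH Llin LC.
have H0 := psd_0 ha.
have L0 : L 0 = 0.
  by have := Llin (-1) _ _ H0 H0; rewrite scaler0 addr0 mulN1r addNr.
have LZ c u : H u -> L (c *: u) = c * L u.
  by move=> Hu; have := Llin c _ _ Hu H0; rewrite addr0 L0 addr0.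
have LD u v : H u -> H v -> L (u + v) = L u + L v.
  by move=> Hu Hv; have := Llin 1 _ _ Hu Hv; rewrite scale1r mul1r.
pose Q w := a w w - 2 * L w.
pose E := [set Q w | w in H].
(* Completing the square: [Q w] is at least [(N w - C)^2 - C^2]. *)
have hQ w : H w -> - C ^+ 2 <= Q w.
  move=> Hw; rewrite /Q -sqr_seminorm//.
  have := le_trans (ler_norm _) (LC _ Hw).
  have := sqr_ge0 (N w - C); rewrite sqrrB.
  lra.
have hE : has_inf E.
  split; first by exists (Q 0), 0.
  by exists (- C ^+ 2) => _ [w Hw <-]; exact: hQ.
pose d := inf E.
have dQ w : H w -> d <= Q w by move=> Hw; apply: ge_inf; [exact: hE.2|exists w].
have exw n : exists w, H w /\ Q w < d + n.+1%:R^-1.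
  have [|_ [w Hw <-] h] := @inf_adherent _ E (n.+1%:R^-1) _ hE; first by rewrite invr_gt0.
  by exists w.
have [u_ hu_] := choice exw.
have par m n : a (u_ m - u_ n) (u_ m - u_ n) <= 2 * (m.+1%:R^-1 + n.+1%:R^-1).
  have [[Hm Qm] [Hn Qn]] := (hu_ m, hu_ n).
  have Hmn := psdD Hm Hn.
  have Hmb := psdB Hm Hn; rewrite formBl// !formBr//.
  (* At the midpoint the linear terms cancel: [a (u_m - u_n) (u_m - u_n)] is
     [2 Q u_m + 2 Q u_n - 4 Q] of the midpoint, and that last value of [Q] is at least [d]. *)
  have := dQ _ (psdZ (2^-1) Hmn).
  rewrite /Q LZ// LD// formZl ?formZr//; last exact: psdZ.
  rewrite formDl// !formDr//.
  rewrite /Q in Qm Qn.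
  rewrite (psd_sym ha Hn Hm).
  move: (a (u_ m) (u_ m)) (a (u_ m) (u_ n)) (a (u_ n) (u_ n)) (L (u_ m)) (L (u_ n)) Qm Qn.
  move: (m.+1%:R^-1) (n.+1%:R^-1) => x y p q r s t; lra.
have [|w Hw cw] := cH u_ (fun n => (hu_ n).1).
  move=> e e0.
  have e4 : 0 < e ^+ 2 / 4 by rewrite divr_gt0// exprn_gt0.
  exists (Num.bound (1 / (e ^+ 2 / 4))) => m n km kn.
  rewrite /seminorm -(ger0_norm (ltW e0)) -sqrtr_sqr ler_wsqrtr//.
  apply: (le_trans (par m n)).
  have bnd j : (Num.bound (1 / (e ^+ 2 / 4)) <= j)%N -> j.+1%:R^-1 <= e ^+ 2 / 4.
    move=> kj; rewrite -[leRHS]invrK lef_pV2 ?posrE ?invr_gt0//.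
    rewrite -div1r; apply/ltW; apply: (lt_le_trans (archi_boundP (ltW (divr_gt0 ltr01 e4)))).
    by rewrite ler_nat ltnW.
  have := bnd _ km; have := bnd _ kn.
  by move: (m.+1%:R^-1) (n.+1%:R^-1) => x y; lra.
exists w => // z Hz.
apply/eqP; rewrite -subr_eq0; apply/eqP.
apply: (@quadratic_ge0_lin0 _ _ (a z z)) => t.
apply/ler_addgt0Pl => e e0; rewrite addrC.
have Nz := seminorm_ge0 z.
have K0 : 0 < 1 + 2 * `|t| * N z by rewrite ltr_wpDr// !mulr_ge0.
have [N1 hN1] := cw (e / (1 + 2 * `|t| * N z)) (divr_gt0 e0 K0).
have e1 := divr_gt0 e0 K0.
set e' := e / _ in hN1 e1.
pose n := maxn N1 (Num.bound e'^-1).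
have n1 : n.+1%:R^-1 <= e'.
  rewrite -[leRHS]invrK lef_pV2 ?posrE ?invr_gt0//.
  have ei : 0 <= e'^-1 by rewrite invr_ge0 ltW.
  apply/ltW/(lt_le_trans (archi_boundP ei)).
  by rewrite ler_nat ltnW// ltnS leq_maxr.
have := hN1 n (leq_maxl _ _).
have [Hn Qn] := hu_ n.
have CS := form_CS (psdB Hn Hw) Hz.
rewrite formBl// in CS.
have := dQ _ (psdD Hn (psdZ t Hz)).
rewrite /Q form_quad// LD ?LZ//; last exact: psdZ.
rewrite /Q in Qn.
move=> h1 h2.
have h3 : `|t * (a (u_ n) z - a w z)| <= `|t| * N z * e'.
  rewrite normrM -mulrA ler_wpM2l// mulrC.
  by apply: (le_trans CS); exact: ler_wpM2r.
have h4 : e = e' + 2 * (`|t| * N z * e').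
  by rewrite /e'; field; rewrite gt_eqF.
move: h3; rewrite ler_norml mulrBr => /andP[h3 h5].
rewrite h4; move: (n.+1%:R^-1) n1 Qn => x n1 Qn; lra.
Qed.

End PsdTheory.
(** Compactness of a segment provides a cluster point, and an ultrafilter converges to each of its
    cluster points. *)
Lemma ultra_bounded_cvg (R : realType) (U : set_system nat) (s : nat -> R) (B : R) :
  UltraFilter U -> (forall n, `|s n| <= B) -> exists l : R, s n @[n --> U] --> l.
Proof.
move=> UU sB.
have [|p [_ clp]] := @segment_compact R (- B) B (s @ U) _.
  by apply: nearW => n /=; rewrite in_itv /= -ler_norml.
exists p => A /= pA.
have [//|UA] := in_ultra_setVsetC (s @^-1` A) UU.
by have [x [+ Ax]] := clp (~` A) A UA pA.
Qed.

(** * Direct method and variational inequality for an abstract energy *)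

Section AbstractEnergy.
Variables (R : realType) (V : lmodType R) (H : set V) (a : V -> V -> R).
Hypotheses (ha : psd_form H a) (ca : form_complete H a).
Local Notation N := (seminorm a).

(** One ultrafilter serves all [z] at once, so the limits of the pairings form a functional of [z]
    that is linear and bounded by [B]; its Riesz vector is the weak limit. *)
Lemma ultra_weak_limit (U : set_system nat) (u_ : nat -> V) (B : R) :
  UltraFilter U -> (forall n, H (u_ n)) -> (forall n, N (u_ n) <= B) ->
  exists2 u, H u & forall z, H z -> a (u_ n) z @[n --> U] --> a u z.
Proof.
move=> UU Hu NB.
have bd z n : H z -> `|a (u_ n) z| <= B * N z.
  move=> Hz; apply: (le_trans (form_CS ha (Hu n) Hz)).
  by rewrite ler_wpM2r// seminorm_ge0.
have exl z : exists l : R, H z -> a (u_ n) z @[n --> U] --> l.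
  have [Hz|nHz] := pselect (H z); last by exists 0.
  by have [l hl] := ultra_bounded_cvg UU (fun n => bd z n Hz); exists l.
have [L hL] := choice exl.
have [||w Hw wL] := @riesz _ _ _ _ ha L B ca.
- move=> c x y Hx Hy.
  apply: (@cvg_unique _ _ (a (u_ n) (c *: x + y) @[n --> U])) => //.
    by apply: hL; exact: psd_lin ha _ _ _ Hx Hy.
  rewrite (_ : (fun n => _) = (fun n => c * a (u_ n) x + a (u_ n) y)).
    by apply: cvgD; [apply: cvgMl_tmp|]; exact: hL.
  apply/funext => n.
  by rewrite (formDr ha)// ?(formZr ha)//; exact: (psdZ ha).
- move=> z Hz.
  have := closed_cvg (fun x => x <= B * N z) (@closed_le R _) _ _ (cvg_norm (hL z Hz)).
  by apply; apply: nearW => n; exact: bd.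
exists w => // z Hz; rewrite wL//; exact: hL.
Qed.

Variables (b : V -> V -> V -> R) (G : V -> V) (F : V -> R).
Variables (S : R -> V -> Prop) (K : set V) (Cb CF CS : R).
Hypotheses
  (b_lin : forall x y c u v, H x -> H y -> H u -> H v ->
     b x y (c *: u + v) = c * b x y u + b x y v)
  (b_sym12 : forall u v w, H u -> H v -> H w -> b u v w = b v u w)
  (b_sym23 : forall u v w, H u -> H v -> H w -> b u v w = b u w v)
  (b_bd : forall u v w, H u -> H v -> H w -> `|b u v w| <= Cb * N u * N v * N w)
  (HG : forall u, H u -> H (G u))
  (aG : forall u z, H u -> H z -> a (G u) z = b u u z)
  (F_lin : forall c u v, H u -> H v -> F (c *: u + v) = c * F u + F v)
  (F_bd : forall u, H u -> `|F u| <= CF * N u).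

Lemma trilD x y u v : H x -> H y -> H u -> H v -> b x y (u + v) = b x y u + b x y v.
Proof. by move=> Hx Hy Hu Hv; rewrite -[u]scale1r b_lin// mul1r scale1r. Qed.

Lemma tril0 x y : H x -> H y -> b x y 0 = 0.
Proof.
move=> Hx Hy; have H0 := psd_0 ha.
have := trilD Hx Hy H0 H0; rewrite addr0 => h.
by apply: (addrI (b x y 0)); rewrite addr0 -h.
Qed.

Lemma trilZ x y c u : H x -> H y -> H u -> b x y (c *: u) = c * b x y u.
Proof.
move=> Hx Hy Hu; have H0 := psd_0 ha.
by rewrite -[_ *: _]addr0 b_lin// tril0// addr0.
Qed.

Lemma trilB x y u v : H x -> H y -> H u -> H v -> b x y (u - v) = b x y u - b x y v.
Proof.
move=> Hx Hy Hu Hv; rewrite trilD//; last exact: (psdN ha).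
by rewrite -scaleN1r trilZ// mulN1r.
Qed.

Lemma func0 : F 0 = 0.
Proof.
have H0 := psd_0 ha; have := F_lin 1 H0 H0.
by rewrite scale1r addr0 mul1r => h; apply: (addrI (F 0)); rewrite addr0 -h.
Qed.

Lemma funcD u v : H u -> H v -> F (u + v) = F u + F v.
Proof. by move=> Hu Hv; rewrite -[u]scale1r F_lin// mul1r scale1r. Qed.

Lemma funcZ c u : H u -> F (c *: u) = c * F u.
Proof. by move=> Hu; rewrite -[_ *: _]addr0 F_lin ?func0 ?addr0//; exact: (psd_0 ha). Qed.

Lemma trilinear_riesz x y : H x -> H y -> exists2 d, H d & forall z, H z -> a d z = b x y z.
Proof.
move=> Hx Hy; apply: (@riesz _ _ _ _ ha (b x y) (Cb * N x * N y) ca) => [c u v Hu Hv|u Hu].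
  exact: b_lin.
exact: b_bd.
Qed.

Definition energy u := 1 / 2 * a u u + 1 / 2 * a (G u) (G u) - F u.

(** [S e z] stands for an essential bound of [|z|] by [e]. Under this reading [S_compact] is the
    compactness of the embedding into continuous functions, and [K_closed] is closedness under
    uniform approximation. *)
Hypotheses
  (S_bd : forall u v z e, 0 <= e -> H u -> H v -> H z -> S e z ->
     `|b u v z| <= CS * N u * N v * e)
  (S_compact : forall (U : set_system nat) (z_ : nat -> V) (B : R),
     ProperFilter U -> (forall n, H (z_ n)) -> (forall n, N (z_ n) <= B) ->
     (forall w, H w -> a (z_ n) w @[n --> U] --> (0 : R)) ->
     forall e : R, 0 < e -> \forall n \near U, S e (z_ n))
  (KH : K `<=` H)
  (K_convex : forall u v (t : R), 0 <= t <= 1 -> K u -> K v -> K (u + t *: (v - u)))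
  (K_closed : forall u, H u -> (forall e : R, 0 < e -> exists2 w, K w & S e (w - u)) -> K u).

(* Direct method, with weak limits taken along an ultrafilter so that no
   subsequence has to be extracted. *)
Lemma energy_minimizer : K !=set0 ->
  exists2 u, K u & forall v, K v -> energy u <= energy v.
Proof.
move=> [k0 Kk0].
have coer u : H u -> 1 / 2 * N u ^+ 2 - CF * N u <= energy u.
  move=> Hu; rewrite /energy (sqr_seminorm ha Hu).
  have := le_trans (ler_norm _) (F_bd Hu).
  have := psd_ge0 ha (HG Hu).
  lra.
pose E := [set energy u | u in K].
have hE : has_inf E.
  split; first by exists (energy k0), k0.
  exists (- CF ^+ 2 / 2) => _ [u Ku <-]; apply: le_trans (coer _ (KH Ku)).
  have := sqr_ge0 (N u - CF); rewrite sqrrB; lra.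
pose d := inf E.
have dE u : K u -> d <= energy u by move=> Ku; apply: ge_inf; [exact: hE.2|exists u].
have exu n : exists u, K u /\ energy u < d + n.+1%:R^-1.
  have [|_ [u Ku <-] h] := @inf_adherent _ E (n.+1%:R^-1) _ hE; first by rewrite invr_gt0.
  by exists u.
have [u_ hu_] := choice exu.
have Hu n : H (u_ n) by apply: KH; exact: (hu_ n).1.
(* From [energy (u_ n) < d + 1] and coercivity, [(N (u_ n) - CF)^2 < 2 (d + 1) + CF^2 <= s], which
   is less than [(s + 1)^2]; this excludes [N (u_ n) > CF + s + 1]. *)
pose s := `|2 * (d + 1) + CF ^+ 2|.
have NB n : N (u_ n) <= CF + s + 1.
  have := coer _ (Hu n); have [_ h1 h2] := hu_ n.
  have h3 : n.+1%:R^-1 <= 1 :> R by rewrite invf_le1 ?ler1n.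
  rewrite leNgt; apply/negP => h4.
  have s0 : 0 <= s by exact: normr_ge0.
  have h5 : 2 * (d + 1) + CF ^+ 2 <= s by exact: ler_norm.
  have h6 : (s + 1) ^+ 2 < (N (u_ n) - CF) ^+ 2.
    by rewrite ltr_pXn2r ?nnegrE//; lra.
  move: h6; rewrite sqrrB sqrrD => h6.
  have := sqr_ge0 s.
  by move: (n.+1%:R^-1) h1 h3 => x h1 h3; lra.
have [U [UU nU]] := @ultraFilterLemma nat \oo _.
have PU : ProperFilter U by exact: ultra_proper.
have [u Hlu cu] := ultra_weak_limit UU Hu NB.
have Hz n : H (u_ n - u) by exact: (psdB ha).
have cz w : H w -> a (u_ n - u) w @[n --> U] --> (0 : R).
  move=> Hw; rewrite -(subrr (a u w)).
  rewrite (_ : (fun n => _) = (fun n => a (u_ n) w - a u w)).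
    by apply: cvgB; [exact: cu|exact: cvg_cst].
  by apply/funext => n; rewrite (formBl ha).
have NBz n : N (u_ n - u) <= CF + s + 1 + N u.
  apply: (le_trans (seminorm_triangle ha (Hu n) (psdN ha Hlu))).
  by rewrite (seminormN ha)// lerD2r.
have nS e : 0 < e -> \forall n \near U, S e (u_ n - u).
  exact: (S_compact PU Hz NBz cz).
have Ku : K u.
  apply: K_closed => // e e0.
  have [n Sn] := filter_ex (nS e e0).
  by exists (u_ n) => //; exact: (hu_ n).1.
exists u => // v Kv; apply: le_trans (dE v Kv).
pose w := G u; have Hw : H w by exact: HG.
(* Riesz vectors turn the load and the functional [b (G u) u] into pairings with [u_ n - u], which
   weak convergence controls. *)
have [f0 Hf0 f0F] := @riesz _ _ _ _ ha F CF ca F_lin F_bd.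
have [r Hr rb] := trilinear_riesz Hw Hlu.
have B0 : 0 <= CF + s + 1 by exact: le_trans (seminorm_ge0 _ _) (NB 0%N).
apply/ler_addgt0Pr => e e0.
pose P := `|CS| * N w * (CF + s + 1).
have P0 : 0 <= P by rewrite !mulr_ge0 ?seminorm_ge0.
have e5 : 0 < e / 5 by rewrite divr_gt0.
have eP : 0 < e / 5 / (P + 1) by rewrite divr_gt0// ltr_wpDl.
have near1 z : H z -> \forall n \near U, `|a (u_ n - u) z| < e / 5.
  move=> Hzz; have /cvgrPdist_lt/(_ _ e5) := cz z Hzz.
  by apply: filterS => n; rewrite sub0r normrN.
have hN : \forall n \near U, n.+1%:R^-1 < e / 5.
  by apply: nU; exact: near_infty_natSinv_lt (PosNum e5).
(* A single index suffices. Five errors of at most [e / 5] enter: the pairings with [u], [f0] and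
   [r], the gap to the infimum, and the remainder [b w (u_ n) (u_ n - u)], whose other factors are
   bounded by [P]. *)
have [n [[[h1 h2] [h3 h4]] h5]] := filter_ex (filterI (filterI
  (filterI (near1 u Hlu) (near1 f0 Hf0)) (filterI (near1 r Hr) hN)) (nS _ eP)).
have Eu : energy (u_ n) < d + n.+1%:R^-1 by exact: (hu_ n).2.
(* The quantitative form of weak lower semicontinuity: expanding this square, and the one for [G] in
   [q2], bounds the quadratic terms at [u_ n] below by their tangents at [u] and [G u]. *)
have q1 : 0 <= a (u_ n - u) (u_ n - u) by exact: psd_ge0 ha _ (Hz n).
have Gn := HG (Hu n).
have HBG := psdB ha Gn Hw.
have q2 : 0 <= a (G (u_ n) - w) (G (u_ n) - w) by exact: (psd_ge0 ha).
(* By symmetry the left side is [b w u_n u_n - b w u u]. One copy of [u_n - u] is isolated in the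
   third argument, where its uniform smallness counts; what is left is linear in [u_n - u]. *)
have q3 : a (G (u_ n)) w - a w w = b w (u_ n) (u_ n - u) + a r (u_ n - u).
  rewrite aG// {1}/w aG// rb// -/w (b_sym23 (Hu n))// (b_sym12 (Hu n))//.
  rewrite (b_sym23 Hlu Hlu Hw) (b_sym12 Hlu Hw Hlu).
  rewrite !trilB// (b_sym23 Hw Hlu (Hu n)); ring.
have q4 : `|b w (u_ n) (u_ n - u)| <= e / 5.
  apply: (le_trans (S_bd (ltW eP) Hw (Hu n) (Hz n) h5)).
  apply: (@le_trans _ _ (P * (e / 5 / (P + 1)))).
    rewrite ler_wpM2r ?(ltW eP)//; apply: (@le_trans _ _ (`|CS| * N w * N (u_ n))).
      by rewrite -!mulrA ler_wpM2r ?mulr_ge0 ?seminorm_ge0// ler_norm.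
    by rewrite ler_wpM2l ?mulr_ge0 ?seminorm_ge0.
  rewrite mulrCA -[leRHS]mulr1 ler_wpM2l ?(ltW e5)// ler_pdivrMr ?ltr_wpDl// mul1r.
  by rewrite lerDl.
have q5 : F (u_ n) - F u = a (u_ n - u) f0.
  by have HNu := psdN ha Hlu; rewrite (psd_sym ha (Hz n) Hf0) f0F// funcD// -[- u]scaleN1r funcZ// mulN1r.
have q6 : a u (u_ n) = a (u_ n) u by rewrite (psd_sym ha Hlu (Hu n)).
have q7 : a w (G (u_ n)) = a (G (u_ n)) w by rewrite (psd_sym ha Hw Gn).
have q8 := psd_sym ha Hr (Hz n).
rewrite (formBl ha)// (formBr ha)// (formBr ha)// q6 in q1.
rewrite (formBl ha)// (formBr ha)// (formBr ha)// q7 in q2.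
rewrite (formBl ha)// in h1.
rewrite -q5 in h2.
rewrite q8 in q3.
have := ler_norm (b w (u_ n) (u_ n - u)).
move: h1 h2 h3 q4; rewrite !ltr_norml !ler_norml => /andP[h1 h1'] /andP[h2 h2'] /andP[h3 h3'] /andP[q4 q4'] _.
rewrite /energy in Eu *; rewrite -/w.
move: (n.+1%:R^-1) h4 Eu => x h4 Eu.
lra.
Qed.

(** Symmetry of [b] gives, in pairings, [G (u + t w) = G u + t (2 d + t G w)] with [d] representing
    [b u w]. The energy along the segment is thus a polynomial in [t]; [X] is its first order
    coefficient and [t^2 Y] bounds the remainder for [t <= 1]. *)
Lemma energy_variational u v : K u -> (forall w, K w -> energy u <= energy w) -> K v ->
  0 <= a u (v - u) + 2 * b u (G u) (v - u) - F (v - u).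
Proof.
move=> Ku umin Kv; have [Hu Hv] := (KH Ku, KH Kv).
set w := v - u; have Hw : H w by exact: (psdB ha).
have [d Hd db] := trilinear_riesz Hu Hw.
have HGu := HG Hu; have HGw := HG Hw.
pose p t := 2 *: d + t *: G w.
have Hp t : H (p t) by apply: (psdD ha); exact: (psdZ ha).
have H2d := psdZ ha 2 Hd; have HtG t := psdZ ha t HGw.
pose P := 2 * N d + N (G w).
pose X := a u w + 2 * a (G u) d - F w.
pose Y := 1 / 2 * a w w + `|a (G u) (G w)| + P ^+ 2.
have Y0 : 0 <= Y by rewrite addr_ge0 ?sqr_ge0// addr_ge0// mulr_ge0 ?(psd_ge0 ha).
have -> : a u w + 2 * b u (G u) w - F w = X.
  by rewrite /X (psd_sym ha HGu Hd) db// (b_sym23 Hu HGu Hw).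
have key (t : R) : 0 < t -> t <= 1 -> 0 <= X + t * Y.
  move=> t0 t1.
  have Ht : H (u + t *: w) by apply: (psdD ha) => //; exact: (psdZ ha).
  have /umin : K (u + t *: w) by apply: K_convex => //; rewrite ltW.
  have Hg : H (G u + t *: p t) by apply: (psdD ha) => //; exact: (psdZ ha).
  (* The expansion of [G] is available only under the pairing with [z]. This is enough, because
     [a (G _) (G _)] can be rewritten in one argument after the other. *)
  have aGt z : H z -> a (G (u + t *: w)) z = a (G u + t *: p t) z.
    move=> Hz; have Htw := psdZ ha t Hw; rewrite aG//.
    rewrite (formDl ha)//; last exact: (psdZ ha).
    rewrite (formZl ha)// /p (formDl ha)// !(formZl ha)// !aG// db//.
    rewrite (b_sym23 Ht Ht Hz) (trilD Ht Hz Hu Htw) (trilZ _ Ht Hz Hw).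
    rewrite (b_sym12 Ht Hz Hu) (b_sym23 Hz Ht Hu) (trilD Hz Hu Hu Htw) (trilZ _ Hz Hu Hw).
    rewrite (b_sym12 Ht Hz Hw) (b_sym23 Hz Ht Hw) (trilD Hz Hw Hu Htw) (trilZ _ Hz Hw Hw).
    rewrite (b_sym12 Hz Hu Hu) (b_sym23 Hu Hz Hu).
    rewrite (b_sym12 Hz Hu Hw) (b_sym23 Hu Hz Hw).
    rewrite (b_sym12 Hz Hw Hu) (b_sym23 Hw Hz Hu) (b_sym12 Hw Hu Hz).
    rewrite (b_sym12 Hz Hw Hw) (b_sym23 Hw Hz Hw).
    by ring.
  rewrite /energy aGt; last exact: HG.
  rewrite (psd_sym ha Hg (HG Ht)) aGt// (form_quad ha t Hu Hw) (form_quad ha t HGu (Hp t)) funcD//; last exact: (psdZ ha).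
  rewrite funcZ//.
  have -> : a (G u) (p t) = 2 * a (G u) d + t * a (G u) (G w).
    by rewrite /p (formDr ha)// !(formZr ha).
  have pP : a (p t) (p t) <= P ^+ 2.
    rewrite -(sqr_seminorm ha (Hp t)) ler_pXn2r ?nnegrE ?seminorm_ge0 ?addr_ge0 ?mulr_ge0 ?seminorm_ge0//.
    apply: (le_trans (seminorm_triangle ha _ _))=> //.
    rewrite !(seminormZ ha)// ger0_norm// lerD2l gtr0_norm//.
    by rewrite ler_piMl ?seminorm_ge0.
  have h2 := ler_norm (a (G u) (G w)).
  rewrite -subr_ge0 => h.
  rewrite -(pmulr_rge0 _ t0); apply: (le_trans h).
  rewrite /X /Y.
  have := psd_ge0 ha Hw; set ww := a w w => ww0.
  have tt : 0 < t ^+ 2 by rewrite exprn_gt0.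
  have P20 := sqr_ge0 P.
  move: (a (p t) (p t)) (P ^+ 2) pP P20 `|_| h2 => pp P2 pP P20 y h2.
  rewrite -subr_ge0; set D := (X in 0 <= X).
  have -> : D = t ^+ 2 * (y - a (G u) (G w)) + t ^+ 2 * (P2 - pp) / 2 + t ^+ 2 * P2 / 2.
    by rewrite /D; field.
  have tt0 := ltW tt; rewrite -subr_ge0 in pP; rewrite -subr_ge0 in h2.
  have := mulr_ge0 tt0 pP; have := mulr_ge0 tt0 h2; have := mulr_ge0 tt0 P20.
  by move: (t ^+ 2 * (y - _)) (t ^+ 2 * (P2 - pp)) (t ^+ 2 * P2) => c1 c2 c3; lra.
rewrite leNgt; apply/negP => X0.
(* This [t] makes [t Y <= - X / 2], so that [X + t Y <= X / 2 < 0], against [key]. *)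
pose t := Num.min 1 (- X / (2 * (Y + 1))).
have Y1 : 0 < 2 * (Y + 1) by rewrite mulr_gt0// ltr_wpDl.
have t0 : 0 < t by rewrite lt_min ltr01 divr_gt0// oppr_gt0.
have t1 : t <= 1 by rewrite ge_min lexx.
have := key t t0 t1.
have : t * Y <= (- X / (2 * (Y + 1))) * (Y + 1).
  apply: ler_pM; rewrite ?(ltW t0)//; last by rewrite lerDl.
  by rewrite ge_min lexx orbT.
have -> : (- X / (2 * (Y + 1))) * (Y + 1) = - X / 2 by field; rewrite gt_eqF// ltr_wpDl.
lra.
Qed.

End AbstractEnergy.

(** * Smooth functions *)

Section Smooth.
Variable R : realType.
Local Notation P := (R * R)%type.
Implicit Types (g h : P -> R) (l : seq bool) (i : bool).

(** Coinduction for [smooth]: the class [C] is an invariant closed under both partial derivatives,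
    so no formula for an iterated derivative is ever needed. *)
Lemma smooth_of_class (C : set (P -> R)) g :
  (forall h, C h -> continuous h /\ forall i,
     (forall x, derivable h x (dir R i)) /\ C (fun x => derive h x (dir R i))) ->
  C g -> smooth g.
Proof.
move=> HC Cg l; have Cl : C (pder l g) by elim: l => [//|i l /HC [_ /(_ i) []]].
by have [cl dl] := HC _ Cl; split => // i x; exact: (dl i).1.
Qed.

Lemma pder_cat l1 l2 g : pder (l1 ++ l2) g = pder l1 (pder l2 g).
Proof. by elim: l1 => //= i l1 ->. Qed.

Lemma smooth_pder l g : smooth g -> smooth (pder l g).
Proof. by move=> sg l'; rewrite -pder_cat; exact: sg. Qed.

Lemma smooth_continuous l g : smooth g -> continuous (pder l g).
Proof. by move=> sg; exact: (sg l).1. Qed.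

Lemma smooth_derivable l g i x : smooth g -> derivable (pder l g) x (dir R i).
Proof. by move=> sg; exact: (sg l).2. Qed.

Lemma pder_linear l c g h : smooth g -> smooth h ->
  pder l (fun x => c * g x + h x) = (fun x => c * pder l g x + pder l h x).
Proof.
move=> sg sh; elim: l => [//|i l /= ->]; apply/funext => x.
rewrite (_ : (fun y => _) = (c *: pder l g) + pder l h) //.
rewrite deriveD; [|apply: derivableZ|]; try exact: smooth_derivable.
by rewrite deriveZ//; exact: smooth_derivable.
Qed.

Lemma smooth_linear c g h : smooth g -> smooth h -> smooth (fun x => c * g x + h x).
Proof.
move=> sg sh l; rewrite pder_linear//; split=> [|i] x.
  apply: cvgD; last exact: smooth_continuous.
  by apply: cvgMl_tmp; exact: smooth_continuous.
rewrite (_ : (fun y => _) = (c *: pder l g) + pder l h) //.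
by apply: derivableD; [apply: derivableZ|]; exact: smooth_derivable.
Qed.

(** Products of smooth functions are not closed under differentiation; by the Leibniz rule their
    finite sums are. This is the invariant for [smooth_mul]. *)
Inductive product_sum : set (P -> R) :=
| product_sum_mul g h : smooth g -> smooth h -> product_sum (fun x => g x * h x)
| product_sum_add g h : product_sum g -> product_sum h ->
    product_sum (fun x => g x + h x).

Lemma smooth_mul g h : smooth g -> smooth h -> smooth (fun x => g x * h x).
Proof.
move=> sg sh; apply: (@smooth_of_class product_sum); last exact: product_sum_mul.
move=> f; elim=> {f} [{sg sh}g {}h sg sh|{sg sh}g {}h Pg [cg dg] Ph [ch dh]].
  have [[cg dg] [ch dh]] := (sg [::], sh [::]).
  split=> [x|i]; first by apply: cvgM; [exact: cg|exact: ch].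
  split=> [x|]; first by apply: derivableM; [exact: dg|exact: dh].
  rewrite (_ : (fun x => _) =
     fun x => g x * pder [:: i] h x + h x * pder [:: i] g x); last first.
    by apply/funext => x /=; rewrite (deriveM (dg i x) (dh i x)).
  exact: (product_sum_add (product_sum_mul sg (smooth_pder [:: i] sh))
    (product_sum_mul sh (smooth_pder [:: i] sg))).
split=> [x|i]; first by apply: cvgD; [exact: cg|exact: ch].
split=> [x|]; first by apply: derivableD; [exact: (dg i).1|exact: (dh i).1].
rewrite (_ : (fun x => _) =
    fun x => derive g x (dir R i) + derive h x (dir R i)); last first.
  by apply/funext => x /=; rewrite (deriveD ((dg i).1 x) ((dh i).1 x)).
by apply: product_sum_add; [exact: (dg i).2|exact: (dh i).2].
Qed.

Lemma pder1_mul i g h : smooth g -> smooth h -> pder [:: i] (fun x => g x * h x) =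
  fun x => pder [:: i] g x * h x + g x * pder [:: i] h x.
Proof.
move=> sg sh; apply/funext => x /=.
have := deriveM (@smooth_derivable [::] g i x sg) (@smooth_derivable [::] h i x sh).
by rewrite /= => ->; rewrite addrC [X in X + _]mulrC.
Qed.

Lemma smooth0 : smooth (fun _ : P => 0 : R).
Proof.
apply: (@smooth_of_class [set fun _ => 0]) => // _ -> /=.
split=> [x|i]; first exact: cvg_cst.
split=> [x|]; first exact: derivable_cst.
by apply/funext => x; rewrite derive_cst.
Qed.

Lemma derive_dirE g (x y : R) i :
  (fun h : R => h^-1 *: ((g \o shift (x, y)) (h *: dir R i) - g (x, y))) =
  if i then (fun h : R => h^-1 *: (((fun s => g (s, y)) \o shift x) (h *: 1) - g (x, y)))
  else (fun h : R => h^-1 *: (((fun s => g (x, s)) \o shift y) (h *: 1) - g (x, y))).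
Proof.
case: i; apply/funext => h /=; congr (_ *: (g _ - _));
  by apply/pair_equal_spec; split => //=; rewrite scaler0 add0r.
Qed.

Lemma derivable_dir g (x y : R) i : derivable g (x, y) (dir R i) <->
  if i then derivable (fun s => g (s, y)) x 1 else derivable (fun s => g (x, s)) y 1.
Proof. by rewrite /derivable derive_dirE; case: i. Qed.

Lemma derive_dir g (x y : R) i : derive g (x, y) (dir R i) =
  if i then derive (fun s => g (s, y)) x 1 else derive (fun s => g (x, s)) y 1.
Proof. by rewrite /derive derive_dirE; case: i. Qed.

End Smooth.

(** * Smooth functions built from exp(-1/x) *)

Section FlatFunctions.
Variable R : realType.

(* The polynomial factor makes this family closed under differentiation. *)
Definition flat (p : {poly R}) (x : R) : R :=
  if 0 < x then p.[x^-1] * expR (- x^-1) else 0.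

(** Each monomial is beaten by one term of the exponential series, [t^(i+2) <= (i+2)! exp t]. Two
    powers are kept to spare: at [t = 1/x] they give the bound [C x^2], hence a vanishing derivative
    at the origin. *)
Lemma poly_expRN_bound (p : {poly R}) : exists2 C : R, 0 <= C &
  forall t, 0 < t -> `|p.[t]| * expR (- t) <= C / t ^+ 2.
Proof.
exists (\sum_(i < size p) `|p`_i| * (i.+2)`!%:R).
  by apply: sumr_ge0 => i _; rewrite mulr_ge0.
move=> t t0; rewrite horner_coef.
apply: (@le_trans _ _ ((\sum_(i < size p) `|p`_i * t ^+ i|) * expR (- t))).
  by rewrite ler_wpM2r ?expR_ge0// ler_norm_sum.
rewrite !mulr_suml; apply: ler_sum => i _.
rewrite normrM -!mulrA ler_wpM2l// normrX gtr0_norm//.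
rewrite expRN ler_pdivrMr ?expR_gt0// -mulrA -ler_pdivrMl ?ltr0n ?fact_gt0//.
rewrite ler_pdivlMl ?exprn_gt0// mulrCA -exprD mulrC.
by have := expR_ge1Dxn i.+1 (ltW t0); lra.
Qed.

Lemma flat_bound (p : {poly R}) : exists2 C : R, 0 <= C & forall x, `|flat p x| <= C * x ^+ 2.
Proof.
have [C C0 hC] := poly_expRN_bound p; exists C => // x; rewrite /flat.
case: ifP => x0; last by rewrite normr0 mulr_ge0// sqr_ge0.
rewrite normrM (ger0_norm (expR_ge0 _)).
have := hC x^-1; rewrite invr_gt0 exprVn invrK; exact.
Qed.

(** The factor ['X^2] comes from the chain rule for [1/x], the difference from differentiating [p]
    and the exponential. *)
Definition dflat (p : {poly R}) : {poly R} := 'X^2 * (p - p^`()).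

Lemma is_derive_flat (p : {poly R}) (x : R) : is_derive x 1 (flat p) (flat (dflat p) x).
Proof.
have [x0|x0|->] := ltgtP x 0.
- rewrite {2}/flat ltNge (ltW x0) /=.
  have d0 : is_derive x 1 (cst (0 : R) : R -> R) 0 by exact: is_derive_cst.
  apply: (near_eq_is_derive _ d0).
  near=> y; rewrite /flat ifF//; apply/negbTE; rewrite -leNgt ltW//.
  by near: y; exact: lt_nbhsl.
- have xn0 : x != 0 by rewrite gt_eqF.
  have dV : is_derive x 1 (fun y : R => y^-1) (- x ^- 2 *: 1) by exact: is_deriveV.
  have dP := is_derive1_comp (is_derive_poly p x^-1) dV.
  have dE := @is_derive1_comp R expR (fun y => - y^-1) x _ _
    (is_derive_expR _) (is_deriveN dV).
  apply: (near_eq_is_derive _ (is_derive_eq (is_deriveM dP dE) _)).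
    near=> y; rewrite /flat ifT//; near: y; exact: lt_nbhsr.
  rewrite /flat x0 /dflat !hornerE /= /GRing.scale /= !mulr1.
  by rewrite -exprVn; ring.
rewrite {2}/flat ltxx.
have [C C0 hC] := flat_bound p.
have f0 : flat p 0 = 0 by rewrite /flat ltxx.
(* At the junction point the quadratic bound makes the difference quotient at most [C |h|]. *)
have cv : h^-1 *: ((flat p \o shift 0) (h *: 1) - flat p 0) @[h --> 0^'] --> (0 : R).
  apply/cvgrPdist_le => e e0.
  near=> h.
  rewrite sub0r normrN /= addr0 f0 subr0 normrZ normfV /GRing.scale /= mulr1.
  have h0 : 0 < `|h| by rewrite normr_gt0; near: h; exact: nbhs_dnbhs_neq.
  have hb : `|h| <= e / (C + 1).
    by near: h; apply: dnbhs0_le; rewrite divr_gt0// ltr_wpDl.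
  rewrite ler_pdivrMl//; apply: (le_trans (hC h)).
  rewrite -[h ^+ 2]ger0_norm ?sqr_ge0// normrX expr2 mulrCA ler_wpM2l//.
  apply: (@le_trans _ _ ((C + 1) * `|h|)); first by rewrite ler_wpM2r// lerDl.
  by rewrite mulrC -ler_pdivlMr ?ltr_wpDl.
by split; [apply/cvg_ex; exists 0|exact: cvg_lim].
Unshelve. all: by end_near. Qed.

Lemma smooth_flat_affine (i : bool) (p : {poly R}) (k s : R) :
  smooth (fun x : R * R => flat p (k * (if i then x.1 else x.2) + s)).
Proof.
pose pr (x : R * R) := if i then x.1 else x.2.
pose C := [set f : R * R -> R | exists p, f = fun x => flat p (k * pr x + s)].
apply: (@smooth_of_class _ C); last by exists p.
move=> _ [q ->].
have dq j x y : is_derive (x, y) (dir R j) (fun x => flat q (k * pr x + s))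
    (flat ((if i == j then k else 0) *: dflat q) (k * pr (x, y) + s)).
  have h (t : R) : is_derive t 1 (fun t => flat q (k * t + s)) (flat (k *: dflat q) (k * t + s)).
    have d1 : is_derive t 1 (fun t => k * t + s) k.
      by apply: is_derive_eq; rewrite /GRing.scale /= ?mulr1 ?addr0 ?mulr0; ring.
    have dc : is_derive t 1 (fun t => flat q (k * t + s)) (flat (dflat q) (k * t + s) * k).
      exact: (@is_derive1_comp R (flat q) (fun t => k * t + s) t _ _ (is_derive_flat q _) d1).
    apply: is_derive_eq dc _.
    by rewrite /flat; case: ifP => _; rewrite ?hornerZ ?mul0r//; ring.
  (* The derivative in the other coordinate is the member of the class with polynomial 0, so the
     class is closed in both directions. *)
  have z (t : R) : flat (0 *: dflat q) t = 0.
    by rewrite /flat scale0r horner0 mul0r if_same.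
  rewrite /pr; split.
    by apply/derivable_dir; case: (i) j => -[] /=; [case: (h x)|exact: derivable_cst|exact: derivable_cst|case: (h y)].
  by rewrite derive_dir; case: (i) j => -[] /=; rewrite ?z;
    [case: (h x)|exact: derive_cst|exact: derive_cst|case: (h y)].
have cf t : {for t, continuous (flat q)}.
  by apply/differentiable_continuous/derivable1_diffP; case: (is_derive_flat q t).
split=> [x|j].
  apply: (@continuous_comp _ _ _ (fun x : R * R => k * pr x + s) (flat q)); last exact: cf.
  apply: cvgD; last exact: cvg_cst.
  apply: cvgMl_tmp; rewrite /pr; case: (i); [exact: cvg_fst|exact: cvg_snd].
split=> [[x y]|]; first by case: (dq j x y).
by exists ((if i == j then k else 0) *: dflat q); apply/funext => -[x y]; have [] := dq j x y.
Qed.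

End FlatFunctions.

(** * Square integrable functions *)

Lemma cvg_sqr_EFin (R : realType) (a : nat -> R) (l : R) : a @ \oo --> l ->
  ((a j) ^+ 2)%:E @[j --> \oo] --> (l ^+ 2)%:E.
Proof.
move=> al; apply: cvg_EFin; first exact: nearW.
exact: (cvgM al al).
Qed.

Section SquareIntegrable.
Context d (T : measurableType d) (R : realType).
Variables (mu : {measure set T -> \bar R}) (D : set T).
Hypothesis mD : measurable D.
Implicit Types f g : T -> R.

(** [L2] and [ip] are the instances for [mu2], by conversion. *)
Definition sqint : set (T -> R) := [set f : T -> R | measurable_fun D f /\
  mu.-integrable D (fun x => ((f x) ^+ 2)%:E)].

Definition sqip f g : R := (\int[mu]_(x in D) (f x * g x))%R.

Lemma sqint_mul f g : sqint f -> sqint g ->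
  mu.-integrable D (EFin \o (fun x => f x * g x)).
Proof.
move=> [mf f2] [mg g2].
apply: (le_integrable mD _ _ (integrableD mD f2 g2)).
  by apply/measurable_EFinP; exact: measurable_funM.
move=> x Dx /=; rewrite lee_fin.
rewrite [leRHS]ger0_norm ?addr_ge0 ?sqr_ge0//.
rewrite ler_norml; have := sqr_ge0 (f x + g x); have := sqr_ge0 (f x - g x).
have := sqr_ge0 (f x); have := sqr_ge0 (g x).
rewrite sqrrB sqrrD; set a := f x ^+ 2; set b := g x ^+ 2 => h1 h2 h3 h4.
by apply/andP; split; lra.
Qed.

Lemma sqint0 : sqint 0.
Proof.
split; first exact: measurable_cst.
rewrite (_ : (fun x => _) = cst 0%E); first exact: integrable0.
by apply/funext => x; rewrite expr0n.
Qed.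

Lemma sqint_lin c f g : sqint f -> sqint g -> sqint (c *: f + g).
Proof.
move=> sf sg; have [mf f2] := sf; have [mg g2] := sg.
have mcf : measurable_fun D (fun x => c * f x).
  by apply: measurable_funM => //; exact: measurable_cst.
split; first exact: measurable_funD.
have -> : (fun x => (((c *: f + g) x) ^+ 2)%:E) =
    ((fun x => (c ^+ 2)%:E * (f x ^+ 2)%:E) \+ ((fun x => (2 * c)%:E *
     (EFin \o (fun x => (f x * g x)%R)) x) \+ (fun x => (g x ^+ 2)%:E)))%E.
  apply/funext => x /=; rewrite -!EFinM -!EFinD; congr EFin.
  by rewrite (_ : (c *: f + g) x = c * f x + g x)//; ring.
apply: integrableD => //; first exact: integrableZl.
by apply: integrableD => //; apply: integrableZl => //; exact: sqint_mul.
Qed.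

Lemma sqip_psd : psd_form sqint sqip.
Proof.
split.
- exact: sqint0.
- exact: sqint_lin.
- move=> c u v w su sv sw; rewrite /sqip.
  rewrite (_ : (fun x => _) = (fun x => c * (u x * w x) + v x * w x)); last first.
    by apply/funext => x; rewrite !fctE /GRing.scale/=; ring.
  rewrite RintegralD//; last 2 first.
  - rewrite (_ : _ \o _ = (fun x => c%:E * (EFin \o (fun x => (u x * w x)%R)) x)%E).
      by apply: integrableZl => //; exact: sqint_mul.
    by apply/funext => x /=; rewrite EFinM.
  - exact: sqint_mul.
  by rewrite RintegralZl//; exact: sqint_mul.
- by move=> u v _ _; apply: eq_Rintegral => x _; rewrite mulrC.
- by move=> u _; apply: Rintegral_ge0 => x _; rewrite -expr2 sqr_ge0.
Qed.

Lemma sqip_EFin f g : sqint f -> sqint g ->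
  (sqip f g)%:E = (\int[mu]_(x in D) (f x * g x)%:E)%E.
Proof.
by move=> sf sg; rewrite /sqip /Rintegral fineK//; apply: integrable_fin_num => //; exact: sqint_mul.
Qed.

Lemma integral_sqr_EFin f : sqint f ->
  (\int[mu]_(x in D) ((f x) ^+ 2)%:E)%E = (seminorm sqip f ^+ 2)%:E.
Proof. by move=> sf; rewrite (sqr_seminorm sqip_psd sf) sqip_EFin. Qed.

Lemma sqint_aeP f : sqint f -> sqip f f = 0 -> ae_eq mu D f (cst 0).
Proof.
move=> sf f0; have [mf _] := sf.
have : (\int[mu]_(x in D) `|((f x) ^+ 2)%:E|)%E = 0%E.
  under eq_integral do rewrite gee0_abs ?lee_fin ?sqr_ge0//.
  by rewrite -[RHS]/((0 : R)%:E) -f0 sqip_EFin.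
move=> /ae_eq_integral_abs => /(_ mD) H.
have /H : measurable_fun D (fun x => ((f x) ^+ 2)%:E).
  by apply/measurable_EFinP; apply: measurable_funM.
by apply: filterS => x h /h [/eqP]; rewrite sqrf_eq0 => /eqP.
Qed.

Lemma sqip_ae f f' g g' : measurable_fun D f -> measurable_fun D f' ->
  measurable_fun D g -> measurable_fun D g' ->
  ae_eq mu D f f' -> ae_eq mu D g g' -> sqip f g = sqip f' g'.
Proof.
move=> mf mf' mg mg' ff gg; rewrite /sqip /Rintegral; congr fine.
apply: ae_eq_integral => //; try by apply/measurable_EFinP; exact: measurable_funM.
by rewrite /ae_eq; apply: filterS2 ff gg => x h1 h2 Dx; rewrite h1// h2.
Qed.

(** Fatou's lemma for the squares. Upper and lower limits stand in for the limit, which exists only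
    almost everywhere, and the shift by [J] discards the terms without a bound. *)
Lemma sqint_fatou (v : nat -> T -> R) (w : T -> R) (e : R) : 0 <= e ->
  (forall j, sqint (v j)) -> measurable_fun D w ->
  {ae mu, forall x, D x -> v j x @[j --> \oo] --> w x} ->
  (exists J, forall j, (J <= j)%N -> seminorm sqip (v j) <= e) ->
  sqint w /\ seminorm sqip w <= e.
Proof.
move=> e0 sv mw cv [J hJ].
have mw2 : measurable_fun D (fun x => ((w x) ^+ 2)%:E).
  by apply/measurable_EFinP; apply: measurable_funM.
have mv2 j : measurable_fun D (fun x => ((v j x) ^+ 2)%:E).
  by have [mv _] := sv j; apply/measurable_EFinP; apply: measurable_funM.
have le2 : (\int[mu]_(x in D) ((w x) ^+ 2)%:E <= (e ^+ 2)%:E)%E.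
  apply: (@le_trans _ _ (\int[mu]_(x in D) limn_esup (fun j => ((v (J + j)%N x) ^+ 2)%:E))%E).
    rewrite le_eqVlt; apply/orP; left; apply/eqP; apply: ae_eq_integral => //.
      by apply: measurable_fun_limn_esup => j; exact: mv2.
    apply: filterS cv => x cx Dx.
    have cv2 := cvg_sqr_EFin (cvg_comp _ _ (@cvg_addnl J) (cx Dx)).
    by rewrite (cvg_limn_einf_sup cv2).2.
  rewrite (_ : (\int[mu]_(x in D) _)%E =
    (\int[mu]_(x in D) limn_einf (fun j => ((v (J + j)%N x) ^+ 2)%:E))%E); last first.
    apply: ae_eq_integral => //.
    - by apply: measurable_fun_limn_esup => j; exact: mv2.
    - rewrite /limn_einf; apply: measurableT_comp => //.
      apply: measurable_fun_limn_esup => j; apply: measurableT_comp => //; exact: mv2.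
    apply: filterS cv => x cx Dx.
    have cv2 := cvg_sqr_EFin (cvg_comp _ _ (@cvg_addnl J) (cx Dx)).
    by rewrite (cvg_limn_einf_sup cv2).2 (cvg_limn_einf_sup cv2).1.
  apply: (le_trans (fatou _ mD _ _)) => [j|j x _|]; [exact: mv2|by rewrite lee_fin sqr_ge0|].
  rewrite limn_einf_lim; apply: lime_le; first exact: is_cvg_einfs.
  apply: nearW => m; apply: ereal_inf_le.
  exists (\int[mu]_(x in D) ((v (J + m)%N x) ^+ 2)%:E)%E; first by exists m => /=.
  rewrite integral_sqr_EFin// lee_fin ler_pXn2r ?nnegrE ?seminorm_ge0//.
  by apply: hJ; exact: leq_addr.
have sw : sqint w.
  split=> //; apply/integrableP; split => //.
  under eq_integral do rewrite gee0_abs ?lee_fin ?sqr_ge0//.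
  exact: le_lt_trans le2 (ltry _).
split=> //; move: le2.
by rewrite integral_sqr_EFin// lee_fin ler_pXn2r ?nnegrE ?seminorm_ge0.
Qed.

(** The rate enters squared, so the increments [w j] may be weighted: the sum of [4^j (w j)^2] still
    has a finite integral and is finite almost everywhere. There [|w j| <= 4^-j + 4^j (w j)^2] makes
    the telescoping series absolutely convergent. *)
Lemma sqint_rapid_cvg (v : nat -> T -> R) : (forall j, sqint (v j)) ->
  (forall j, seminorm sqip (v j.+1 - v j) <= (4^-1) ^+ j) ->
  {ae mu, forall x, D x -> cvgn (v ^~ x)}.
Proof.
move=> sv hv; pose w j := v j.+1 - v j.
have sw j : sqint (w j) by exact: (psdB sqip_psd).
pose h j x : \bar R := (4 ^+ j * (w j x) ^+ 2)%:E.
have mh j : measurable_fun D (h j).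
  have [mw _] := sw j; apply/measurable_EFinP; apply: measurable_funM => //.
  exact: measurable_funM.
have h0 j x : D x -> (0 <= h j x)%E by rewrite lee_fin mulr_ge0 ?sqr_ge0 ?exprn_ge0.
have ih j : (\int[mu]_(x in D) h j x <= ((4^-1) ^+ j)%:E)%E.
  under eq_integral do rewrite /h EFinM.
  have [_ iw] := sw j.
  rewrite integralZl// integral_sqr_EFin// -EFinM lee_fin.
  have -> : (4^-1) ^+ j = 4 ^+ j * ((4^-1) ^+ j) ^+ 2 :> R.
    by rewrite expr2 mulrA -exprMn mulfV// expr1n mul1r.
  rewrite ler_wpM2l ?exprn_ge0// ler_pXn2r ?nnegrE ?seminorm_ge0 ?exprn_ge0 ?invr_ge0//.
  exact: hv.
have ltS : (\int[mu]_(x in D) (\sum_(0 <= j <oo) h j x) < +oo)%E.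
  rewrite integral_nneseries//.
  apply: (@le_lt_trans _ _ (4 / 3)%:E); last exact: ltry.
  apply: lime_le.
    by apply: is_cvg_nneseries => n _ _; apply: integral_ge0 => x Dx; exact: h0.
  apply: nearW => n; apply: (@le_trans _ _ (\sum_(0 <= j < n) ((4^-1 : R) ^+ j)%:E)%E).
    by apply: lee_sum => j _; exact: ih.
  rewrite sumEFin lee_fin.
  have -> : \sum_(0 <= j < n) (4^-1) ^+ j = (1 - (4^-1) ^+ n) * (4 / 3) :> R.
    elim: n => [|n IH]; first by rewrite big_geq// expr0 subrr mul0r.
    by rewrite big_nat_recr//= IH exprS; field.
  have : 0 <= (4^-1 : R) ^+ n by rewrite exprn_ge0 ?invr_ge0.
  by move: (_ ^+ n) => t t0; lra.
have mS : measurable_fun D (fun x => \sum_(0 <= j <oo) h j x)%E.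
  by apply: ge0_emeasurable_sum => [k x Dx _|k _]; [exact: h0|exact: mh].
have iS : mu.-integrable D (fun x => \sum_(0 <= j <oo) h j x)%E.
  apply/integrableP; split=> //.
  rewrite (eq_integral (fun x => \sum_(0 <= j <oo) h j x)%E)// => x /set_mem Dx.
  by rewrite gee0_abs// nneseries_ge0// => n _ _; exact: h0.
apply: filterS (integrable_ae mD iS) => x hx Dx.
have := hx Dx; move: (hx Dx) => /fineK hS _.
set M := fine _ in hS.
have sM n : \sum_(0 <= j < n) (4 ^+ j * (w j x) ^+ 2) <= M.
  rewrite -lee_fin hS -sumEFin; apply: nneseries_lim_ge => j _ _; exact: h0.
have cs : cvgn (series (fun j => w j x)).
  apply: normed_cvg; apply: nondecreasing_is_cvgn.
    by apply/nondecreasing_seqP => n /=; rewrite /series /= big_nat_recr//= lerDl.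
  exists (4 / 3 + M) => _ [n _ <-]; rewrite /series /=.
  apply: (@le_trans _ _ (\sum_(0 <= j < n) ((4^-1) ^+ j + 4 ^+ j * (w j x) ^+ 2))).
    apply: ler_sum => j _.
    have p4 : 0 < 4 ^+ j :> R by rewrite exprn_gt0.
    rewrite exprVn; set q := 4 ^+ j in p4 *.
    rewrite -[w j x ^+ 2]real_normK ?num_real//; set y := `|_|.
    have y0 : 0 <= y by exact: normr_ge0.
    have -> : q^-1 + q * y ^+ 2 = y + ((q * y - 1) ^+ 2 + q * y) / q.
      by field; rewrite gt_eqF.
    by rewrite lerDl divr_ge0 ?(ltW p4)// addr_ge0 ?sqr_ge0// mulr_ge0// ltW.
  rewrite big_split /= lerD//.
  have -> : \sum_(0 <= j < n) (4^-1) ^+ j = (1 - (4^-1) ^+ n) * (4 / 3) :> R.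
    elim: n => [|n IH]; first by rewrite big_geq// expr0 subrr mul0r.
    by rewrite big_nat_recr//= IH exprS; field.
  have : 0 <= (4^-1 : R) ^+ n by rewrite exprn_ge0 ?invr_ge0.
  by move: (_ ^+ n) => t t0; lra.
rewrite (_ : v ^~ x = (fun n => v 0%N x + series (fun j => w j x) n)).
  by apply: is_cvgD => //; exact: is_cvg_cst.
apply/funext => n; rewrite /series /= (@telescope_sumr _ 0 n (v ^~ x))//.
by rewrite addrC subrK.
Qed.

(** Riesz-Fischer: a rapidly Cauchy subsequence converges almost everywhere, and Fatou's lemma along
    it, applied to [u n - v j] with [n] fixed, yields convergence of the whole sequence. *)
Lemma sqip_complete : form_complete sqint sqip.
Proof.
move=> u su cu.
have /choice [k hk] : forall j, exists N, forall m n, (N <= m)%N -> (N <= n)%N ->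
    seminorm sqip (u m - u n) <= (4^-1) ^+ j.
  by move=> j; apply: cu; rewrite exprn_gt0// invr_gt0.
(* The sum dominates every [k i] with [i <= j], so both [K j] and [K j.+1] lie beyond [k j]; the
   summand [j] makes [K] unbounded. *)
pose K j := (\sum_(i < j.+1) k i + j)%N.
have kK i j : (i <= j)%N -> (k i <= K j)%N.
  by move=> ij; rewrite /K (bigD1 (Ordinal (ij : (i < j.+1)%N)))//= -addnA leq_addr.
pose v j := u (K j).
have sv j : sqint (v j) by exact: su.
have av : {ae mu, forall x, D x -> cvgn (v ^~ x)}.
  apply: sqint_rapid_cvg => // j.
  by apply: hk; apply: kK.
(* The upper limit is measurable without any convergence; [fine] only matters on the null set where
   [v] does not converge. *)
pose w x := fine (limn_esup (fun j => (v j x)%:E)).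
have mw : measurable_fun D w.
  apply: measurableT_comp; first exact: measurable_realfun.fine_measurable.
  by apply: measurable_fun_limn_esup => j; apply/measurable_EFinP; exact: (sv j).1.
have vw : {ae mu, forall x, D x -> v j x @[j --> \oo] --> w x}.
  apply: filterS av => x cx Dx; have /cvg_ex[l hl] := cx Dx.
  suff -> : w x = l by [].
  have cl : (v j x)%:E @[j --> \oo] --> l%:E by apply: cvg_EFin => //; exact: nearW.
  by rewrite /w (cvg_limn_einf_sup cl).2.
have key e : 0 < e -> exists N, forall n, (N <= n)%N ->
    sqint (u n - w) /\ seminorm sqip (u n - w) <= e.
  move=> e0; have [N hN] := cu e e0; exists N => n Nn.
  apply: (@sqint_fatou (fun j => u n - v j)) => //; first exact: ltW.
  - by move=> j; exact: (psdB sqip_psd).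
  - by apply: measurable_funB => //; exact: (su n).1.
  - apply: filterS vw => x cx Dx; apply: cvgB; [exact: cvg_cst|exact: cx].
  - exists N => j Nj; apply: hN => //; apply: leq_trans Nj _; exact: leq_addl.
have [N hN] := key 1 ltr01.
have sw : sqint w.
  have [h _] := hN N (leqnn N).
  have -> : w = u N - (u N - w) by rewrite opprB addrC subrK.
  exact: (psdB sqip_psd).
by exists w => // e /key [M hM]; exists M => n Mn; have [] := hM n Mn.
Qed.

End SquareIntegrable.

(** * Calculus on the plane *)

(* [mu2] is [leb2] (by conversion) bundled as a measure on the Borel plane. *)
Definition plane (R : realType) : measurableType _ :=
  (measurableTypeR R * measurableTypeR R)%type.

Definition mu2 (R : realType) : {measure set (plane R) -> \bar R} :=
  (@lebesgue_measure R \x @lebesgue_measure R)%E.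

Section PlaneMeasure.
Variable R : realType.
Local Notation P := (R * R)%type.
Implicit Types (g : P -> R) (A : set P).

Definition square (x : P) (r : R) : set P := [set y | `|x.1 - y.1| <= r /\ `|x.2 - y.2| <= r].

Lemma square_itv (x : P) r :
  square x r = `[x.1 - r, x.1 + r]%classic `*` `[x.2 - r, x.2 + r]%classic.
Proof.
by apply/seteqP; split=> -[y1 y2]; rewrite /square /= !in_itv /= !ler_distlC.
Qed.

Lemma square_compact (x : P) r : compact (square x r).
Proof. by rewrite square_itv; apply: compact_setX; exact: segment_compact. Qed.

Lemma nbhs_square (x : P) A : nbhs x A -> exists2 r, 0 < r & square x r `<=` A.
Proof.
move=> /nbhs_ballP[e /= e0 eA]; exists (e / 2); first by rewrite divr_gt0.
move=> y [h1 h2]; apply: eA; rewrite /ball /=; split; rewrite /ball /=.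
  by apply: (le_lt_trans h1); rewrite ltr_pdivrMr// ltr_pMr// ltr1n.
by apply: (le_lt_trans h2); rewrite ltr_pdivrMr// ltr_pMr// ltr1n.
Qed.

Lemma square_nbhs (x : P) r : 0 < r -> nbhs x (square x r).
Proof.
move=> r0; apply/nbhs_ballP; exists r => //= y [h1 h2].
by split; apply: ltW.
Qed.

Definition osquare (x : P) (r : R) : set P :=
  `]x.1 - r, x.1 + r[%classic `*` `]x.2 - r, x.2 + r[%classic.

Lemma osquare_square (x : P) r : osquare x r `<=` square x r.
Proof.
by rewrite square_itv => y [h1 h2]; split; apply: subset_itv_oo_cc.
Qed.

(** A countable cover by rational squares. The index asks for the closed square to lie in [A]:
    compact supports inside [A] are then at hand when the cover is used with test functions. *)
Lemma open_bigcup_square A : open A ->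
  A = \bigcup_(q in [set q : rat * rat * nat |
    square (ratr q.1.1, ratr q.1.2) q.2.+1%:R^-1 `<=` A])
    osquare (ratr q.1.1, ratr q.1.2) q.2.+1%:R^-1.
Proof.
move=> oA; apply/seteqP; split=> [x Ax|x [q qA /osquare_square/qA//]].
have [e e0 eA] := nbhs_square (open_nbhs_nbhs (conj oA Ax)).
have e2 : 0 < e / 2 by rewrite divr_gt0.
have [n _ /(_ n (leqnn n)) hn] := near_infty_natSinv_lt (PosNum e2).
have n0 : 0 < n.+1%:R^-1 :> R by rewrite invr_gt0.
have lt2 (a t : R) : 0 < a -> t - a < t + a by lra.
have ex (t : R) : exists q : rat, t \in `]ratr q - n.+1%:R^-1, ratr q + n.+1%:R^-1[.
  have [q] := @rat_in_itvoo R (t - n.+1%:R^-1) (t + n.+1%:R^-1) (lt2 _ t n0).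
  rewrite in_itv /= => /andP[h1 h2]; exists q.
  rewrite in_itv /=; move: (n.+1%:R^-1) h1 h2 => a h1 h2.
  by apply/andP; split; lra.
have [[q1 h1] [q2 h2]] := (ex x.1, ex x.2).
have {}ex (q : rat) (t : R) : t \in `]ratr q - n.+1%:R^-1, ratr q + n.+1%:R^-1[ ->
    `|ratr q - t| <= n.+1%:R^-1.
  rewrite in_itv /=; move: (n.+1%:R^-1) => a /andP[k1 k2].
  by rewrite ler_norml; apply/andP; split; lra.
exists (q1, q2, n); last by split.
move=> y [/= k1 k2]; apply: eA; move/ex: h1 => h1; move/ex: h2 => h2; split.
  rewrite -[x.1](subrK (ratr q1)) -addrA; apply: (le_trans (ler_normD _ _)).
  rewrite distrC; move: (`|_|) (`|_|) (n.+1%:R^-1) h1 k1 hn => a b c /= h1 k1 hn.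
  lra.
rewrite -[x.2](subrK (ratr q2)) -addrA; apply: (le_trans (ler_normD _ _)).
rewrite distrC; move: (`|_|) (`|_|) (n.+1%:R^-1) h2 k2 hn => a b c /= h2 k2 hn.
lra.
Qed.

Lemma measurable_square (x : P) r : measurable (square x r : set (plane R)).
Proof. by rewrite square_itv; apply: measurableX; exact: measurable_itv. Qed.

Lemma measurable_osquare (x : P) r : measurable (osquare x r : set (plane R)).
Proof. by apply: measurableX; exact: measurable_itv. Qed.

Lemma open_measurable_plane A : open A -> measurable (A : set (plane R)).
Proof.
move=> /open_bigcup_square ->; rewrite bigcup_mkcond.
apply: countable_bigcupT_measurable => [|q]; first exact: countableP.
by case: ifP => _; [exact: measurable_osquare|exact: measurable0].
Qed.

Lemma continuous_measurable_plane g : continuous g ->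
  measurable_fun [set: plane R] (g : plane R -> R).
Proof.
move=> cg; apply: (measurability _ (RGenOpens.measurableE R)).
move=> _ [_ [a [b ->] <-]]; rewrite setTI; apply: open_measurable_plane.
by apply: open_comp => // *; exact: cg.
Qed.

Lemma mu2_square (x : P) r : (mu2 R (square x r) < +oo)%E.
Proof.
rewrite square_itv /mu2 /= product_measure1E//=; try exact: measurable_itv.
rewrite !lebesgue_measure_itv /=.
by case: ifP => _; case: ifP => _; rewrite -?EFinB ?mule0 ?mul0e ?ltry// -EFinM ltry.
Qed.

(** The strict inequalities make the region open, so the derivatives vanish there as well. *)
Definition vanish_off (M : R) g := forall x : P, M < `|x.1| \/ M < `|x.2| -> g x = 0.

Lemma vanish_off_restrict M g : vanish_off M g -> g \_ (square (0, 0) M) = g.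
Proof.
move=> Mg; apply/funext => x; rewrite patchE; case: ifPn => // /negP nx.
rewrite Mg//; apply: contrapT => /not_orP[/negP h1 /negP h2]; apply: nx; apply/mem_set.
by rewrite /square /= !sub0r !normrN; split; rewrite leNgt; apply/negP/negP.
Qed.

Lemma integrable_vanish_off M g : continuous g -> vanish_off M g ->
  (mu2 R).-integrable setT (EFin \o g).
Proof.
move=> cg Mg; rewrite -(vanish_off_restrict Mg) -restrict_EFin.
apply: (integrable_mkcond _ (measurable_square (0, 0) M)).1.
apply: measurable_bounded_integrable.
- exact: measurable_square.
- exact: mu2_square.
- by apply: measurable_funS (continuous_measurable_plane cg).
have [|B [Br hB]] := @compact_bounded R R (g @` square (0, 0) M).
  by apply: continuous_compact; [exact: continuous_subspaceT|exact: square_compact].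
by exists B; split => // K /hB h x Ax; apply: h; exists x.
Qed.

Lemma derive_near0 (V : normedModType R) (f : V -> R) (x v : V) :
  (\forall y \near x, f y = 0) -> derive f x v = 0.
Proof.
move=> f0; rewrite (near_eq_derive (g := cst 0)) ?derive_cst//.
Qed.

Lemma integral_derive_Nyc (f : R -> R) (M b : R) :
  (forall x, derivable f x 1) -> continuous (fun x => derive f x 1) ->
  (forall x, M < `|x| -> f x = 0) ->
  (\int[lebesgue_measure]_(x in `]-oo, b]) (derive f x 1)%:E)%E = (f b)%:E.
Proof.
move=> df cf f0.
(* Left of [a + 1] the function is zero on a neighbourhood of each point, hence so is its
   derivative; the margin 1 also gives [a < b] and [f a = 0]. *)
pose a := Num.min (- `|M|) b - 1.
have aM x : x < a + 1 -> M < `|x|.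
  rewrite /a subrK lt_min => /andP[h _].
  have := ler_norm M; have := ler_norm (- x); rewrite normrN; lra.
have ab1 : a + 1 <= b by rewrite /a subrK ge_min lexx orbT.
have ab : a < b by lra.
have df0 x : x < a + 1 -> derive f x 1 = 0.
  move=> xa; apply: derive_near0; near=> y; rewrite f0//; apply: aM.
  by near: y; exact: lt_nbhsl.
rewrite integral_mkcond.
rewrite (_ : _ \_ _ = ((fun x => (derive f x 1)%:E) \_ `[a, b]%classic)); last first.
  apply/funext => x; rewrite !patchE.
  case: ifPn => [/set_mem|/negP h1]; case: ifPn => [/set_mem|/negP h2] //.
  - rewrite /= !in_itv /= => xb; have [ax|xa] := leP a x.
      by exfalso; apply: h2; apply/mem_set; rewrite /= in_itv /= ax.
    by rewrite df0//; lra.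
  - rewrite /= in_itv /= => /andP[ax xb].
    by exfalso; apply: h1; apply/mem_set; rewrite /= in_itv.
rewrite -integral_mkcond.
have cfun : continuous f.
  by move=> x; apply/differentiable_continuous/derivable1_diffP; exact: df.
rewrite (@continuous_FTC2 _ _ f)//.
- by rewrite (f0 a) ?sube0//; apply: aM; lra.
- exact: continuous_subspaceT.
- split=> [x _||]; first exact: df.
  + by apply: cvg_at_right_filter; exact: cfun.
  + by apply: cvg_at_left_filter; exact: cfun.
- by move=> x _; rewrite derive1E.
Unshelve. all: by end_near. Qed.

Lemma integral_derive_full (f : R -> R) (M : R) :
  (forall x, derivable f x 1) -> continuous (fun x => derive f x 1) ->
  (forall x, M < `|x| -> f x = 0) ->
  (\int[lebesgue_measure]_x (derive f x 1)%:E)%E = 0%E.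
Proof.
move=> df cf f0; pose b := `|M| + 1.
have hM x : `|M| < x -> M < `|x|.
  by move=> h; have := ler_norm M; have := ler_norm x; lra.
rewrite [RHS](_ : _ = (f b)%:E); last by rewrite f0// hM// /b; lra.
rewrite -(integral_derive_Nyc b df cf f0) [RHS]integral_mkcond.
apply: eq_integral => x _; rewrite patchE; case: ifPn => // /negP h.
rewrite (_ : derive f x 1 = 0)//.
apply: derive_near0; near=> y; apply: f0; apply: hM.
near: y; apply: lt_nbhsr.
rewrite ltNge; apply/negP => xb; apply: h; apply/mem_set; rewrite /= in_itv /=.
by rewrite /b; lra.
Unshelve. all: by end_near. Qed.

Lemma pder_vanish_open g A l : open A -> (forall x, A x -> g x = 0) ->
  forall x, A x -> pder l g x = 0.
Proof.
move=> oA g0; elim: l => [//|i l IH x Ax] /=.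
apply: derive_near0.
have := open_nbhs_nbhs (conj oA Ax); apply: filterS => y; exact: IH.
Qed.

Lemma open_off (M : R) : open [set x : P | M < `|x.1| \/ M < `|x.2|].
Proof.
rewrite -[X in open X]/([set x : P | M < `|x.1|] `|` [set x : P | M < `|x.2|]).
apply: openU.
  rewrite -[X in open X]/((fun x : P => `|x.1|) @^-1` [set t | M < t]).
  apply: open_comp; last exact: open_gt.
  by move=> x _; apply: cvg_norm; exact: cvg_fst.
rewrite -[X in open X]/((fun x : P => `|x.2|) @^-1` [set t | M < t]).
apply: open_comp; last exact: open_gt.
by move=> x _; apply: cvg_norm; exact: cvg_snd.
Qed.

Lemma vanish_off_pder M g l : vanish_off M g -> vanish_off M (pder l g).
Proof. by move=> Mg x h; exact: (pder_vanish_open l (@open_off M) Mg h). Qed.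

Lemma pair_continuousl (x : R) : continuous (fun y : R => (x, y)).
Proof. by move=> y; apply: (@cvg_pair _ _ _ (nbhs y) (nbhs x) (nbhs y)); [exact: cvg_cst|exact: cvg_id]. Qed.

Lemma pair_continuousr (y : R) : continuous (fun x : R => (x, y)).
Proof. by move=> x; apply: (@cvg_pair _ _ _ (nbhs x) (nbhs x) (nbhs y)); [exact: cvg_id|exact: cvg_cst]. Qed.

Lemma smooth_section1 l g y : smooth g ->
  (forall x, derivable (fun s => pder l g (s, y)) x 1) /\
  (forall x, derive (fun s => pder l g (s, y)) x 1 = pder (true :: l) g (x, y)) /\
  continuous (fun x => derive (fun s => pder l g (s, y)) x 1).
Proof.
move=> sg.
have e x : derive (fun s => pder l g (s, y)) x 1 = pder (true :: l) g (x, y).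
  by rewrite /= (derive_dir _ _ _ true).
split; [|split=> //].
  by move=> x; have /(derivable_dir _ _ _ true) := @smooth_derivable R l g true (x, y) sg.
rewrite (_ : (fun x => _) = (fun x => pder (true :: l) g (x, y))); last exact/funext.
move=> x; apply: (@continuous_comp _ _ _ (fun x => (x, y)) (pder (true :: l) g)).
  exact: pair_continuousr.
exact: smooth_continuous.
Qed.

Lemma smooth_section2 l g x : smooth g ->
  (forall y, derivable (fun s => pder l g (x, s)) y 1) /\
  (forall y, derive (fun s => pder l g (x, s)) y 1 = pder (false :: l) g (x, y)) /\
  continuous (fun y => derive (fun s => pder l g (x, s)) y 1).
Proof.
move=> sg.
have e y : derive (fun s => pder l g (x, s)) y 1 = pder (false :: l) g (x, y).
  by rewrite /= (derive_dir _ _ _ false).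
split; [|split=> //].
  by move=> y; have /(derivable_dir _ _ _ false) := @smooth_derivable R l g false (x, y) sg.
rewrite (_ : (fun y => _) = (fun y => pder (false :: l) g (x, y))); last exact/funext.
move=> y; apply: (@continuous_comp _ _ _ (fun y => (x, y)) (pder (false :: l) g)).
  exact: pair_continuousl.
exact: smooth_continuous.
Qed.

Lemma smooth_mvt1 l g (x y h : R) : smooth g -> 0 < h ->
  exists2 s, x < s < x + h & pder l g (x + h, y) - pder l g (x, y) = pder (true :: l) g (s, y) * h.
Proof.
move=> sg h0; have [d [e c]] := smooth_section1 l y sg.
have [|||s] := @MVT R (fun s => pder l g (s, y)) (fun s => pder (true :: l) g (s, y)) x (x + h).
- lra.
- by move=> s _; split; [exact: d|exact: e].
- by apply: derivable_within_continuous => s _; exact: d.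
by rewrite in_itv /= => xs ->; exists s => //; rewrite addrAC subrr add0r.
Qed.

Lemma smooth_mvt2 l g (x y h : R) : smooth g -> 0 < h ->
  exists2 s, y < s < y + h & pder l g (x, y + h) - pder l g (x, y) = pder (false :: l) g (x, s) * h.
Proof.
move=> sg h0; have [d [e c]] := smooth_section2 l x sg.
have [|||s] := @MVT R (fun s => pder l g (x, s)) (fun s => pder (false :: l) g (x, s)) y (y + h).
- lra.
- by move=> s _; split; [exact: d|exact: e].
- by apply: derivable_within_continuous => s _; exact: d.
by rewrite in_itv /= => xs ->; exists s => //; rewrite addrAC subrr add0r.
Qed.

Lemma second_difference_eq (d11 d10 d01 d00 a1 a0 b1 b0 A B h : R) : (h == 0) = false ->
  (d11 - d10) - (d01 - d00) = (b1 - b0) * h -> b1 - b0 = B * h ->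
  (d11 - d01) - (d10 - d00) = (a1 - a0) * h -> a1 - a0 = A * h -> A = B.
Proof.
move=> h0 e1 e2 e3 e4; rewrite e2 in e1; rewrite e4 in e3.
have hn : h != 0 by rewrite h0.
by apply: (mulIf hn); apply: (mulIf hn); rewrite -e1 -e3; ring.
Qed.

(* The second difference of [g] over a square of side [h] equals [h^2] times
   either mixed derivative at some point of the square. *)
Lemma schwarz g : smooth g -> pder [:: true; false] g = pder [:: false; true] g.
Proof.
move=> sg; apply/funext => -[x y]; apply/eqP; rewrite -subr_eq0 -normr_le0.
apply/ler_addgt0Pr => e e0; rewrite add0r.
have e2 : 0 < e / 2 by rewrite divr_gt0.
have near l : exists2 r, 0 < r & forall z, square (x, y) r z ->
    `|pder l g (x, y) - pder l g z| <= e / 2.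
  have /cvgrPdist_le/(_ _ e2) := @smooth_continuous R l g sg (x, y).
  exact: nbhs_square.
have [[r1 r10 h1] [r2 r20 h2]] := (near [:: true; false], near [:: false; true]).
(* The points found by the mean value theorem below then lie where each mixed derivative is within
   [e / 2] of its value at [(x, y)]. *)
pose h := Num.min r1 r2.
have h0 : 0 < h by rewrite lt_min r10.
have [hr1 hr2] : h <= r1 /\ h <= r2 by rewrite !ge_min !lexx orbT.
have insq r s t : h <= r -> x < s < x + h -> y < t < y + h -> square (x, y) r (s, t).
  by move=> hr /andP[? ?] /andP[? ?]; split; rewrite /= distrC ler_norml; apply/andP; split; lra.
have [s hs ds] : exists2 s, x < s < x + h &
    (g (x + h, y + h) - g (x + h, y)) - (g (x, y + h) - g (x, y)) =
    (pder [:: true] g (s, y + h) - pder [:: true] g (s, y)) * h.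
  have [d1 [e1 _]] := smooth_section1 [::] (y + h) sg.
  have [d2 [e2' _]] := smooth_section1 [::] y sg.
  have [|||s] := @MVT R (fun s => g (s, y + h) - g (s, y))
      (fun s => pder [:: true] g (s, y + h) - pder [:: true] g (s, y)) x (x + h).
  - lra.
  - move=> s _; apply: is_deriveB; split; [exact: d1|exact: e1|exact: d2|exact: e2'].
  - by apply: derivable_within_continuous => s _; apply: derivableB; [exact: d1|exact: d2].
  by rewrite in_itv /= => hs E; exists s => //; move: E; rewrite (_ : x + h - x = h); [move=> <-; ring|ring].
have [t ht dt] := smooth_mvt2 [:: true] s y sg h0.
have [t' ht' dt'] : exists2 t, y < t < y + h &
    (g (x + h, y + h) - g (x, y + h)) - (g (x + h, y) - g (x, y)) =
    (pder [:: false] g (x + h, t) - pder [:: false] g (x, t)) * h.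
  have [d1 [e1 _]] := smooth_section2 [::] (x + h) sg.
  have [d2 [e2' _]] := smooth_section2 [::] x sg.
  have [|||s'] := @MVT R (fun s => g (x + h, s) - g (x, s))
      (fun s => pder [:: false] g (x + h, s) - pder [:: false] g (x, s)) y (y + h).
  - lra.
  - move=> s' _; apply: is_deriveB; split; [exact: d1|exact: e1|exact: d2|exact: e2'].
  - by apply: derivable_within_continuous => s' _; apply: derivableB; [exact: d1|exact: d2].
  by rewrite in_itv /= => hs' E; exists s' => //; move: E; rewrite (_ : y + h - y = h); [move=> <-; ring|ring].
have [s' hs' ds'] := smooth_mvt1 [:: false] x t' sg h0.
have eq : pder [:: true; false] g (s', t') = pder [:: false; true] g (s, t).
  exact: (second_difference_eq (gt_eqF h0) ds dt dt' ds').
have k1 := h1 _ (insq _ _ _ hr1 hs' ht').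
have k2 := h2 _ (insq _ _ _ hr2 hs ht).
rewrite eq in k1.
apply: (le_trans (ler_distD (pder [:: false; true] g (s, t)) _ _)).
rewrite (splitr e); apply: lerD; first exact: k1.
rewrite distrC; exact: k2.
Qed.

End PlaneMeasure.

(** * Fubini and the fundamental theorem of calculus in the plane *)

Section PlaneIntegrals.
Variable R : realType.
Local Notation P := (R * R)%type.
Implicit Types (g : P -> R) (A : set P).

Lemma integral_pder M g i : smooth g -> vanish_off M g ->
  (\int[mu2 R]_x (pder [:: i] g x)%:E)%E = 0%E.
Proof.
move=> sg Mg.
have ig : (mu2 R).-integrable setT (EFin \o pder [:: i] g).
  apply: (@integrable_vanish_off R M); first exact: smooth_continuous.
  exact: vanish_off_pder.
case: i ig => ig.
  rewrite -(integral21_prod_meas1 ig).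
  rewrite (eq_integral (cst 0%E)) ?integral0// => y _; rewrite /fubini_G /=.
  have [d [e c]] := smooth_section1 [::] y sg.
  apply: (etrans _ (integral_derive_full d c (fun x xM => Mg (x, y) (or_introl xM)))).
  by apply: eq_integral => x _; exact: (congr1 EFin (esym (e x))).
rewrite -(integral12_prod_meas1 ig).
rewrite (eq_integral (cst 0%E)) ?integral0// => x _; rewrite /fubini_F /=.
have [d [e c]] := smooth_section2 [::] x sg.
apply: (etrans _ (integral_derive_full d c (fun y yM => Mg (x, y) (or_intror yM)))).
by apply: eq_integral => y _; exact: (congr1 EFin (esym (e y))).
Qed.

Definition quadrant (p : P) : set P := [set x | x.1 <= p.1 /\ x.2 <= p.2].

Lemma quadrantE p : quadrant p = `]-oo, p.1]%classic `*` `]-oo, p.2]%classic.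
Proof. by apply/seteqP; split => -[a b] /=; rewrite !in_itv. Qed.

Lemma measurable_quadrant p : measurable (quadrant p : set (plane R)).
Proof. by rewrite quadrantE; apply: measurableX; exact: measurable_itv. Qed.

(** The fundamental theorem of calculus in each variable. The mixed derivative is reordered first,
    so that the inner integral of Fubini, in the second variable, meets the outermost derivative. *)
Lemma integral_quadrant M g (p : P) : smooth g -> vanish_off M g ->
  (\int[mu2 R]_(x in quadrant p) (pder [:: true; false] g x)%:E)%E = (g p)%:E.
Proof.
move=> sg Mg; rewrite schwarz//.
have ig : (mu2 R).-integrable setT (EFin \o pder [:: false; true] g).
  apply: (@integrable_vanish_off R M); first exact: smooth_continuous.
  exact: vanish_off_pder.
have iq : (mu2 R).-integrable setT ((EFin \o pder [:: false; true] g) \_ (quadrant p)).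
  apply: (integrable_mkcond _ (measurable_quadrant p)).1.
  exact: (integrableS measurableT (measurable_quadrant p) (@subsetT _ _) ig).
rewrite integral_mkcond -(integral12_prod_meas1 iq).
case: p iq => p1 p2 iq.
have [d [e c]] := smooth_section1 [::] p2 sg.
apply: (etrans _ (integral_derive_Nyc p1 d c (fun x xM => Mg (x, p2) (or_introl xM)))).
rewrite [RHS]integral_mkcond; apply: eq_integral => x _.
rewrite /fubini_F [RHS]patchE.
have [d' [e' c']] := smooth_section2 [:: true] x sg.
case: ifPn => [/set_mem|/negP xp].
  rewrite /= in_itv /= => xp; rewrite e.
  have E := integral_derive_Nyc p2 d' c'
    (fun y yM => vanish_off_pder [:: true] Mg (or_intror yM : M < `|(x, y).1| \/ M < `|(x, y).2|)).
  apply: (etrans _ E).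
  rewrite [RHS]integral_mkcond; apply: eq_integral => y _.
  rewrite !patchE; have -> : ((x, y) \in quadrant (p1, p2)) = (y \in `]-oo, p2]%classic).
    apply/idP/idP => /set_mem h; apply/mem_set; first by rewrite /= in_itv /=; case: h.
    by split => //=; move: h; rewrite /= in_itv.
  by rewrite e'; case: (y \in _).
rewrite (eq_integral (cst 0%E)) ?integral0// => y _.
rewrite patchE ifF//; apply/negbTE/negP => /set_mem[/= h _]; apply: xp.
by apply/mem_set; rewrite /= in_itv.
Qed.

End PlaneIntegrals.

(** * Test functions on a bounded open set *)

Section SquareIntegrableOnDomain.
Variable R : realType.
Local Notation P := (R * R)%type.
Variables (Om : set P) (M : R).
Hypotheses (oOm : open Om) (bOm : forall x, Om x -> `|x.1| <= M /\ `|x.2| <= M).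
Implicit Types (f g h phi psi : P -> R).

Lemma measurable_Om : measurable (Om : set (plane R)).
Proof. exact: open_measurable_plane. Qed.

Lemma Om_sub_square : Om `<=` square (0, 0) M.
Proof. by move=> x /bOm[h1 h2]; split; rewrite /= sub0r normrN. Qed.

Lemma mu2_Om_lty : (mu2 R Om < +oo)%E.
Proof.
apply: le_lt_trans (mu2_square (0, 0) M); apply: le_measure.
- by rewrite inE; exact: measurable_Om.
- by rewrite inE; exact: measurable_square.
exact: Om_sub_square.
Qed.

Lemma L2_psd : psd_form (L2 Om : set (P -> R)) (ip Om).
Proof. exact: (sqip_psd (mu2 R) measurable_Om). Qed.

Lemma L2_complete : form_complete (L2 Om : set (P -> R)) (ip Om).
Proof. exact: (sqip_complete measurable_Om). Qed.

Definition normL2 f := seminorm (ip Om) f.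

Lemma L2_mul f g : L2 Om f -> L2 Om g ->
  (mu2 R).-integrable Om (EFin \o (fun x => f x * g x)).
Proof. exact: (@sqint_mul _ _ _ (mu2 R) Om measurable_Om). Qed.

Lemma normL2_ae f g : L2 Om f -> L2 Om g -> normL2 (f - g) = 0 -> ae_eq (mu2 R) Om f g.
Proof.
move=> Lf Lg h0; have Lfg := psdB L2_psd Lf Lg.
have : ip Om (f - g) (f - g) = 0 by rewrite -(sqr_seminorm L2_psd Lfg) -/(normL2 _) h0 expr0n.
move=> /(sqint_aeP measurable_Om Lfg); rewrite /ae_eq.
by apply: filterS => x h /h /= /eqP; rewrite subr_eq0 => /eqP.
Qed.

Lemma ae_normL2 f g : L2 Om f -> L2 Om g -> ae_eq (mu2 R) Om f g -> normL2 (f - g) = 0.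
Proof.
move=> Lf Lg fg; have Lfg := psdB L2_psd Lf Lg.
rewrite /normL2 /seminorm.
rewrite [X in Num.sqrt X](_ : _ = ip Om 0 0); last first.
  apply: (sqip_ae measurable_Om) => //; try exact: Lfg.1; try exact: measurable_cst.
  - by rewrite /ae_eq; apply: filterS fg => x h /h /= e; rewrite !fctE e subrr.
  - by rewrite /ae_eq; apply: filterS fg => x h /h /= e; rewrite !fctE e subrr.
by rewrite (form0l L2_psd (psd_0 L2_psd)) sqrtr0.
Qed.

Lemma ip_eq_normL2 f g h : L2 Om f -> L2 Om g -> L2 Om h -> normL2 (f - g) = 0 ->
  ip Om f h = ip Om g h.
Proof.
move=> Lf Lg Lh fg; apply/eqP; rewrite -subr_eq0 -normr_le0 -(formBl L2_psd Lf Lg Lh).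
apply: (le_trans (form_CS L2_psd (psdB L2_psd Lf Lg) Lh)).
by rewrite -/(normL2 (f - g)) fg mul0r.
Qed.

Lemma L2_bounded f (C : R) : measurable_fun (Om : set (plane R)) (f : plane R -> R) ->
  (forall x, Om x -> `|f x| <= C) -> L2 Om f.
Proof.
move=> mf fC; split; first exact: mf.
apply: (@measurable_bounded_integrable _ (plane R) R (mu2 R) (fun x => f x ^+ 2)).
- exact: measurable_Om.
- exact: mu2_Om_lty.
- exact: measurable_funX.
exists (C ^+ 2); split; first exact: num_real.
move=> K CK x Ox; rewrite /= normrX; apply: le_trans (ltW CK).
by rewrite ler_pXn2r ?nnegrE// ?(le_trans _ (fC x Ox))// fC.
Qed.

Lemma L2_cst (c : R) : L2 Om (fun=> c).
Proof. by apply: (@L2_bounded _ `|c|) => //; exact: measurable_cst. Qed.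

Lemma L2_integrable f : L2 Om f -> (mu2 R).-integrable Om (EFin \o f).
Proof.
move=> Lf; have := L2_mul Lf (L2_cst 1).
by congr (_.-integrable _ _); apply/funext => x /=; rewrite mulr1.
Qed.

Lemma normL2_bounded f (C : R) : measurable_fun (Om : set (plane R)) (f : plane R -> R) ->
  0 <= C -> (forall x, Om x -> `|f x| <= C) ->
  normL2 f <= C * Num.sqrt (fine (mu2 R Om)).
Proof.
move=> mf C0 fC; have Lf := L2_bounded mf fC.
have m0 : 0 <= fine (mu2 R Om) by rewrite fine_ge0.
rewrite -(ger0_norm C0) -sqrtr_sqr -sqrtrM ?sqr_ge0// ler_wsqrtr//.
have -> : C ^+ 2 * fine (mu2 R Om) = Rintegral (mu2 R) Om (fun=> C ^+ 2).
  by rewrite Rintegral_cst//; exact: measurable_Om.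
apply: le_Rintegral; first exact: measurable_Om.
- exact: L2_mul.
- exact: L2_integrable (L2_cst _).
move=> x Ox; rewrite -expr2 -[f x ^+ 2]real_normK ?num_real//.
by rewrite ler_pXn2r ?nnegrE// fC.
Qed.

Lemma test_vanish_off phi : test_fun Om phi -> vanish_off M phi.
Proof.
move=> [_ [C [_ [CO phi0]]]] x xM; apply: phi0 => /CO/bOm[h1 h2].
by case: xM; rewrite ltNge ?h1 ?h2.
Qed.

Lemma test_smooth phi : test_fun Om phi -> smooth phi. Proof. by case. Qed.

Lemma test_out phi x : test_fun Om phi -> ~ Om x -> phi x = 0.
Proof. by move=> [_ [C [_ [CO phi0]]]] nO; apply: phi0 => /CO. Qed.

Lemma plane_hausdorff : hausdorff_space P.
Proof. exact: norm_hausdorff. Qed.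

Lemma test_pder l phi : test_fun Om phi -> test_fun Om (pder l phi).
Proof.
move=> [s [C [cC [CO phi0]]]]; split; first exact: smooth_pder.
exists C; split=> //; split=> // x nC.
apply: (@pder_vanish_open R phi (~` C) l _ _ x nC) => //.
by apply: closed_openC; apply: compact_closed => //; exact: plane_hausdorff.
Qed.

Lemma test_continuous phi : test_fun Om phi -> continuous phi.
Proof. by move=> [s _]; exact: (@smooth_continuous R [::] phi s). Qed.

Lemma continuous_L2 phi : continuous phi -> vanish_off M phi -> L2 Om phi.
Proof.
move=> cphi Mphi; split.
  by apply: measurable_funS (continuous_measurable_plane cphi).
apply: (integrableS measurableT measurable_Om (@subsetT _ _)).
apply: (@integrable_vanish_off R M (fun x => phi x ^+ 2)).
  by move=> x; apply: cvgM; exact: cphi.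
by move=> x /Mphi ->; rewrite expr0n.
Qed.

Lemma test_L2 phi : test_fun Om phi -> L2 Om phi.
Proof.
by move=> tphi; apply: continuous_L2; [exact: test_continuous|exact: test_vanish_off].
Qed.

Lemma test_lin c phi psi : test_fun Om phi -> test_fun Om psi ->
  test_fun Om (c *: phi + psi).
Proof.
move=> [s1 [C1 [c1 [sub1 z1]]]] [s2 [C2 [c2 [sub2 z2]]]].
split; first exact: smooth_linear.
exists (C1 `|` C2); split; first exact: compactU.
split; first by move=> x [/sub1|/sub2].
move=> x /not_orP[/z1 h1 /z2 h2].
by rewrite (_ : (c *: phi + psi) x = c * phi x + psi x)// h1 h2 mulr0 addr0.
Qed.

Lemma test_mul phi psi : test_fun Om phi -> smooth psi ->
  test_fun Om (fun x => phi x * psi x).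
Proof.
move=> [s1 [C1 [c1 [sub1 z1]]]] s2; split; first exact: smooth_mul.
by exists C1; split=> //; split=> // x /z1 ->; rewrite mul0r.
Qed.

Lemma test0 : test_fun Om 0.
Proof.
split; first exact: smooth0.
by exists set0; split; [exact: compact0|split].
Qed.

Lemma Rint_setT g : (forall x, ~ Om x -> g x = 0) -> Defs.Rint Om g = Rintegral (mu2 R) setT g.
Proof.
move=> g0; rewrite /Defs.Rint Rintegral_mkcond; congr (Rintegral _ _ _).
by apply/funext => x; rewrite patchE; case: ifPn => // /negP h; rewrite g0// => /mem_set.
Qed.

Lemma ibp1 i phi psi : test_fun Om phi -> test_fun Om psi ->
  ip Om (pder [:: i] phi) psi = - ip Om phi (pder [:: i] psi).
Proof.
move=> tphi tpsi.
have [s1 s2] := (test_smooth tphi, test_smooth tpsi).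
have t12 := test_mul tphi s2.
have := integral_pder i (test_smooth t12) (test_vanish_off t12).
rewrite (pder1_mul i s1 s2) => I0.
have [L1 L2'] := (test_L2 (test_pder [:: i] tphi), test_L2 tpsi).
have [L3 L4] := (test_L2 tphi, test_L2 (test_pder [:: i] tpsi)).
apply/eqP; rewrite -addr_eq0; apply/eqP.
have := RintegralD measurable_Om (L2_mul L1 L2') (L2_mul L3 L4).
move=> E; apply: (etrans (esym E)).
have nz x : ~ Om x -> pder [:: i] phi x * psi x + phi x * pder [:: i] psi x = 0.
  by move=> nO; rewrite (test_out tpsi nO) (test_out tphi nO) mulr0 mul0r addr0.
apply: (etrans (Rint_setT nz)).
by rewrite /Rintegral I0.
Qed.

(** Two integrations by parts return the derivatives in reversed order; equality of mixed
    derivatives restores it. *)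
Lemma ibp l phi psi : (size l <= 2)%N -> test_fun Om phi -> test_fun Om psi ->
  ip Om (pder l phi) psi = (-1) ^+ size l * ip Om phi (pder l psi).
Proof.
move=> sl tphi tpsi; case: l sl => [|i [|j [|//]]] _.
- by rewrite expr0 mul1r.
- by rewrite ibp1// expr1 mulN1r.
have tj := test_pder [:: j] tphi; have ti := test_pder [:: i] tpsi.
have -> : pder [:: i; j] phi = pder [:: i] (pder [:: j] phi) by [].
rewrite ibp1// ibp1// opprK.
have -> : (-1) ^+ size [:: i; j] = 1 :> R by rewrite /= expr2 mulrNN mulr1.
rewrite mul1r.
have -> : pder [:: j] (pder [:: i] psi) = pder [:: j; i] psi by [].
have S := congr1 (ip Om phi) (schwarz (test_smooth tpsi)).
by case: i j {tj ti} => -[]; [reflexivity|exact: esym S|exact: S|reflexivity].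
Qed.

Definition quad_ind (p : P) : P -> R := \1_(quadrant p).

Lemma measurable_quad_ind p : measurable_fun (Om : set (plane R)) (quad_ind p : plane R -> R).
Proof. by apply: measurable_indic; exact: measurable_quadrant. Qed.

Lemma L2_quad_ind p : L2 Om (quad_ind p).
Proof.
apply: (@L2_bounded _ 1); first exact: measurable_quad_ind.
by move=> x _; rewrite /quad_ind indicE; case: (_ \in _); rewrite ?normr1 ?normr0.
Qed.

Lemma normL2_quad_ind p : normL2 (quad_ind p) <= Num.sqrt (fine (mu2 R Om)).
Proof.
rewrite -[leRHS]mul1r; apply: normL2_bounded => //; first exact: measurable_quad_ind.
by move=> x _; rewrite /quad_ind indicE; case: (_ \in _); rewrite ?normr1 ?normr0.
Qed.

Lemma test_quadrant phi p : test_fun Om phi ->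
  phi p = ip Om (pder [:: true; false] phi) (quad_ind p).
Proof.
move=> tphi.
have E := congr1 fine (integral_quadrant p (test_smooth tphi) (test_vanish_off tphi)).
have t2 := test_pder [:: true; false] tphi.
apply: (etrans (esym E)); rewrite /ip Rint_setT; last by move=> x nO; rewrite (test_out t2 nO) mul0r.
rewrite -[LHS]/(Rintegral (mu2 R) (quadrant p) (pder [:: true; false] phi)) Rintegral_mkcond.
apply: eq_Rintegral => x _; rewrite patchE /quad_ind indicE.
by case: (x \in _); rewrite ?mulr1 ?mulr0.
Qed.

(** In the bounding box, quadrants whose corners differ by at most [r] in each coordinate can differ
    only on two strips of width [2 r] around the edges through [p]. As [u] does not enter, this is a
    common modulus of continuity for all functions of bounded energy. *)
Lemma quad_ind_continuous (p : P) (e : R) : 0 < e -> exists2 r, 0 < r &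
  forall q, square p r q -> normL2 (quad_ind q - quad_ind p) <= e.
Proof.
move=> e0; pose M1 := `|M| + 1.
have M10 : 0 < M1 by rewrite ltr_wpDl.
(* Each strip has area [2 r * 2 M1]; the two together have area [e^2]. *)
pose r := e ^+ 2 / (8 * M1).
have r0 : 0 < r by rewrite divr_gt0 ?exprn_gt0// mulr_gt0.
exists r => // q [q1 q2].
pose S1 : set P := `[p.1 - r, p.1 + r]%classic `*` `[- M1, M1]%classic.
pose S2 : set P := `[- M1, M1]%classic `*` `[p.2 - r, p.2 + r]%classic.
have mS1 : measurable (S1 : set (plane R)) by apply: measurableX; exact: measurable_itv.
have mS2 : measurable (S2 : set (plane R)) by apply: measurableX; exact: measurable_itv.
have r2 t : t - r < t + r :> R by move: (r) r0 => s s0; lra.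
have M12 : - M1 < M1 by move: (M1) M10 => s s0; lra.
have vS1 : (mu2 R S1 = (4 * r * M1)%:E)%E.
  rewrite /mu2 /= product_measure1E //=; try exact: measurable_itv.
  rewrite !lebesgue_measure_itv /= !lte_fin r2 M12 -!EFinB -EFinM; congr EFin.
  by ring.
have vS2 : (mu2 R S2 = (4 * r * M1)%:E)%E.
  rewrite /mu2 /= product_measure1E //=; try exact: measurable_itv.
  rewrite !lebesgue_measure_itv /= !lte_fin r2 M12 -!EFinB -EFinM; congr EFin.
  by ring.
have Lqp : L2 Om (quad_ind q - quad_ind p) by apply: (psdB L2_psd); exact: L2_quad_ind.
rewrite -(ger0_norm (ltW e0)) -sqrtr_sqr /normL2 /seminorm ler_wsqrtr//.
have i1 (S : set P) : measurable (S : set (plane R)) ->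
    (mu2 R).-integrable Om (EFin \o (\1_S : P -> R)).
  move=> mS; apply: L2_integrable; apply: (@L2_bounded _ 1); first exact: measurable_indic.
  by move=> x _; rewrite indicE; case: (_ \in _); rewrite ?normr1 ?normr0.
have I1 (S : set P) (c : R) : measurable (S : set (plane R)) -> mu2 R S = c%:E ->
    Rintegral (mu2 R) Om (\1_S : P -> R) <= c.
  move=> mS Sc; rewrite /Rintegral integral_indic//; last exact: measurable_Om.
  have le1 : (mu2 R (S `&` Om) <= mu2 R S)%E.
    by apply: le_measure; rewrite ?inE//; apply: measurableI => //; exact: measurable_Om.
  rewrite -lee_fin fineK -?Sc// ge0_fin_numE//.
  by apply: (le_lt_trans le1); rewrite Sc ltry.
apply: (@le_trans _ _ (Rintegral (mu2 R) Om (fun x => (\1_S1 x : R) + \1_S2 x))).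
  apply: le_Rintegral; first exact: measurable_Om.
  - exact: L2_mul.
  - exact: (integrableD measurable_Om (i1 _ mS1) (i1 _ mS2)).
  move=> x Ox; rewrite (_ : (quad_ind q - quad_ind p) x = quad_ind q x - quad_ind p x)//.
  rewrite /quad_ind !indicE.
  have [Mx1 Mx2] : x.1 \in `[- M1, M1] /\ x.2 \in `[- M1, M1].
    have [b1 b2] := bOm Ox; rewrite !in_itv /= -!ler_norml /M1.
    have := ler_norm M; move: b1 b2; move: `|x.1| `|x.2| `|M| => u v w.
    by split; lra.
  have [xS1|xS1] := boolP (x \in S1).
    by case: (x \in quadrant q); case: (x \in quadrant p); case: (x \in S2);
      rewrite /= ?subrr ?subr0 ?sub0r ?mulrNN ?mulr0 ?mulr1 ?addr0 ?lerDl ?addr_ge0.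
  have [xS2|xS2] := boolP (x \in S2).
    by case: (x \in quadrant q); case: (x \in quadrant p);
      rewrite /= ?subrr ?subr0 ?sub0r ?mulrNN ?mulr0 ?mulr1 ?add0r.
  suff -> : (x \in quadrant q) = (x \in quadrant p) by rewrite subrr mulr0 addr0.
  have {}xS1 : ~ (p.1 - r <= x.1 <= p.1 + r).
    by move=> h; move/negP: xS1; apply; apply/mem_set; split => //=; rewrite in_itv.
  have {}xS2 : ~ (p.2 - r <= x.2 <= p.2 + r).
    by move=> h; move/negP: xS2; apply; apply/mem_set; split => //=; rewrite in_itv.
  move: q1 q2; rewrite !ler_norml => /andP[a1 a2] /andP[a3 a4].
  apply/idP/idP => /set_mem[b1 b2]; apply/mem_set; split; rewrite leNgt; apply/negP => c.
  - by apply: xS1; apply/andP; split; lra.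
  - by apply: xS2; apply/andP; split; lra.
  - by apply: xS1; apply/andP; split; lra.
  - by apply: xS2; apply/andP; split; lra.
rewrite RintegralD//; [|exact: measurable_Om|exact: i1|exact: i1].
apply: (le_trans (lerD (I1 _ _ mS1 vS1) (I1 _ _ mS2 vS2))).
by rewrite /r le_eqVlt; apply/orP; left; apply/eqP; field; rewrite gt_eqF.
Qed.

End SquareIntegrableOnDomain.

(** * The fundamental lemma of the calculus of variations *)

(** The sets with vanishing integral form a Dynkin system containing the pi-system [G]. The map [pi]
    lets one statement serve both coordinate projections and the identity. *)
Lemma zero_integral_extend d (T : measurableType d) d' (T' : measurableType d') (R : realType)
    (mu : {measure set T -> \bar R}) (pi : T -> T') (G : set (set T')) (E : set T) (g : T -> \bar R) :
  measurable_fun setT pi -> measurable E -> mu.-integrable E g ->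
  @measurable _ T' = <<s G >> -> setI_closed G ->
  (\int[mu]_(x in E) g x = 0)%E ->
  (forall A, G A -> (\int[mu]_(x in pi @^-1` A `&` E) g x = 0)%E) ->
  forall A, measurable A -> (\int[mu]_(x in pi @^-1` A `&` E) g x = 0)%E.
Proof.
move=> mpi mE ig mG GI E0 GA A mA; have [mg _] := integrableP _ _ _ ig.
have mpre B : measurable B -> measurable (pi @^-1` B).
  by move=> mB; rewrite -[_ @^-1` _]setTI; exact: mpi.
apply: (@dynkin_induction _ T' G
  (fun A => \int[mu]_(x in pi @^-1` A `&` E) g x = 0)%E) => //.
- by rewrite preimage_setT setTI.
- move=> S mS S0; rewrite preimage_setC.
  have := @integral_setU _ _ _ mu (pi @^-1` S `&` E) (~` (pi @^-1` S) `&` E) g.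
  have -> : pi @^-1` S `&` E `|` ~` (pi @^-1` S) `&` E = E by rewrite -setIUl setUv setTI.
  move=> H; have := H _ _ mg _; rewrite E0 S0 add0e => -> //.
  + by apply: measurableI => //; exact: mpre.
  + by apply: measurableI => //; apply: measurableC; exact: mpre.
  + rewrite disj_set2E; apply/eqP; rewrite setIACA setICr set0I//.
- move=> F mF tF F0; rewrite preimage_bigcup setI_bigcupl integral_bigcup.
  + by rewrite eseries0.
  + apply/trivIsetP => i j _ _ ij; rewrite setIACA setIid -preimage_setI.
    by move/trivIsetP : tF => /(_ i j I I ij) ->; rewrite preimage_set0 set0I.
  + by move=> k; apply: measurableI => //; exact: mpre.
  + apply: integrableS ig => //; last by move=> x [k _ []].
    by apply: bigcupT_measurable => k; apply: measurableI => //; exact: mpre.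
- by rewrite -mG.
Qed.

Section FundamentalLemma.
Variable R : realType.
Local Notation P := (R * R)%type.

Lemma RGenOpens_setI : setI_closed (@RGenOpens.G R).
Proof.
move=> _ _ [a [b ->]] [c [d ->]]; exists (Num.max a c), (Num.min b d).
by apply/seteqP; split=> t /=; rewrite !in_itv /= gt_max lt_min;
  [move=> [/andP[-> ->] /andP[-> ->]]|move=> /andP[/andP[-> ->] /andP[-> ->]]].
Qed.

Lemma measurable_R_generated : @measurable _ (measurableTypeR R) = <<s @RGenOpens.G R >>.
Proof. exact: RGenOpens.measurableE. Qed.

Definition rect (a b c d : R) : set P := `]a, b[%classic `*` `]c, d[%classic.

Lemma measurable_rect a b c d : measurable (rect a b c d : set (plane R)).
Proof. by apply: measurableX; exact: measurable_itv. Qed.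

(* Dynkin's argument in each variable, then on product sets. *)
Lemma ae_zero_on_rect (g : P -> R) (a b c d : R) :
  (mu2 R).-integrable (rect a b c d) (EFin \o g) ->
  (forall a' b' c' d', a <= a' -> b' <= b -> c <= c' -> d' <= d ->
     (\int[mu2 R]_(x in rect a' b' c' d') (g x)%:E = 0)%E) ->
  ae_eq (mu2 R) (rect a b c d) (EFin \o g) (cst 0%E).
Proof.
move=> ig H; pose E := rect a b c d.
have mE : measurable (E : set (plane R)) by exact: measurable_rect.
have ige (A : set (plane R)) : measurable A -> A `<=` E -> (mu2 R).-integrable A (EFin \o g).
  by move=> mA AE; exact: (integrableS mE mA AE ig).
have s1 c' d' A : c <= c' -> d' <= d -> measurable (A : set (measurableTypeR R)) ->
    (\int[mu2 R]_(x in (fst : plane R -> measurableTypeR R) @^-1` A `&` rect a b c' d') (g x)%:E = 0)%E.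
  move=> cc dd mA.
  apply: (zero_integral_extend _ _ _ measurable_R_generated RGenOpens_setI) => //.
  - exact: measurable_rect.
  - apply: ige; first exact: measurable_rect.
    move=> x [h1 h2]; split=> //; move: h2; rewrite /= !in_itv /= => /andP[h2 h3].
    by apply/andP; split; lra.
  - exact: H.
  - move=> _ [a' [b' ->]].
    have -> : (fst : plane R -> measurableTypeR R) @^-1` `]a', b'[%classic `&` rect a b c' d' =
        rect (Num.max a' a) (Num.min b' b) c' d'.
      apply/seteqP; split=> -[x y] /=; rewrite /rect /= !in_itv /= gt_max lt_min.
        by move=> [/andP[-> ->] [/andP[-> ->] ->]].
      by move=> [/andP[/andP[-> ->] /andP[-> ->]] ->].
    by apply: H => //; rewrite ?le_max ?ge_min ?lexx ?orbT.
have s2 A B : measurable (A : set (measurableTypeR R)) -> measurable (B : set (measurableTypeR R)) ->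
    (\int[mu2 R]_(x in (snd : plane R -> measurableTypeR R) @^-1` B `&`
       ((fst : plane R -> measurableTypeR R) @^-1` A `&` E)) (g x)%:E = 0)%E.
  move=> mA mB.
  have mAE : measurable ((fst : plane R -> measurableTypeR R) @^-1` A `&` E).
    by apply: measurableI => //; rewrite -[_ @^-1` _]setTI; exact: measurable_fst.
  apply: (zero_integral_extend _ _ _ measurable_R_generated RGenOpens_setI) => //.
  - by apply: ige => // x [].
  - exact: s1.
  - move=> _ [c' [d' ->]].
    have -> : (snd : plane R -> measurableTypeR R) @^-1` `]c', d'[%classic `&`
         ((fst : plane R -> measurableTypeR R) @^-1` A `&` E) =
        (fst : plane R -> measurableTypeR R) @^-1` A `&` rect a b (Num.max c' c) (Num.min d' d).
      apply/seteqP; split=> -[x y] /=; rewrite /E /rect /= !in_itv /= gt_max lt_min.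
        by move=> [/andP[-> ->] [? [-> /andP[-> ->]]]].
      by move=> [? [-> /andP[/andP[-> ->] /andP[-> ->]]]].
    by apply: s1 => //; rewrite ?le_max ?ge_min ?lexx ?orbT.
apply: integral_ae_eq => //.
move=> A AE mA; rewrite integral0.
have -> : A = id @^-1` A `&` E by rewrite preimage_id; apply/esym/setIidPl.
apply: (@zero_integral_extend _ (plane R) _ (plane R) R (mu2 R) id
  [set X `*` Y | X in measurable & Y in measurable]) => //.
- exact: measurable_prod_measurableType.
- move=> _ _ [X1 mX1 [Y1 mY1 <-]] [X2 mX2 [Y2 mY2 <-]].
  exists (X1 `&` X2); first exact: measurableI.
  by exists (Y1 `&` Y2); [exact: measurableI|rewrite setXI].
- exact: H.
- move=> _ [X mX [Y mY <-]]; rewrite -[RHS](s2 X Y mX mY); congr (integral _ _ _).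
  by apply/seteqP; split=> -[x y] /=; [move=> [[? ?] ?]|move=> [? [? ?]]].
Qed.

Variables (Om : set P) (M : R).
Hypotheses (oOm : open Om) (bOm : forall x, Om x -> `|x.1| <= M /\ `|x.2| <= M).

(** [flat 1] is exp(-1/t) continued by zero, so the product is positive exactly on the open
    rectangle when [k > 0]. Raising the slope [k] drives it to the indicator under the constant
    bound 1; with [k = 1] it is the bump placed under the obstacle problem's competitor. *)
Definition cutoff (a b c d k : R) : P -> R := fun x =>
  (flat 1 (k * x.1 + - (k * a)) * flat 1 (- k * x.1 + k * b)) *
  (flat 1 (k * x.2 + - (k * c)) * flat 1 (- k * x.2 + k * d)).

Lemma smooth_cutoff a b c d k : smooth (cutoff a b c d k).
Proof.
apply: smooth_mul; apply: smooth_mul.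
- exact: (smooth_flat_affine true).
- exact: (smooth_flat_affine true).
- exact: (smooth_flat_affine false).
- exact: (smooth_flat_affine false).
Qed.

Lemma flat1E (t : R) : flat 1 t = if 0 < t then expR (- t^-1) else 0.
Proof. by rewrite /flat hornerC mul1r. Qed.

Lemma flat1_01 (t : R) : 0 <= flat 1 t <= 1.
Proof.
rewrite flat1E; case: ifPn => t0; last by rewrite lexx ler01.
by rewrite expR_ge0 -expR0 ler_expR lerNl oppr0 invr_ge0 ltW.
Qed.

Lemma cutoff_01 a b c d k x : 0 <= cutoff a b c d k x <= 1.
Proof.
have m01 (s t : R) : 0 <= s <= 1 -> 0 <= t <= 1 -> 0 <= s * t <= 1.
  by move=> /andP[s0 s1] /andP[t0 t1]; rewrite mulr_ge0//= mulr_ile1.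
by apply: (m01); apply: (m01); exact: flat1_01.
Qed.

Lemma cutoff_gt0 a b c d k x : 0 < k -> rect a b c d x -> 0 < cutoff a b c d k x.
Proof.
move=> k0 [/=]; rewrite !in_itv /= => /andP[ax xb] /andP[cy yd].
have p (t : R) : 0 < t -> 0 < flat 1 t by move=> t0; rewrite flat1E t0 expR_gt0.
rewrite /cutoff !mulr_gt0//; apply: p.
- by rewrite -mulrBr mulr_gt0// subr_gt0.
- by rewrite mulNr addrC -mulrBr mulr_gt0// subr_gt0.
- by rewrite -mulrBr mulr_gt0// subr_gt0.
- by rewrite mulNr addrC -mulrBr mulr_gt0// subr_gt0.
Qed.

Lemma cutoff_eq0 a b c d k x : 0 < k -> ~ rect a b c d x -> cutoff a b c d k x = 0.
Proof.
move=> k0 nx.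
have z (t : R) : t <= 0 -> flat 1 t = 0 by move=> t0; rewrite flat1E ltNge t0.
have [ax|ax] := leP x.1 a.
  by rewrite /cutoff (z (k * x.1 + _)) ?mul0r// -mulrBr pmulr_rle0// subr_le0.
have [bx|bx] := leP b x.1.
  by rewrite /cutoff (z (- k * x.1 + _)) ?mulr0 ?mul0r// mulNr addrC -mulrBr pmulr_rle0// subr_le0.
have [cx|cx] := leP x.2 c.
  by rewrite /cutoff (z (k * x.2 + _)) ?mul0r ?mulr0// -mulrBr pmulr_rle0// subr_le0.
have [dx|dx] := leP d x.2.
  by rewrite /cutoff (z (- k * x.2 + _)) ?mulr0// mulNr addrC -mulrBr pmulr_rle0// subr_le0.
by exfalso; apply: nx; split; rewrite /= in_itv /= ?ax ?bx ?cx ?dx.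
Qed.

Lemma test_cutoff a b c d k : 0 < k -> `[a, b]%classic `*` `[c, d]%classic `<=` Om ->
  test_fun Om (cutoff a b c d k).
Proof.
move=> k0 subOm; split; first exact: smooth_cutoff.
exists (`[a, b]%classic `*` `[c, d]%classic); split.
  by apply: compact_setX; exact: segment_compact.
split=> // x nx; apply: cutoff_eq0 => // -[h1 h2]; apply: nx.
by split; apply: subset_itv_oo_cc.
Qed.

Lemma cvg_cutoff a b c d x :
  cutoff a b c d n.+1%:R x @[n --> \oo] --> (\1_(rect a b c d) x : R).
Proof.
have [xr|xr] := pselect (rect a b c d x); last first.
  rewrite indicE memNset// (_ : (fun n => _) = fun=> 0); first exact: cvg_cst.
  by apply/funext => n; rewrite cutoff_eq0.
rewrite indicE mem_set//.
have p (t : R) : 0 < t -> flat 1 (n.+1%:R * t) @[n --> \oo] --> (1 : R).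
  move=> t0; rewrite -[X in _ --> X]expR0.
  rewrite (_ : (fun n => _) = fun n => expR (- (n.+1%:R^-1 * t^-1))); last first.
    by apply/funext => n; rewrite flat1E mulr_gt0// invfM.
  apply: (@continuous_cvg _ _ _ _ _ _ expR); first exact: continuous_expR.
  rewrite -oppr0 -(mul0r t^-1); apply: cvgN; apply: cvgMr_tmp; exact: cvg_harmonic.
move: xr => [/=]; rewrite !in_itv /= => /andP[ax xb] /andP[cy yd].
rewrite [X in _ --> X](_ : _ = (1 * 1) * (1 * 1)); last by rewrite !mulr1.
rewrite (_ : (fun n => _) = fun n =>
   (flat 1 (n.+1%:R * (x.1 - a)) * flat 1 (n.+1%:R * (b - x.1))) *
   (flat 1 (n.+1%:R * (x.2 - c)) * flat 1 (n.+1%:R * (d - x.2)))); last first.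
  apply/funext => n; rewrite /cutoff !mulrBr !mulNr.
  by rewrite (addrC (_ * b)) (addrC (_ * d)).
by apply: cvgM; apply: cvgM; apply: p; rewrite subr_gt0.
Qed.

Lemma zero_integral_rect g a b c d : L2 Om g -> (forall psi, test_fun Om psi -> ip Om g psi = 0) ->
  `[a, b]%classic `*` `[c, d]%classic `<=` Om ->
  (\int[mu2 R]_(x in rect a b c d) (g x)%:E = 0)%E.
Proof.
move=> Lg H sub.
have mO := measurable_Om oOm.
have ig := L2_integrable oOm bOm Lg.
have rO : rect a b c d `<=` Om.
  by move=> x [h1 h2]; apply: sub; split; apply: subset_itv_oo_cc.
pose f_ n : plane R -> \bar R := fun x => (g x * cutoff a b c d n.+1%:R x)%:E.
pose f : plane R -> \bar R := fun x => (g x * \1_(rect a b c d) x)%:E.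
have tc n : test_fun Om (cutoff a b c d n.+1%:R) by apply: test_cutoff.
have mf n : measurable_fun (Om : set (plane R)) (f_ n).
  by have /integrableP[] := L2_mul oOm Lg (test_L2 oOm bOm (tc n)).
have mf' : measurable_fun (Om : set (plane R)) f.
  apply/measurable_EFinP; apply: measurable_funM; first exact: Lg.1.
  by apply: measurable_indic; exact: measurable_rect.
have aecv : {ae mu2 R, forall x, Om x -> f_ ^~ x @ \oo --> f x}.
  apply: aeW => x Ox; apply: cvg_EFin; first exact: nearW.
  by apply: cvgMl_tmp; exact: cvg_cutoff.
have aebd : {ae mu2 R, forall x n, Om x -> (`|f_ n x| <= `|(g x)%:E|)%E}.
  apply: aeW => x n Ox; rewrite /f_ lee_fin normrM.
  have /andP[c0 c1] := cutoff_01 a b c d n.+1%:R x.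
  by rewrite -[leRHS]mulr1 ler_wpM2l// ger0_norm.
have [_ _ cv] := dominated_convergence mO mf mf' aecv (integrable_abse ig) aebd.
have E0 n : (\int[mu2 R]_(x in Om) f_ n x = 0)%E.
  have := sqip_EFin mO Lg (test_L2 oOm bOm (tc n)); rewrite /f_ => <-.
  by congr EFin; exact: (H _ (tc n)).
have -> : (\int[mu2 R]_(x in rect a b c d) (g x)%:E = \int[mu2 R]_(x in Om) f x)%E.
  rewrite integral_mkcond [RHS]integral_mkcond; apply: eq_integral => x _.
  rewrite !patchE /f indicE; case: ifPn => xr.
    by rewrite ifT ?mulr1//; apply/mem_set/rO/set_mem.
  by rewrite mulr0; case: ifP.
have cv0 : (fun _ : nat => 0%E : \bar R) @ \oo --> (\int[mu2 R]_(x in Om) f x)%E.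
  by move: cv; rewrite (_ : [sequence _]_n = fun=> 0%E)//; apply/funext => n; exact: E0.
by rewrite -(cvg_lim (@ereal_hausdorff R) cv0) (lim_cst (@ereal_hausdorff R)).
Qed.

Lemma fundamental_lemma g : L2 Om g -> (forall psi, test_fun Om psi -> ip Om g psi = 0) ->
  ae_eq (mu2 R) Om g (cst 0).
Proof.
move=> Lg H.
pose F (n : nat) : set P := if unpickle n is Some q then
  (if `[< square (ratr (q : rat * rat * nat).1.1, ratr q.1.2) q.2.+1%:R^-1 `<=` Om >]
   then osquare (ratr q.1.1, ratr q.1.2) q.2.+1%:R^-1 else set0) else set0.
have hF n : ae_eq (mu2 R) (F n) g (cst 0).
  rewrite /F; case: unpickle => [q|]; last by apply: aeW.
  case: ifPn => [/asboolP sq|_]; last by apply: aeW.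
  have /= := @ae_zero_on_rect g _ _ _ _ _ _.
  set r := q.2.+1%:R^-1 in sq *; set x := (_, _) in sq *.
  move=> /(_ (x.1 - r) (x.1 + r) (x.2 - r) (x.2 + r)) HH.
  rewrite square_itv in sq.
  rewrite /ae_eq; apply: filterS (HH _ _) => [y h Dy||].
  - by move: (h Dy) => /= -[].
  - apply: (integrableS (measurable_Om oOm) (measurable_rect _ _ _ _) _ (L2_integrable oOm bOm Lg)).
    by move=> y [h1 h2]; apply: sq; split; apply: subset_itv_oo_cc.
  - move=> a' b' c' d' h1 h2 h3 h4; apply: zero_integral_rect => // y [].
    rewrite /= !in_itv /= => /andP[k1 k2] /andP[k3 k4]; apply: sq.
    by split; rewrite /= in_itv /=; apply/andP; split; lra.
rewrite /ae_eq; apply: filterS (ae_foralln hF) => x Hx Ox.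
move: Ox; rewrite (open_bigcup_square oOm) => -[q /= sq xq].
apply: (Hx (pickle q)); rewrite /F pickleK ifT//.
exact/asboolP.
Qed.

End FundamentalLemma.

(** * Weak derivatives and the energy space *)

Lemma bool_sum2_ge (R : realType) (F : bool -> bool -> R) i j :
  (forall k m, 0 <= F k m) -> F i j <= \sum_(k : bool) \sum_(m : bool) F k m.
Proof.
move=> F0; rewrite !big_bool /=.
have := F0 true true; have := F0 true false; have := F0 false true; have := F0 false false.
by case: i j => -[]; lra.
Qed.

Lemma bool_sum2_le (R : realType) (F : bool -> bool -> R) (e : R) :
  (forall k m, F k m <= e ^+ 2) -> \sum_(k : bool) \sum_(m : bool) F k m <= (2 * e) ^+ 2.
Proof.
move=> Fe; rewrite !big_bool /= exprMn.
have := Fe true true; have := Fe true false; have := Fe false true; have := Fe false false.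
by move: (e ^+ 2) => t; lra.
Qed.

Section WeakDerivatives.
Variable R : realType.
Local Notation P := (R * R)%type.
Variables (Om : set P) (M : R).
Hypotheses (oOm : open Om) (bOm : forall x, Om x -> `|x.1| <= M /\ `|x.2| <= M).
Implicit Types (f g h u v w phi psi : P -> R) (l : seq bool).
Local Notation N2 := (normL2 Om).
Let L2p := L2_psd oOm.
Let tL2 phi (t : test_fun Om phi) := test_L2 oOm bOm t.

Lemma normL2B0 f g : L2 Om f -> L2 Om g -> N2 (f - g) = 0 -> N2 (g - f) = 0.
Proof. by move=> Lf Lg; rewrite /normL2 (seminormBC L2p). Qed.

Lemma normL2_trans0 f g h : L2 Om f -> L2 Om g -> L2 Om h ->
  N2 (f - g) = 0 -> N2 (g - h) = 0 -> N2 (f - h) = 0.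
Proof.
move=> Lf Lg Lh fg gh; apply/eqP; rewrite eq_le seminorm_ge0 andbT.
rewrite -[f](subrK g) -addrA.
apply: (le_trans (seminorm_triangle L2p (psdB L2p Lf Lg) (psdB L2p Lg Lh))).
by rewrite -!/(normL2 _ _) fg gh addr0.
Qed.

Lemma normL2_eq0 f g : L2 Om f -> L2 Om g -> N2 (f - g) = 0 -> N2 f = N2 g.
Proof.
move=> Lf Lg fg; have Lfg := psdB L2p Lf Lg; have gf := normL2B0 Lf Lg fg.
have Lgf := psdB L2p Lg Lf.
apply/eqP; rewrite eq_le; apply/andP; split.
  rewrite -{1}[f](subrK g); apply: (le_trans (seminorm_triangle L2p Lfg Lg)).
  by rewrite -!/(normL2 _ _) fg add0r.
rewrite -{1}[g](subrK f); apply: (le_trans (seminorm_triangle L2p Lgf Lf)).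
by rewrite -!/(normL2 _ _) gf add0r.
Qed.

Lemma wder_L2 l u h : wder Om l u h -> L2 Om h. Proof. by case. Qed.

Lemma wder_unique l u h h' : wder Om l u h -> wder Om l u h' -> N2 (h - h') = 0.
Proof.
move=> [Lh wh] [Lh' wh']; apply: (ae_normL2 oOm) => //.
have /(fundamental_lemma oOm bOm (psdB L2p Lh Lh')) : forall psi, test_fun Om psi ->
    ip Om (h - h') psi = 0.
  move=> psi tpsi; rewrite (formBl L2p Lh Lh' (tL2 tpsi)).
  have := wh _ tpsi; rewrite (wh' _ tpsi) => /(mulfI _) E.
  by rewrite /ip E ?subrr// signr_eq0.
rewrite /ae_eq; apply: filterS => x H /H /= /eqP.
by rewrite subr_eq0 => /eqP.
Qed.

Lemma wder_nil u : L2 Om u -> wder Om [::] u u.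
Proof. by move=> Lu; split=> // psi _; rewrite expr0 mul1r. Qed.

Definition L2cvg (f_ : nat -> P -> R) h : Prop :=
  forall e : R, 0 < e -> exists n0, forall n, (n0 <= n)%N -> N2 (f_ n - h) <= e.

Lemma L2cvgP (f_ : nat -> P -> R) h : (forall n, L2 Om (f_ n)) -> L2 Om h ->
  L2cvg f_ h <-> (fun n => Defs.Rint Om (fun x => (f_ n x - h x) ^+ 2)) @ \oo --> (0 : R).
Proof.
move=> Lf Lh; have E n : Defs.Rint Om (fun x => (f_ n x - h x) ^+ 2) = N2 (f_ n - h) ^+ 2.
  by rewrite (sqr_seminorm L2p (psdB L2p (Lf n) Lh)).
split=> [H|].
  apply/cvgrPdist_le => e e0.
  have m0 : 0 < Num.min 1 e by rewrite lt_min ltr01.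
  have [n0 hn0] := H _ m0; exists n0 => // n /hn0.
  rewrite le_min => /andP[h1 h2]; rewrite sub0r normrN E ger0_norm ?sqr_ge0//.
  apply: le_trans h2; rewrite expr2 -[leRHS]mulr1.
  by rewrite ler_wpM2l// seminorm_ge0.
move/cvgrPdist_le => H e e0; have [n0 _ hn0] := H _ (exprn_gt0 2 e0).
exists n0 => n /hn0; rewrite /= sub0r normrN E ger0_norm ?sqr_ge0//.
by rewrite ler_pXn2r ?nnegrE ?seminorm_ge0// ltW.
Qed.

Lemma L2cvg_ip (f_ : nat -> P -> R) h g : (forall n, L2 Om (f_ n)) -> L2 Om h -> L2 Om g -> L2cvg f_ h ->
  ip Om (f_ n) g @[n --> \oo] --> ip Om h g.
Proof.
move=> Lf Lh Lg H; apply/cvgrPdist_le => e e0.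
have Ng : 0 < N2 g + 1 by rewrite ltr_wpDl// seminorm_ge0.
have [n0 hn0] := H _ (divr_gt0 e0 Ng); exists n0 => // n /hn0 hn.
rewrite distrC -(formBl L2p (Lf n) Lh Lg).
apply: (le_trans (form_CS L2p (psdB L2p (Lf n) Lh) Lg)).
apply: (@le_trans _ _ (e / (N2 g + 1) * (N2 g + 1))); last by rewrite divfK// gt_eqF.
by apply: ler_pM; rewrite ?seminorm_ge0// lerDl.
Qed.

Lemma L2cvg_lin c (f_ g_ : nat -> P -> R) f g : (forall n, L2 Om (f_ n)) -> (forall n, L2 Om (g_ n)) ->
  L2 Om f -> L2 Om g -> L2cvg f_ f -> L2cvg g_ g ->
  L2cvg (fun n => c *: f_ n + g_ n) (c *: f + g).
Proof.
move=> Lfn Lgn Lf Lg Hf Hg e e0.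
have c1 : 0 < `|c| + 1 by rewrite ltr_wpDl.
have e2 : 0 < e / 2 by rewrite divr_gt0.
have [n1 h1] := Hf _ (divr_gt0 e2 c1); have [n2 h2] := Hg _ e2.
exists (maxn n1 n2) => n; rewrite geq_max => /andP[/h1 k1 /h2 k2].
have -> : c *: f_ n + g_ n - (c *: f + g) = c *: (f_ n - f) + (g_ n - g).
  by rewrite scalerBr opprD addrACA.
have L1 := psdB L2p (Lfn n) Lf; have L2' := psdB L2p (Lgn n) Lg.
apply: (le_trans (seminorm_triangle L2p (psdZ L2p c L1) L2')).
rewrite (seminormZ L2p)// (splitr e) lerD//.
apply: (@le_trans _ _ ((`|c| + 1) * (e / 2 / (`|c| + 1)))).
  by apply: ler_pM; rewrite ?seminorm_ge0// lerDl.
by rewrite mulrC divfK// gt_eqF.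
Qed.

Lemma L2cvg_eq (f_ : nat -> P -> R) h h' : (forall n, L2 Om (f_ n)) -> L2 Om h -> L2 Om h' ->
  N2 (h - h') = 0 -> L2cvg f_ h -> L2cvg f_ h'.
Proof.
move=> Lf Lh Lh' hh H e e0; have [n0 hn0] := H e e0; exists n0 => n /hn0 hn.
rewrite -[f_ n](subrK h) -addrA.
apply: (le_trans (seminorm_triangle L2p (psdB L2p (Lf n) Lh) (psdB L2p Lh Lh'))).
by rewrite -!/(normL2 _ _) hh addr0.
Qed.

(** Weak differentiation is closed: the identity of integration by parts for [phi n] passes to the
    limit. As [H20] speaks of every weak derivative of [u], uniqueness up to null sets carries the
    convergence from [h l] to any other one. *)
Lemma H20_limit u (phi : nat -> P -> R) (h : seq bool -> P -> R) :
  (forall n, test_fun Om (phi n)) -> L2 Om u ->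
  (forall l, (size l <= 2)%N -> L2 Om (h l) /\ L2cvg (fun n => pder l (phi n)) (h l)) ->
  N2 (u - h [::]) = 0 ->
  H20 Om u /\ forall l, (size l <= 2)%N -> wder Om l u (h l).
Proof.
move=> tphi Lu Hh uh.
have Lp l n : L2 Om (pder l (phi n)) by apply: tL2; exact: test_pder.
have [Lh0 c0] := Hh [::] isT.
have wh l : (size l <= 2)%N -> wder Om l u (h l).
  move=> sl; have [Lh cl] := Hh l sl; split=> // psi tpsi.
  have Lpsi := tL2 tpsi; have Lpl := tL2 (test_pder l tpsi).
  rewrite -[LHS]/(ip Om u (pder l psi)) (ip_eq_normL2 oOm Lu Lh0 Lpl uh).
  have C1 := L2cvg_ip (Lp [::]) Lh0 Lpl c0.
  have C2 : (-1) ^+ size l * ip Om (pder l (phi n)) psi @[n --> \oo] -->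
      (-1) ^+ size l * ip Om (h l) psi.
    by apply: cvgMl_tmp; exact: L2cvg_ip.
  have E : (fun n => (-1) ^+ size l * ip Om (pder l (phi n)) psi) =
      (fun n => ip Om (pder [::] (phi n)) (pder l psi)).
    apply/funext => n; rewrite (ibp oOm bOm sl (tphi n) tpsi) mulrA -exprMn.
    by rewrite mulrNN mulr1 expr1n mul1r.
  rewrite E in C2.
  exact: (cvg_unique _ C1 C2).
split=> //; split.
  by split=> // l sl; exists (h l); exact: wh.
exists phi; split=> // l sl h' wh'.
have [Lh cl] := Hh l sl; have Lh' := wder_L2 wh'.
apply/(L2cvgP (Lp l) Lh'); apply: (L2cvg_eq (Lp l) Lh Lh') => //.
exact: wder_unique (wh l sl) wh'.
Qed.

Lemma H20_approx u : H20 Om u -> exists2 phi : nat -> P -> R,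
  (forall n, test_fun Om (phi n)) & forall l, (size l <= 2)%N ->
    forall h, wder Om l u h -> L2cvg (fun n => pder l (phi n)) h.
Proof.
move=> [_ [phi [tphi H]]]; exists phi => // l sl h wh.
apply/L2cvgP; [|exact: wder_L2 wh|exact: H].
by move=> n; apply: tL2; exact: test_pder.
Qed.

Lemma H20_L2 u : H20 Om u -> L2 Om u. Proof. by case=> -[]. Qed.

Definition wd u l := xget (fun=> 0) (wder Om l u).

Lemma wdP u l : H20 Om u -> (size l <= 2)%N -> wder Om l u (wd u l).
Proof. by move=> [[_ H] _] sl; apply: xgetPex; exact: H. Qed.

Lemma hessP u i j : H20 Om u -> wder Om [:: i; j] u (hess Om u i j).
Proof. by move=> Hu; exact: (@wdP u [:: i; j]). Qed.

Lemma hess_L2 u i j : H20 Om u -> L2 Om (hess Om u i j).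
Proof. by move=> Hu; apply: wder_L2; exact: hessP. Qed.

Lemma H20_lin_wder c u v : H20 Om u -> H20 Om v -> H20 Om (c *: u + v) /\
  forall l, (size l <= 2)%N -> wder Om l (c *: u + v) (c *: wd u l + wd v l).
Proof.
move=> Hu Hv; have [Lu Lv] := (H20_L2 Hu, H20_L2 Hv).
have [phi tphi cphi] := H20_approx Hu; have [psi tpsi cpsi] := H20_approx Hv.
have Lw w l : H20 Om w -> (size l <= 2)%N -> L2 Om (wd w l).
  by move=> Hw sl; exact: wder_L2 (wdP Hw sl).
apply: (@H20_limit _ (fun n => c *: phi n + psi n)).
- by move=> n; exact: test_lin.
- exact: (psd_lin L2p).
- move=> l sl; have [L1 L2'] := (Lw u l Hu sl, Lw v l Hv sl).
  split; first exact: (psd_lin L2p).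
  rewrite (_ : (fun n => _) = fun n => c *: pder l (phi n) + pder l (psi n)); last first.
    by apply/funext => n; exact: pder_linear (test_smooth (tphi n)) (test_smooth (tpsi n)).
  apply: L2cvg_lin => //.
  + by move=> n; apply: tL2; exact: test_pder.
  + by move=> n; apply: tL2; exact: test_pder.
  + by apply: cphi => //; exact: wdP.
  + by apply: cpsi => //; exact: wdP.
have [L1 L2'] := (Lw u [::] Hu isT, Lw v [::] Hv isT).
have -> : c *: u + v - (c *: wd u [::] + wd v [::]) = c *: (u - wd u [::]) + (v - wd v [::]).
  by rewrite scalerBr opprD addrACA.
have z1 : N2 (u - wd u [::]) = 0 by apply: wder_unique (wder_nil Lu) (wdP Hu _).
have z2 : N2 (v - wd v [::]) = 0 by apply: wder_unique (wder_nil Lv) (wdP Hv _).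
have L3 := psdB L2p Lu L1; have L4 := psdB L2p Lv L2'.
apply/eqP; rewrite eq_le seminorm_ge0 andbT.
apply: (le_trans (seminorm_triangle L2p (psdZ L2p c L3) L4)).
by rewrite (seminormZ L2p c L3) -!/(normL2 _ _) z1 z2 mulr0 addr0.
Qed.

(** [hess] picks some weak derivative, so linearity is only an equality in the [L2] seminorm. *)
Lemma hess_lin c u v i j : H20 Om u -> H20 Om v ->
  N2 (hess Om (c *: u + v) i j - (c *: hess Om u i j + hess Om v i j)) = 0.
Proof.
move=> Hu Hv; have [Huv W] := H20_lin_wder c Hu Hv.
exact: wder_unique (hessP i j Huv) (W [:: i; j] isT).
Qed.

Lemma test_wder phi : test_fun Om phi -> H20 Om phi /\
  forall l, (size l <= 2)%N -> wder Om l phi (pder l phi).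
Proof.
move=> tphi; apply: (@H20_limit _ (fun=> phi) (fun l => pder l phi)) => //.
- exact: tL2.
- move=> l _; split; first by apply: tL2; exact: test_pder.
  move=> e e0; exists 0%N => n _; rewrite subrr /normL2 /seminorm.
  by rewrite (form0l L2p (psd_0 L2p)) sqrtr0 ltW.
- by rewrite subrr /normL2 /seminorm (form0l L2p (psd_0 L2p)) sqrtr0.
Qed.

Lemma test_H20 phi : test_fun Om phi -> H20 Om phi.
Proof. by move=> /test_wder[]. Qed.

Lemma test_hess phi i j : test_fun Om phi -> N2 (hess Om phi i j - pder [:: i; j] phi) = 0.
Proof.
move=> tphi; have [H W] := test_wder tphi.
exact: wder_unique (hessP i j H) (W [:: i; j] isT).
Qed.

Lemma H20_psd : psd_form (H20 Om : set (P -> R)) (aform Om).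
Proof.
split.
- exact: test_H20 (test0 Om).
- by move=> c u v Hu Hv; exact: (H20_lin_wder c Hu Hv).1.
- move=> c u v w Hu Hv Hw; have [Huv _] := H20_lin_wder c Hu Hv.
  rewrite /aform mulr_sumr -big_split/=; apply: eq_bigr => i _.
  rewrite mulr_sumr -big_split/=; apply: eq_bigr => j _.
  have [L1 [L2' L3]] := (hess_L2 i j Hu, (hess_L2 i j Hv, hess_L2 i j Hw)).
  rewrite (ip_eq_normL2 oOm (hess_L2 i j Huv) (psd_lin L2p c L1 L2') L3 (hess_lin c i j Hu Hv)).
  exact: (psd_l L2p).
- move=> u v Hu Hv; rewrite /aform; apply: eq_bigr => i _; apply: eq_bigr => j _.
  by apply: (psd_sym L2p); exact: hess_L2.
- move=> u Hu; rewrite /aform; apply: sumr_ge0 => i _; apply: sumr_ge0 => j _.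
  by apply: (psd_ge0 L2p); exact: hess_L2.
Qed.
Let Hp := H20_psd.
Local Notation EN := (seminorm (aform Om)).

Lemma hess_le_seminorm u i j : H20 Om u -> N2 (hess Om u i j) <= EN u.
Proof.
move=> Hu; rewrite ler_wsqrtr// /aform.
have ge k m : 0 <= ip Om (hess Om u k m) (hess Om u k m).
  by apply: (psd_ge0 L2p); exact: hess_L2.
exact: (bool_sum2_ge i j ge).
Qed.

Lemma seminorm_le_hess u (e : R) : H20 Om u -> 0 <= e ->
  (forall i j, N2 (hess Om u i j) <= e) -> EN u <= 2 * e.
Proof.
move=> Hu e0 H; have ee : 0 <= 2 * e by rewrite mulr_ge0.
have k i j : ip Om (hess Om u i j) (hess Om u i j) <= e ^+ 2.
  rewrite -(sqr_seminorm L2p (hess_L2 i j Hu)) ler_pXn2r ?nnegrE ?seminorm_ge0//.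
  exact: H.
rewrite -(ger0_norm ee) -sqrtr_sqr ler_wsqrtr//.
exact: bool_sum2_le k.
Qed.

(** Any weak second derivatives [h] are allowed, since those obtained as limits in the completeness
    proof need not be the ones chosen by [hess]. *)
Lemma seminorm_test_sub u phi (h : bool -> bool -> P -> R) (e : R) : H20 Om u -> test_fun Om phi ->
  0 <= e -> (forall i j, wder Om [:: i; j] u (h i j)) ->
  (forall i j, N2 (pder [:: i; j] phi - h i j) <= e) -> EN (phi - u) <= 2 * e.
Proof.
move=> Hu tphi e0 wh H; have Hphi := test_H20 tphi.
apply: seminorm_le_hess => //; first exact: (psdB Hp).
move=> i j; apply: le_trans (H i j).
have [L1 L2'] := (hess_L2 i j Hphi, hess_L2 i j Hu).
have Lh := wder_L2 (wh i j); have Lp := tL2 (test_pder [:: i; j] tphi).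
have Hs : phi - u = (-1) *: u + phi by rewrite scaleN1r addrC.
rewrite le_eqVlt; apply/orP; left; apply/eqP; apply: normL2_eq0.
- by apply: hess_L2; exact: (psdB Hp).
- exact: (psdB L2p).
rewrite Hs.
apply: (@normL2_trans0 _ ((-1) *: hess Om u i j + hess Om phi i j)).
- by apply: hess_L2; exact: (psd_lin Hp).
- exact: (psd_lin L2p).
- exact: (psdB L2p).
- exact: hess_lin.
have -> : -1 *: hess Om u i j + hess Om phi i j - (pder [:: i; j] phi - h i j) =
    (hess Om phi i j - pder [:: i; j] phi) + (h i j - hess Om u i j).
  by rewrite scaleN1r opprB addrACA addrC; congr (_ + _); exact: addrC.
apply/eqP; rewrite eq_le seminorm_ge0 andbT.
apply: (le_trans (seminorm_triangle L2p (psdB L2p L1 Lp) (psdB L2p Lh L2'))).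
rewrite -!/(normL2 _ _) (test_hess i j tphi).
by rewrite (wder_unique (wh i j) (hessP i j Hu)) addr0.
Qed.

Lemma H20_dense u (e : R) : H20 Om u -> 0 < e ->
  exists2 phi, test_fun Om phi & EN (u - phi) <= e.
Proof.
move=> Hu e0; have [phi tphi cphi] := H20_approx Hu.
have e2 : 0 < e / 2 by rewrite divr_gt0.
have /choice [k hk] : forall ij : bool * bool, exists n0, forall n, (n0 <= n)%N ->
    N2 (pder [:: ij.1; ij.2] (phi n) - hess Om u ij.1 ij.2) <= e / 2.
  by move=> [i j]; apply: cphi => //; exact: hessP.
pose n := (\sum_(ij : bool * bool) k ij)%N.
exists (phi n) => //; rewrite (seminormBC Hp)//; last exact: test_H20.
have -> : e = 2 * (e / 2) by rewrite mulrC divfK.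
apply: (@seminorm_test_sub _ _ (hess Om u)) => //; first exact: ltW.
  by move=> i j; exact: hessP.
by move=> i j; apply: (hk (i, j)); rewrite /n (bigD1 (i, j))//= leq_addr.
Qed.

Definition volume := Num.sqrt (fine (mu2 R Om)).

Lemma volume_ge0 : 0 <= volume. Proof. exact: sqrtr_ge0. Qed.

Lemma test_pder2_le phi i j : test_fun Om phi -> N2 (pder [:: i; j] phi) <= EN phi.
Proof.
move=> tphi; have Hphi := test_H20 tphi.
rewrite -(normL2_eq0 (hess_L2 i j Hphi) (tL2 (test_pder [:: i; j] tphi)) (test_hess i j tphi)).
exact: hess_le_seminorm.
Qed.

Lemma test_sup phi x : test_fun Om phi -> `|phi x| <= EN phi * volume.
Proof.
move=> tphi; rewrite (test_quadrant bOm x tphi).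
apply: (le_trans (form_CS L2p (tL2 (test_pder [:: true; false] tphi)) (L2_quad_ind oOm bOm x))).
apply: ler_pM; rewrite ?seminorm_ge0//; last exact: normL2_quad_ind oOm bOm x.
exact: test_pder2_le.
Qed.

Lemma test_normL2 phi : test_fun Om phi -> N2 phi <= EN phi * volume ^+ 2.
Proof.
move=> tphi; rewrite expr2 mulrA; apply: (normL2_bounded oOm bOm).
- by apply: measurable_funS (continuous_measurable_plane (test_continuous tphi)).
- by rewrite mulr_ge0 ?seminorm_ge0 ?volume_ge0.
- by move=> x _; exact: test_sup.
Qed.

(** Integration by parts gives [|phi_i|^2 = - (phi, phi_ii)], so the bounds for orders zero and two
    yield the one for order one. *)
Lemma test_pder1_le phi i : test_fun Om phi -> N2 (pder [:: i] phi) <= EN phi * volume.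
Proof.
move=> tphi; have ti := test_pder [:: i] tphi.
rewrite -(@ler_pXn2r _ 2)// ?nnegrE ?mulr_ge0 ?seminorm_ge0 ?volume_ge0//.
rewrite (sqr_seminorm L2p (tL2 ti)) (ibp1 oOm bOm i tphi ti).
apply: (le_trans (ler_norm _)); rewrite normrN.
have tii := test_pder [:: i] ti.
apply: (le_trans (form_CS L2p (tL2 tphi) (tL2 tii))).
rewrite exprMn [_ ^+ 2 * _]mulrC [X in _ <= _ * X]expr2 mulrA.
apply: ler_pM; rewrite ?seminorm_ge0//; last exact: (test_pder2_le i i tphi).
by rewrite mulrC; exact: test_normL2.
Qed.

(** One constant for orders two, one and zero, whose own constants are the three summands; [volume]
    is the square root of the area. *)
Definition poincare := 1 + volume + volume ^+ 2.

Lemma poincare_ge0 : 0 <= poincare.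
Proof. by rewrite !addr_ge0 ?volume_ge0 ?sqr_ge0. Qed.

Lemma test_poincare phi l : test_fun Om phi -> (size l <= 2)%N -> N2 (pder l phi) <= EN phi * poincare.
Proof.
move=> tphi; have v0 := volume_ge0; have v2 := sqr_ge0 volume.
have e0 : 0 <= EN phi by exact: seminorm_ge0.
case: l => [|i [|j [|//]]] _.
- by apply: (le_trans (test_normL2 tphi)); rewrite ler_wpM2l// lerDr addr_ge0.
- apply: (le_trans (test_pder1_le i tphi)); rewrite ler_wpM2l// /poincare addrAC lerDr.
  by rewrite addr_ge0.
- apply: (le_trans (test_pder2_le i j tphi)); rewrite -[leLHS]mulr1 ler_wpM2l//.
  by rewrite /poincare -addrA lerDl addr_ge0.
Qed.

(** The Poincare inequality is at hand for test functions only. So [u n] is replaced by a test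
    function at energy distance [1 / (n + 1)]; the derivatives of these converge in [L2], and
    [H20_limit] identifies the limit. *)
Lemma H20_complete : form_complete (H20 Om : set (P -> R)) (aform Om).
Proof.
move=> u Hu cu.
have /choice [phi hphi] : forall n, exists phi, test_fun Om phi /\ EN (u n - phi) <= n.+1%:R^-1.
  move=> n; have n0 : 0 < n.+1%:R^-1 :> R by rewrite invr_gt0.
  by have [phi tphi hphi] := H20_dense (Hu n) n0; exists phi.
have tphi n : test_fun Om (phi n) by case: (hphi n).
have Hphi n : H20 Om (phi n) by exact: test_H20.
have K0 : 0 < poincare + 1 by rewrite ltr_wpDl// poincare_ge0.
have small e : 0 < e -> exists n0, forall n, (n0 <= n)%N -> EN (u n - phi n) <= e.
  move=> e0; have [n0 _ hn] := near_infty_natSinv_lt (PosNum e0).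
  by exists n0 => n /hn /= hh; apply: le_trans (hphi n).2 (ltW hh).
have cphi e : 0 < e -> exists n0, forall m n, (n0 <= m)%N -> (n0 <= n)%N -> EN (phi m - phi n) <= e.
  move=> e0; have e3 : 0 < e / 3 by rewrite divr_gt0.
  have [n1 h1] := small _ e3; have [n2 h2] := cu _ e3.
  exists (maxn n1 n2) => m n; rewrite !geq_max => /andP[m1 m2] /andP[k1 k2].
  have -> : phi m - phi n = (phi m - u m) + ((u m - u n) + (u n - phi n)).
    by rewrite subrKA subrKA.
  apply: (le_trans (seminorm_triangle Hp _ _)); try exact: (psdB Hp).
    by apply: (psdD Hp); exact: (psdB Hp).
  have T := seminorm_triangle Hp (psdB Hp (Hu m) (Hu n)) (psdB Hp (Hu n) (Hphi n)).
  have a1 := h1 m m1; have a2 := h1 n k1; have a3 := h2 m n m2 k2.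
  rewrite (seminormBC Hp)// in a1.
  by move: (EN _) (EN _) (EN _) (EN _) a1 a2 a3 T => a b c d; lra.
have Lp l n : L2 Om (pder l (phi n)) by apply: tL2; exact: test_pder.
have exh l : exists h, (size l <= 2)%N -> L2 Om h /\ L2cvg (fun n => pder l (phi n)) h.
  have [sl|] := leqP (size l) 2; last by exists 0.
  have [|h Lh ch] := L2_complete oOm (u_ := fun n => pder l (phi n)) (Lp l); last by exists h.
  move=> e e0; have [n0 hn0] := cphi _ (divr_gt0 e0 K0).
  exists n0 => m n m0 k0; have := hn0 m n m0 k0.
  have E : pder l (phi m) - pder l (phi n) = pder l (phi m - phi n).
    have := pder_linear l (-1) (test_smooth (tphi n)) (test_smooth (tphi m)).
    rewrite (_ : (fun x => _) = phi m - phi n); last first.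
      by apply/funext => x; rewrite mulN1r addrC.
    by move=> ->; apply/funext => x; rewrite mulN1r addrC.
  rewrite E => hmn.
  have tmn : test_fun Om (phi m - phi n).
    by rewrite -scaleN1r addrC; exact: test_lin.
  apply: (le_trans (test_poincare tmn sl)).
  apply: (@le_trans _ _ (e / (poincare + 1) * (poincare + 1))).
    by apply: ler_pM; rewrite ?seminorm_ge0 ?poincare_ge0// lerDl.
  by rewrite divfK// gt_eqF.
have [h hh] := choice exh.
have [Lh0 _] := hh [::] isT.
have [||Hw W] := @H20_limit (h [::]) phi h tphi Lh0.
- by move=> l sl; exact: hh.
- by rewrite subrr /normL2 /seminorm (form0l L2p (psd_0 L2p)) sqrtr0.
exists (h [::]); first exact: Hw.
move=> e e0; have e2 : 0 < e / 2 by rewrite divr_gt0.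
have e4 : 0 < e / 2 / 2 by rewrite divr_gt0.
have [n1 h1] := small _ e2.
have /choice [k hk] : forall ij : bool * bool, exists n0, forall n, (n0 <= n)%N ->
    N2 (pder [:: ij.1; ij.2] (phi n) - h [:: ij.1; ij.2]) <= e / 2 / 2.
  by move=> [i j]; have [_ c] := hh [:: i; j] isT; exact: c.
exists (maxn n1 (\sum_(ij : bool * bool) k ij)%N) => n; rewrite geq_max => /andP[/h1 k1 k2].
rewrite -[u n](subrK (phi n)) -addrA.
apply: (le_trans (seminorm_triangle Hp (psdB Hp (Hu n) (Hphi n)) (psdB Hp (Hphi n) Hw))).
rewrite (splitr e); apply: lerD; first exact: k1.
have -> : e / 2 = 2 * (e / 2 / 2) by rewrite [RHS]mulrC divfK.
apply: (@seminorm_test_sub _ _ (fun i j => h [:: i; j]) _ Hw (tphi n) (ltW e4)).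
  by move=> i j; exact: W.
move=> i j; apply: (hk (i, j)); apply: leq_trans k2.
by rewrite (bigD1 (i, j))//= leq_addr.
Qed.

(* [ev ^~ u] is the continuous representative of [u]. *)
Definition ev (p : P) u := ip Om (hess Om u true false) (quad_ind p).

Lemma ev_lipschitz u p q : H20 Om u ->
  `|ev q u - ev p u| <= EN u * N2 (quad_ind q - quad_ind p).
Proof.
move=> Hu; have Lh := hess_L2 true false Hu.
have [Lq Lp] := (L2_quad_ind oOm bOm q, L2_quad_ind oOm bOm p).
rewrite /ev -(formBr L2p Lq Lp Lh).
apply: (le_trans (form_CS L2p Lh (psdB L2p Lq Lp))).
by rewrite ler_wpM2r ?seminorm_ge0// hess_le_seminorm.
Qed.

Lemma ev_bound u p : H20 Om u -> `|ev p u| <= EN u * volume.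
Proof.
move=> Hu; apply: (le_trans (form_CS L2p (hess_L2 true false Hu) (L2_quad_ind oOm bOm p))).
apply: ler_pM; rewrite ?seminorm_ge0//; first exact: hess_le_seminorm.
exact: (normL2_quad_ind oOm bOm p).
Qed.

Lemma ev_continuous u : H20 Om u -> continuous (ev ^~ u).
Proof.
move=> Hu p; apply/cvgrPdist_le => e e0.
have K0 : 0 < EN u + 1 by rewrite ltr_wpDl// seminorm_ge0.
have [r r0 hr] := quad_ind_continuous oOm bOm p (divr_gt0 e0 K0).
apply: filterS (square_nbhs p r0) => q /hr hq; rewrite distrC.
apply: (le_trans (ev_lipschitz p q Hu)).
apply: (@le_trans _ _ ((EN u + 1) * (e / (EN u + 1)))).
  by apply: ler_pM; rewrite ?seminorm_ge0// lerDl.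
by rewrite mulrC divfK// gt_eqF.
Qed.

(** A test function is its own evaluation, by [test_quadrant], so both sides are compared with an
    approximating [phi n]. An error [delta] in the mixed derivative costs [delta * volume] pointwise
    and [delta * volume^2] in [L2]. *)
Lemma ae_ev u : H20 Om u -> ae_eq (mu2 R) Om u (ev ^~ u).
Proof.
move=> Hu; have [phi tphi cphi] := H20_approx Hu; have Lu := H20_L2 Hu.
have mev : measurable_fun (Om : set (plane R)) (ev ^~ u : plane R -> R).
  by apply: measurable_funS (continuous_measurable_plane (ev_continuous Hu)).
have Lev : L2 Om (ev ^~ u).
  by apply: (L2_bounded oOm bOm mev) => x _; exact: ev_bound.
have c0 := cphi [::] isT u (wder_nil Lu).
have ch := cphi [:: true; false] isT _ (hessP true false Hu).
have Lh := hess_L2 true false Hu.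
apply: (normL2_ae oOm) => //.
apply/eqP; rewrite eq_le seminorm_ge0 andbT; apply/ler_addgt0Pr => e e0; rewrite add0r.
have e2 : 0 < e / 2 by rewrite divr_gt0.
have K0 : 0 < volume * volume + 1 by rewrite ltr_wpDl// mulr_ge0 ?volume_ge0.
have [n1 h1] := c0 _ e2; have [n2 h2] := ch _ (divr_gt0 e2 K0).
have k1 := h1 _ (leq_maxl n1 n2); have k2 := h2 _ (leq_maxr n1 n2).
set n := maxn n1 n2 in k1 k2; have Lphi := tL2 (tphi n).
have Lp := tL2 (test_pder [:: true; false] (tphi n)).
have -> : u - ev ^~ u = (u - phi n) + (phi n - ev ^~ u) by rewrite subrKA.
apply: (le_trans (seminorm_triangle L2p (psdB L2p Lu Lphi) (psdB L2p Lphi Lev))).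
rewrite (splitr e); apply: lerD.
  by rewrite (seminormBC L2p Lu Lphi); exact: k1.
have e2K := divr_gt0 e2 K0.
apply: (@le_trans _ _ ((e / 2 / (volume * volume + 1)) * volume * volume)).
  apply: (normL2_bounded oOm bOm).
  - apply: measurable_funB => //; exact: Lphi.1.
  - exact: (mulr_ge0 (ltW e2K) volume_ge0).
  move=> x _; have -> : (phi n - ev ^~ u) x = phi n x - ev x u by [].
  have Lx := L2_quad_ind oOm bOm x.
  rewrite (test_quadrant bOm x (tphi n)) /ev -(formBl L2p Lp Lh Lx).
  apply: (le_trans (form_CS L2p (psdB L2p Lp Lh) Lx)).
  exact: (ler_pM (seminorm_ge0 _ _) (seminorm_ge0 _ _) k2 (normL2_quad_ind oOm bOm x)).
rewrite -mulrA -[leRHS](@divfK _ (volume * volume + 1)) ?gt_eqF//.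
by rewrite ler_wpM2l ?(ltW e2K)// lerDl.
Qed.

Lemma ae_bound u : H20 Om u -> {ae mu2 R, forall x, Om x -> `|u x| <= EN u * volume}.
Proof.
move=> Hu; have := ae_ev Hu; rewrite /ae_eq; apply: filterS => x h Ox.
by rewrite (h Ox); exact: ev_bound.
Qed.

End WeakDerivatives.

(** * The von Karman trilinear form *)

Section BoundedMultiplier.
Context d (T : measurableType d) (R : realType).
Variables (mu : {measure set T -> \bar R}) (D : set T).
Hypothesis mD : measurable D.
Implicit Types f z : T -> R.

Lemma integrable_ae_bounded_mul f z (C : R) : 0 <= C ->
  mu.-integrable D (EFin \o f) -> measurable_fun D z ->
  {ae mu, forall x, D x -> `|z x| <= C} ->
  mu.-integrable D (EFin \o (fun x => f x * z x)) /\
  `|(\int[mu]_(x in D) (f x * z x))%R| <= C * (\int[mu]_(x in D) `|f x|)%R.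
Proof.
move=> C0 intf mz zC; have /integrableP[mf _] := intf.
have {}mf : measurable_fun D f by apply/measurable_EFinP.
(* The truncation agrees with [z] almost everywhere and obeys the bound everywhere, so domination by
   [C |f|] applies pointwise. *)
pose z' x := Num.max (- C) (Num.min C (z x)).
have z'C x : `|z' x| <= C.
  by rewrite ler_norml le_max lexx /= ge_max ge_min lexx /= andbT ge0_cp.
have mz' : measurable_fun D z'.
  apply: measurable_maxr; first exact: measurable_cst.
  by apply: measurable_minr => //; exact: measurable_cst.
have zz' : {ae mu, forall x, D x -> z x = z' x}.
  apply: filterS zC => x h /h; rewrite ler_norml /z' => /andP[h1 h2].
  by rewrite (min_idPr h2) (max_idPr h1).
have mfz := measurable_funM mf mz; have mfz' := measurable_funM mf mz'.
have iCf : mu.-integrable D (EFin \o (fun x => C * `|f x|)).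
  rewrite (_ : _ \o _ = (fun x => C%:E * (abse \o (EFin \o f)) x)%E).
    by apply: integrableZl => //; exact: integrable_abse.
  by apply/funext => x /=; rewrite EFinM.
have ifz' : mu.-integrable D (EFin \o (fun x => f x * z' x)).
  apply: (le_integrable mD _ _ iCf); first exact/measurable_EFinP.
  move=> x Dx; rewrite /= lee_fin normrM [leRHS]ger0_norm ?mulr_ge0//.
  by rewrite mulrC ler_wpM2r.
have ifz : mu.-integrable D (EFin \o (fun x => f x * z x)).
  apply/integrableP; split; first exact/measurable_EFinP.
  move/integrableP : ifz' => [_]; apply: le_lt_trans.
  rewrite le_eqVlt; apply/orP; left; apply/eqP; apply: ae_eq_integral => //.
  - by apply: measurableT_comp => //; exact/measurable_EFinP.
  - by apply: measurableT_comp => //; exact/measurable_EFinP.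
  by rewrite /ae_eq; apply: filterS zz' => x h Dx; rewrite /= h.
split=> //.
have -> : (\int[mu]_(x in D) (f x * z x))%R = (\int[mu]_(x in D) (f x * z' x))%R.
  rewrite /Rintegral; congr fine; apply: ae_eq_integral => //; try exact/measurable_EFinP.
  by rewrite /ae_eq; apply: filterS zz' => x h Dx; rewrite /= h.
apply: (le_trans (le_normr_Rintegral mD ifz')).
rewrite -RintegralZl//; last exact: integrable_abse intf.
apply: le_Rintegral => //; first exact: integrable_abse ifz'.
by move=> x Dx; rewrite normrM mulrC ler_wpM2r.
Qed.

End BoundedMultiplier.

Lemma bracket_comm (R : comPzRingType) (a b c d e f k : R) :
  a * b + c * d - k * (e * f) = d * c + b * a - k * (f * e).
Proof. by ring. Qed.

Lemma bracket_lin (R : comPzRingType) (r k a b c a' b' c' x y z t : R) :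
  ((r * a + a') * x + (r * b + b') * y - k * ((r * c + c') * z)) * t =
  r * ((a * x + b * y - k * (c * z)) * t) + (a' * x + b' * y - k * (c' * z)) * t.
Proof. by ring. Qed.

(** The primed functions are derivatives that arise in another order of differentiation; [s] and [t]
    are the third derivatives in the two rows of the cofactor matrix, and they cancel. *)
Lemma bracket_divergence (T : Type) (R : comPzRingType)
    (a b c d e f p q s t s' t' f' d' e' f'' : T -> R) (x : T) :
  s' = s -> t' = t -> f' = f -> d' = d -> e' = e -> f'' = f ->
  (s x * p x + b x * d' x) + -1 * (t x * q x + c x * f'' x) +
    ((t' x * q x + a x * e' x) + -1 * (s' x * p x + c x * f' x)) =
  a x * e x + b x * d x - 2 * (c x * f x).
Proof. by move=> -> -> -> -> -> ->; ring. Qed.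

(** The cofactor matrix of a symmetric matrix is symmetric; as a bilinear form of two gradients it
    may exchange them. This is the source of the symmetry of [b] in its last two arguments. *)
Lemma cofactor_sym (R : comPzRingType) (a b c x y x' y' : R) :
  (b * x + -1 * (c * y)) * x' + (a * y + -1 * (c * x)) * y' =
  (b * x' + -1 * (c * y')) * x + (a * y' + -1 * (c * x')) * y.
Proof. by ring. Qed.

Lemma sum4_le (R : realDomainType) (p q r s : R) :
  p <= s -> q <= s -> r <= s -> p + q + 2 * r <= 4 * s.
Proof. by lra. Qed.

Lemma half_norm_le (R : realFieldType) (t x : R) :
  `|t| <= 4 * x -> `|- (1 / 2) * t| <= 2 * x.
Proof.
by rewrite !ler_norml => /andP[h1 h2]; apply/andP; split; lra.
Qed.

Section Trilinear.
Variable R : realType.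
Local Notation P := (R * R)%type.
Variables (Om : set P) (M : R).
Hypotheses (oOm : open Om) (bOm : forall x, Om x -> `|x.1| <= M /\ `|x.2| <= M).
Implicit Types (f g h u v w z phi psi chi : P -> R).
Local Notation N2 := (normL2 Om).
Local Notation EN := (seminorm (aform Om)).
Let L2p := L2_psd oOm.
Let Hp := H20_psd oOm bOm.
Let mO := measurable_Om oOm.

Lemma L2_abs f : L2 Om f -> L2 Om (fun x => `|f x|) /\ N2 (fun x => `|f x|) = N2 f.
Proof.
move=> [mf f2]; split.
  split; first by apply: measurableT_comp mf.
  move: f2; congr (_.-integrable _ _); apply/funext => x.
  by rewrite -[in LHS](real_normK (num_real (f x))).
rewrite /normL2 /seminorm; congr Num.sqrt; apply: eq_Rintegral => x _.
by rewrite -normrM ger0_norm// -expr2 sqr_ge0.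
Qed.

Lemma Rint_abs_mul f g : L2 Om f -> L2 Om g ->
  Rintegral (mu2 R) Om (fun x => `|f x * g x|) <= N2 f * N2 g.
Proof.
move=> /L2_abs[Lf <-] /L2_abs[Lg <-].
have := le_trans (ler_norm _) (form_CS L2p Lf Lg); apply: le_trans.
rewrite le_eqVlt; apply/orP; left; apply/eqP; apply: eq_Rintegral => x _.
by rewrite normrM.
Qed.

(** The entries are free, in the order xx, yy, xy, so that chosen Hessians, derivatives of test
    functions and linear combinations share one set of lemmas. *)
Definition bracket (a b c a' b' c' : P -> R) : P -> R :=
  fun x => a x * b' x + b x * a' x - 2 * (c x * c' x).

Lemma bracket_integrable a b c a' b' c' :
  L2 Om a -> L2 Om b -> L2 Om c -> L2 Om a' -> L2 Om b' -> L2 Om c' ->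
  (mu2 R).-integrable Om (EFin \o bracket a b c a' b' c') /\
  Rintegral (mu2 R) Om (fun x => `|bracket a b c a' b' c' x|) <=
    N2 a * N2 b' + N2 b * N2 a' + 2 * (N2 c * N2 c').
Proof.
move=> La Lb Lc La' Lb' Lc'.
have i1 := L2_mul oOm La Lb'; have i2 := L2_mul oOm Lb La'; have i3 := L2_mul oOm Lc Lc'.
have i3' : (mu2 R).-integrable Om (EFin \o (fun x => 2 * (c x * c' x))).
  rewrite (_ : _ \o _ = (fun x => 2%:E * (EFin \o (fun x => (c x * c' x)%R)) x)%E).
    exact: integrableZl.
  by apply/funext => x /=; rewrite EFinM.
have ib : (mu2 R).-integrable Om (EFin \o bracket a b c a' b' c').
  rewrite (_ : _ \o _ = ((EFin \o (fun x => (a x * b' x)%R)) \+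
     (EFin \o (fun x => (b x * a' x)%R)) \- (EFin \o (fun x => (2 * (c x * c' x))%R)))%E).
    by apply: integrableB => //; exact: integrableD.
  by apply/funext => x.
split=> //.
have j1 := integrable_abse i1; have j2 := integrable_abse i2; have j3 := integrable_abse i3.
have j3' : (mu2 R).-integrable Om (EFin \o (fun x => 2 * `|c x * c' x|)).
  rewrite (_ : _ \o _ = (fun x => 2%:E * (abse \o (EFin \o (fun x => (c x * c' x)%R))) x)%E).
    exact: integrableZl.
  by apply/funext => x /=; rewrite EFinM.
have j12 : (mu2 R).-integrable Om (EFin \o (fun x => `|a x * b' x| + `|b x * a' x|)).
  exact: (integrableD mO j1 j2).
apply: (@le_trans _ _ (Rintegral (mu2 R) Om
   (fun x => `|a x * b' x| + `|b x * a' x| + 2 * `|c x * c' x|))).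
  apply: le_Rintegral => //.
  - exact: integrable_abse ib.
  - exact: (integrableD mO j12 j3').
  move=> x _; rewrite /bracket; apply: (le_trans (ler_normB _ _)).
  by apply: lerD; [exact: ler_normD|rewrite normrM ger0_norm].
rewrite RintegralD// RintegralD// RintegralZl//.
by apply: lerD; [apply: lerD; exact: Rint_abs_mul|rewrite ler_wpM2l// Rint_abs_mul].
Qed.

Lemma vkbE u w : vkb Om u w = bracket
  (hess Om u true true) (hess Om u false false) (hess Om u true false)
  (hess Om w true true) (hess Om w false false) (hess Om w true false).
Proof. by []. Qed.

Lemma vkb_integrable u w : H20 Om u -> H20 Om w ->
  (mu2 R).-integrable Om (EFin \o vkb Om u w) /\
  Rintegral (mu2 R) Om (fun x => `|vkb Om u w x|) <= 4 * (EN u * EN w).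
Proof.
move=> Hu Hw; have Lu i j := hess_L2 i j Hu; have Lw i j := hess_L2 i j Hw.
have [I B] := bracket_integrable (Lu true true) (Lu false false) (Lu true false)
  (Lw true true) (Lw false false) (Lw true false).
split; first exact: I.
apply: (le_trans B).
have le i j k l : N2 (hess Om u i j) * N2 (hess Om w k l) <= EN u * EN w.
  by apply: ler_pM; rewrite ?seminorm_ge0//; exact: (hess_le_seminorm oOm).
exact: (sum4_le (le _ _ _ _) (le _ _ _ _) (le _ _ _ _)).
Qed.

Definition ess_le (e : R) z : Prop := {ae mu2 R, forall x, Om x -> `|z x| <= e}.

Lemma ip_vkb_bound u w z e : 0 <= e -> H20 Om u -> H20 Om w -> H20 Om z -> ess_le e z ->
  (mu2 R).-integrable Om (EFin \o (fun x => vkb Om u w x * z x)) /\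
  `|ip Om (vkb Om u w) z| <= 4 * EN u * EN w * e.
Proof.
move=> e0 Hu Hw Hz ze; have [I B] := vkb_integrable Hu Hw.
have [J C] := integrable_ae_bounded_mul mO e0 I (H20_L2 Hz).1 ze.
split; first exact: J.
apply: (le_trans C); rewrite mulrC ler_wpM2r//.
by apply: (le_trans B); rewrite mulrA.
Qed.

Lemma bform_ess_bound u w z e : 0 <= e -> H20 Om u -> H20 Om w -> H20 Om z -> ess_le e z ->
  `|bform Om u w z| <= 2 * EN u * EN w * e.
Proof.
move=> e0 Hu Hw Hz ze; have [_ B] := ip_vkb_bound e0 Hu Hw Hz ze.
have E := @half_norm_le R (ip Om (vkb Om u w) z) (EN u * EN w * e).
rewrite !mulrA in E; exact: (E B).
Qed.

Lemma bform_bound u w z : H20 Om u -> H20 Om w -> H20 Om z ->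
  `|bform Om u w z| <= 2 * volume Om * EN u * EN w * EN z.
Proof.
move=> Hu Hw Hz.
have e0 : 0 <= EN z * volume Om by rewrite mulr_ge0 ?seminorm_ge0 ?volume_ge0.
apply: (le_trans (bform_ess_bound e0 Hu Hw Hz (ae_bound oOm bOm Hz))).
by move: (EN u) (EN w) (EN z) (volume Om) => a b c k; rewrite le_eqVlt; apply/orP; left; apply/eqP; ring.
Qed.

Lemma vkb_mul_integrable u w z : H20 Om u -> H20 Om w -> H20 Om z ->
  (mu2 R).-integrable Om (EFin \o (fun x => vkb Om u w x * z x)).
Proof.
move=> Hu Hw Hz.
have e0 : 0 <= EN z * volume Om by rewrite mulr_ge0 ?seminorm_ge0 ?volume_ge0.
by have [] := ip_vkb_bound e0 Hu Hw Hz (ae_bound oOm bOm Hz).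
Qed.

Lemma Rint_lin c f g : (mu2 R).-integrable Om (EFin \o f) -> (mu2 R).-integrable Om (EFin \o g) ->
  Rintegral (mu2 R) Om (fun x => c * f x + g x) =
  c * Rintegral (mu2 R) Om f + Rintegral (mu2 R) Om g.
Proof.
move=> i1 i2; rewrite RintegralD//; first by rewrite RintegralZl.
rewrite (_ : _ \o _ = (fun x => c%:E * (EFin \o f) x)%E); first exact: integrableZl.
by apply/funext => x /=; rewrite EFinM.
Qed.

Lemma bform_linr u w c z1 z2 : H20 Om u -> H20 Om w -> H20 Om z1 -> H20 Om z2 ->
  bform Om u w (c *: z1 + z2) = c * bform Om u w z1 + bform Om u w z2.
Proof.
move=> Hu Hw H1 H2; rewrite /bform.
have -> : ip Om (vkb Om u w) (c *: z1 + z2) =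
    c * ip Om (vkb Om u w) z1 + ip Om (vkb Om u w) z2.
  rewrite -[RHS](Rint_lin c (vkb_mul_integrable Hu Hw H1) (vkb_mul_integrable Hu Hw H2)).
  apply: eq_Rintegral => x _; move: (vkb Om u w) => b.
  by rewrite (_ : (c *: z1 + z2) x = c * z1 x + z2 x)//; ring.
by move: (ip _ _ _) (ip _ _ _) => s t; ring.
Qed.

Lemma bform_sym12 u w z : bform Om u w z = bform Om w u z.
Proof.
have E : vkb Om u w = vkb Om w u by apply/funext => x; rewrite /vkb; exact: bracket_comm.
by rewrite /bform E.
Qed.

Lemma ip_bracket_lin k a b c a1 b1 c1 a2 b2 c2 a' b' c' z :
  ae_eq (mu2 R) Om a (k *: a1 + a2) -> ae_eq (mu2 R) Om b (k *: b1 + b2) ->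
  ae_eq (mu2 R) Om c (k *: c1 + c2) ->
  (mu2 R).-integrable Om (EFin \o (fun x => bracket a b c a' b' c' x * z x)) ->
  (mu2 R).-integrable Om (EFin \o (fun x => bracket a1 b1 c1 a' b' c' x * z x)) ->
  (mu2 R).-integrable Om (EFin \o (fun x => bracket a2 b2 c2 a' b' c' x * z x)) ->
  ip Om (bracket a b c a' b' c') z =
  k * ip Om (bracket a1 b1 c1 a' b' c') z + ip Om (bracket a2 b2 c2 a' b' c') z.
Proof.
move=> ea eb ec I I1 I2; apply: (etrans _ (Rint_lin k I1 I2)).
rewrite /ip /Defs.Rint /Rintegral; congr fine; apply: ae_eq_integral.
- exact: mO.
- by have /integrableP[] := I.
- have /integrableP[m1 _] := I1; have /integrableP[m2 _] := I2.
  apply/measurable_EFinP; apply: measurable_funD; last exact/measurable_EFinP.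
  by apply: measurable_funM; [exact: measurable_cst|exact/measurable_EFinP].
rewrite /ae_eq; apply: filterS3 ea eb ec => x h1 h2 h3 Ox; congr EFin.
rewrite /bracket (h1 Ox) (h2 Ox) (h3 Ox); exact: bracket_lin.
Qed.

Lemma bform_linl c u1 u2 w z : H20 Om u1 -> H20 Om u2 -> H20 Om w -> H20 Om z ->
  bform Om (c *: u1 + u2) w z = c * bform Om u1 w z + bform Om u2 w z.
Proof.
move=> H1 H2 Hw Hz; rewrite /bform.
have H12 := psd_lin Hp c H1 H2.
have ae i j : ae_eq (mu2 R) Om (hess Om (c *: u1 + u2) i j)
    (c *: hess Om u1 i j + hess Om u2 i j).
  apply: (normL2_ae oOm); last exact: (hess_lin oOm bOm).
    exact: hess_L2.
  by apply: (psd_lin L2p); exact: hess_L2.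
have E := ip_bracket_lin (ae true true) (ae false false) (ae true false)
  (vkb_mul_integrable H12 Hw Hz) (vkb_mul_integrable H1 Hw Hz) (vkb_mul_integrable H2 Hw Hz).
rewrite !vkbE E; move: (ip _ _ _) (ip _ _ _) => s t; ring.
Qed.

Lemma bform_linm c u w1 w2 z : H20 Om u -> H20 Om w1 -> H20 Om w2 -> H20 Om z ->
  bform Om u (c *: w1 + w2) z = c * bform Om u w1 z + bform Om u w2 z.
Proof.
move=> Hu H1 H2 Hz.
by rewrite (bform_sym12 u) (bform_linl c H1 H2 Hu Hz) (bform_sym12 w1) (bform_sym12 w2).
Qed.

Definition pbracket phi psi := bracket
  (pder [:: true; true] phi) (pder [:: false; false] phi) (pder [:: true; false] phi)
  (pder [:: true; true] psi) (pder [:: false; false] psi) (pder [:: true; false] psi).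

Lemma ip_bracket_ae a b c a1 b1 c1 a' b' c' a1' b1' c1' z :
  ae_eq (mu2 R) Om a a1 -> ae_eq (mu2 R) Om b b1 -> ae_eq (mu2 R) Om c c1 ->
  ae_eq (mu2 R) Om a' a1' -> ae_eq (mu2 R) Om b' b1' -> ae_eq (mu2 R) Om c' c1' ->
  (mu2 R).-integrable Om (EFin \o bracket a b c a' b' c') ->
  (mu2 R).-integrable Om (EFin \o bracket a1 b1 c1 a1' b1' c1') ->
  measurable_fun (Om : set (plane R)) (z : plane R -> R) ->
  ip Om (bracket a b c a' b' c') z = ip Om (bracket a1 b1 c1 a1' b1' c1') z.
Proof.
move=> e1 e2 e3 e4 e5 e6 /integrableP[m1 _] /integrableP[m2 _] mz.
have ez : ae_eq (mu2 R) Om z z by exact: ae_eq_refl.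
apply: (sqip_ae mO) => //; try exact/measurable_EFinP.
have A : {ae mu2 R, forall x : plane R, Om x -> [/\ a x = a1 x, b x = b1 x & c x = c1 x]}.
  apply: filterS3 e1 e2 e3 => x h1 h2 h3 Ox.
  by split; [exact: h1|exact: h2|exact: h3].
have B : {ae mu2 R, forall x : plane R, Om x -> [/\ a' x = a1' x, b' x = b1' x & c' x = c1' x]}.
  apply: filterS3 e4 e5 e6 => x h1 h2 h3 Ox.
  by split; [exact: h1|exact: h2|exact: h3].
have : {ae mu2 R, forall x : plane R, Om x -> bracket a b c a' b' c' x = bracket a1 b1 c1 a1' b1' c1' x}; last by [].
apply: filterS2 A B => x K1 K2 Ox.
by have [k1 k2 k3] := K1 Ox; have [l1 l2 l3] := K2 Ox; rewrite /bracket k1 k2 k3 l1 l2 l3.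
Qed.

Lemma bform_test phi psi chi : test_fun Om phi -> test_fun Om psi -> test_fun Om chi ->
  bform Om phi psi chi = - (1 / 2) * ip Om (pbracket phi psi) chi.
Proof.
move=> t1 t2 t3.
have [H1 H2] : H20 Om phi /\ H20 Om psi by split; exact: (test_H20 oOm bOm).
have Lp g (t : test_fun Om g) i j := test_L2 oOm bOm (test_pder [:: i; j] t).
have [ib _] := bracket_integrable
  (Lp _ t1 true true) (Lp _ t1 false false) (Lp _ t1 true false)
  (Lp _ t2 true true) (Lp _ t2 false false) (Lp _ t2 true false).
have [iv _] := vkb_integrable H1 H2.
have ae g (t : test_fun Om g) i j : ae_eq (mu2 R) Om (hess Om g i j) (pder [:: i; j] g).
  apply: (normL2_ae oOm); last exact: (test_hess oOm bOm i j t).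
    by apply: hess_L2; exact: (test_H20 oOm bOm).
  exact: Lp.
have E := ip_bracket_ae (ae _ t1 true true) (ae _ t1 false false) (ae _ t1 true false)
  (ae _ t2 true true) (ae _ t2 false false) (ae _ t2 true false) iv ib (test_L2 oOm bOm t3).1.
exact: (congr1 (fun r => - (1 / 2) * r) E).
Qed.

(** With [cof_y], the components of the cofactor matrix of the Hessian of [phi] applied to the
    gradient of [psi]. *)
Definition cof_x phi psi : P -> R := fun x =>
  pder [:: false; false] phi x * pder [:: true] psi x +
  -1 * (pder [:: true; false] phi x * pder [:: false] psi x).

Definition cof_y phi psi : P -> R := fun x =>
  pder [:: true; true] phi x * pder [:: false] psi x +
  -1 * (pder [:: true; false] phi x * pder [:: true] psi x).

Lemma pder_sub1 l g h : smooth g -> smooth h ->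
  pder l (fun x => g x + -1 * h x) = fun x => pder l g x + -1 * pder l h x.
Proof.
move=> sg sh; rewrite (_ : (fun x => _) = fun x => -1 * h x + g x).
  by rewrite (pder_linear l (-1) sh sg); apply/funext => x; rewrite addrC.
by apply/funext => x; rewrite addrC.
Qed.

(* Divergence form of the bracket: the cofactor matrix of the Hessian of
   [phi] is divergence free. *)
Lemma pbracket_divergence phi psi : smooth phi -> smooth psi ->
  (fun x => pder [:: true] (cof_x phi psi) x + pder [:: false] (cof_y phi psi) x) =
  pbracket phi psi.
Proof.
move=> s1 s2.
have [sff stf stt] : [/\ smooth (pder [:: false; false] phi),
   smooth (pder [:: true; false] phi) & smooth (pder [:: true; true] phi)].
  by split; exact: smooth_pder.
have [st sf] : smooth (pder [:: true] psi) /\ smooth (pder [:: false] psi).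
  by split; exact: smooth_pder.
have E1 : pder [:: false] (pder [:: true; false] phi) = pder [:: true] (pder [:: false; false] phi).
  have := schwarz (smooth_pder [:: false] s1); rewrite -!pder_cat => E.
  exact: esym E.
have E2 : pder [:: false] (pder [:: true; true] phi) = pder [:: true] (pder [:: true; false] phi).
  have := schwarz (smooth_pder [:: true] s1); rewrite -!pder_cat => E.
  apply: (etrans (esym E)).
  exact: (congr1 (pder [:: true]) (esym (schwarz s1))).
have E3 : pder [:: false] (pder [:: true] psi) = pder [:: true; false] psi.
  by rewrite -pder_cat; exact: (esym (schwarz s2)).
have E4 : pder [:: true] (pder [:: true] psi) = pder [:: true; true] psi.
  exact: (esym (pder_cat [:: true] [:: true] psi)).
have E5 : pder [:: false] (pder [:: false] psi) = pder [:: false; false] psi.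
  exact: (esym (pder_cat [:: false] [:: false] psi)).
have E6 : pder [:: true] (pder [:: false] psi) = pder [:: true; false] psi.
  exact: (esym (pder_cat [:: true] [:: false] psi)).
apply/funext => x; rewrite /cof_x /cof_y.
rewrite (pder_sub1 [:: true] (smooth_mul sff st) (smooth_mul stf sf)).
rewrite (pder_sub1 [:: false] (smooth_mul stt sf) (smooth_mul stf st)).
rewrite (pder1_mul true sff st) (pder1_mul true stf sf).
rewrite (pder1_mul false stt sf) (pder1_mul false stf st).
exact: (bracket_divergence _ _ _ _ _ x E1 E2 E3 E4 E5 E6).
Qed.

Lemma test_cof phi psi : test_fun Om phi -> test_fun Om psi ->
  test_fun Om (cof_x phi psi) /\ test_fun Om (cof_y phi psi).
Proof.
move=> t1 t2.
have sub1 g h : test_fun Om g -> test_fun Om h -> test_fun Om (fun x => g x + -1 * h x).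
  move=> tg th; rewrite (_ : (fun x => _) = (-1) *: h + g); first exact: test_lin.
  by apply/funext => x; rewrite addrC.
have m l l' : test_fun Om (fun x => pder l phi x * pder l' psi x).
  by apply: test_mul; [exact: test_pder|exact: (smooth_pder l' (test_smooth t2))].
by split; apply: sub1; exact: m.
Qed.

Lemma ip_pbracket phi psi chi : test_fun Om phi -> test_fun Om psi -> test_fun Om chi ->
  ip Om (pbracket phi psi) chi = - Rintegral (mu2 R) Om (fun x =>
    cof_x phi psi x * pder [:: true] chi x + cof_y phi psi x * pder [:: false] chi x).
Proof.
move=> t1 t2 t3; have [tx ty] := test_cof t1 t2.
have Lx := test_L2 oOm bOm (test_pder [:: true] tx).
have Ly := test_L2 oOm bOm (test_pder [:: false] ty).
have L3 := test_L2 oOm bOm t3.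
have -> : pbracket phi psi = pder [:: true] (cof_x phi psi) + pder [:: false] (cof_y phi psi).
  exact: (esym (pbracket_divergence (test_smooth t1) (test_smooth t2))).
apply: (etrans (formDl L2p Lx Ly L3)).
apply: (etrans (congr2 +%R (ibp1 oOm bOm true tx t3) (ibp1 oOm bOm false ty t3))).
apply: (etrans (esym (opprD _ _))); apply: (congr1 -%R); apply: esym.
apply: (RintegralD mO); apply: (L2_mul oOm).
- exact: (test_L2 oOm bOm tx).
- exact: (test_L2 oOm bOm (test_pder [:: true] t3)).
- exact: (test_L2 oOm bOm ty).
- exact: (test_L2 oOm bOm (test_pder [:: false] t3)).
Qed.

Lemma bform_test_sym23 phi psi chi : test_fun Om phi -> test_fun Om psi -> test_fun Om chi ->
  bform Om phi psi chi = bform Om phi chi psi.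
Proof.
move=> t1 t2 t3.
have sym : Rintegral (mu2 R) Om (fun x =>
      cof_x phi psi x * pder [:: true] chi x + cof_y phi psi x * pder [:: false] chi x) =
    Rintegral (mu2 R) Om (fun x =>
      cof_x phi chi x * pder [:: true] psi x + cof_y phi chi x * pder [:: false] psi x).
  by apply: eq_Rintegral => x _; exact: cofactor_sym.
have E : ip Om (pbracket phi psi) chi = ip Om (pbracket phi chi) psi.
  apply: (etrans (ip_pbracket t1 t2 t3)); apply: (etrans (congr1 -%R sym)).
  exact: (esym (ip_pbracket t1 t3 t2)).
apply: (etrans (bform_test t1 t2 t3)); apply: (etrans (congr1 (fun r => - (1 / 2) * r) E)).
exact: (esym (bform_test t1 t3 t2)).
Qed.

Lemma dense_zero (L : (P -> R) -> R) (C : R) : 0 <= C ->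
  (forall u v, H20 Om u -> H20 Om v -> L (u - v) = L u - L v) ->
  (forall u, H20 Om u -> `|L u| <= C * EN u) ->
  (forall phi, test_fun Om phi -> L phi = 0) -> forall u, H20 Om u -> L u = 0.
Proof.
move=> C0 LB Lbd L0 u Hu; apply/eqP; rewrite -normr_le0.
apply/ler_addgt0Pr => e e0; rewrite add0r.
have C1 : 0 < C + 1 by rewrite ltr_wpDl.
have [phi tphi hphi] := H20_dense oOm bOm Hu (divr_gt0 e0 C1).
have Hphi := test_H20 oOm bOm tphi.
have -> : L u = L (u - phi) by rewrite (LB _ _ Hu Hphi) (L0 _ tphi) subr0.
apply: (le_trans (Lbd _ (psdB Hp Hu Hphi))).
apply: (@le_trans _ _ ((C + 1) * (e / (C + 1)))); last by rewrite mulrC divfK// gt_eqF.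
by apply: ler_pM; rewrite ?seminorm_ge0// lerDl.
Qed.

Lemma bform_sym23 u w z : H20 Om u -> H20 Om w -> H20 Om z ->
  bform Om u w z = bform Om u z w.
Proof.
pose C := 4 * volume Om; have C0 : 0 <= C by rewrite mulr_ge0 ?volume_ge0.
pose t u w z := bform Om u w z - bform Om u z w.
have tbd u' w' z' : H20 Om u' -> H20 Om w' -> H20 Om z' ->
    `|t u' w' z'| <= C * (EN u' * EN w' * EN z').
  move=> H1 H2 H3; apply: (le_trans (ler_normB _ _)).
  apply: (le_trans (lerD (bform_bound H1 H2 H3) (bform_bound H1 H3 H2))).
  rewrite /C; move: (EN u') (EN w') (EN z') (volume Om) => a b c k.
  by rewrite le_eqVlt; apply/orP; left; apply/eqP; ring.
have Bl x y : x - y = (-1) *: y + x :> (P -> R) by rewrite scaleN1r addrC.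
have ringid (p q r s : R) : -1 * p + q - (-1 * r + s) = q - s - (p - r) by ring.
have tBl x y w' z' : H20 Om x -> H20 Om y -> H20 Om w' -> H20 Om z' ->
    t (x - y) w' z' = t x w' z' - t y w' z'.
  move=> Hx Hy H1 H2; rewrite /t Bl (bform_linl (-1) Hy Hx H1 H2) (bform_linl (-1) Hy Hx H2 H1).
  exact: ringid.
have tBm x y u' z' : H20 Om x -> H20 Om y -> H20 Om u' -> H20 Om z' ->
    t u' (x - y) z' = t u' x z' - t u' y z'.
  move=> Hx Hy H1 H2; rewrite /t Bl (bform_linm (-1) H1 Hy Hx H2) (bform_linr (-1) H1 H2 Hy Hx).
  exact: ringid.
have tBr x y u' w' : H20 Om x -> H20 Om y -> H20 Om u' -> H20 Om w' ->
    t u' w' (x - y) = t u' w' x - t u' w' y.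
  move=> Hx Hy H1 H2; rewrite /t Bl (bform_linr (-1) H1 H2 Hy Hx) (bform_linm (-1) H1 Hy Hx H2).
  exact: ringid.
have tH phi := @test_H20 _ _ _ oOm bOm phi.
(* The defect [t] is additive and bounded in each argument, so the arguments are freed from being
   test functions one at a time: [u], then [w], then [z]. *)
have z1 psi chi : test_fun Om psi -> test_fun Om chi -> forall u, H20 Om u -> t u psi chi = 0.
  move=> t2 t3; apply: (@dense_zero (fun u => t u psi chi) (C * (EN psi * EN chi))).
  - exact: (mulr_ge0 C0 (mulr_ge0 (seminorm_ge0 _ _) (seminorm_ge0 _ _))).
  - by move=> x y Hx Hy; exact: (tBl _ _ _ _ Hx Hy (tH _ t2) (tH _ t3)).
  - move=> x Hx; apply: (le_trans (tbd _ _ _ Hx (tH _ t2) (tH _ t3))).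
    move: (C) (EN x) (EN psi) (EN chi) => k a b c; by rewrite le_eqVlt; apply/orP; left; apply/eqP; ring.
  - by move=> phi t1; apply/eqP; rewrite subr_eq0; apply/eqP; exact: (bform_test_sym23 t1 t2 t3).
have z2 u' chi : H20 Om u' -> test_fun Om chi -> forall w, H20 Om w -> t u' w chi = 0.
  move=> Hu' t3; apply: (@dense_zero (fun w => t u' w chi) (C * (EN u' * EN chi))).
  - exact: (mulr_ge0 C0 (mulr_ge0 (seminorm_ge0 _ _) (seminorm_ge0 _ _))).
  - by move=> x y Hx Hy; exact: (tBm _ _ _ _ Hx Hy Hu' (tH _ t3)).
  - move=> x Hx; apply: (le_trans (tbd _ _ _ Hu' Hx (tH _ t3))).
    move: (C) (EN x) (EN u') (EN chi) => k a b c; by rewrite le_eqVlt; apply/orP; left; apply/eqP; ring.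
  - by move=> psi t2; exact: (z1 _ _ t2 t3).
have z3 u' w' : H20 Om u' -> H20 Om w' -> forall z, H20 Om z -> t u' w' z = 0.
  move=> Hu' Hw'; apply: (@dense_zero (fun z => t u' w' z) (C * (EN u' * EN w'))).
  - exact: (mulr_ge0 C0 (mulr_ge0 (seminorm_ge0 _ _) (seminorm_ge0 _ _))).
  - by move=> x y Hx Hy; exact: (tBr _ _ _ _ Hx Hy Hu' Hw').
  - move=> x Hx; apply: (le_trans (tbd _ _ _ Hu' Hw' Hx)).
    move: (C) (EN x) (EN u') (EN w') => k a b c; by rewrite le_eqVlt; apply/orP; left; apply/eqP; ring.
  - by move=> chi t3; exact: (z2 _ _ Hu' t3 _ Hw').
by move=> Hu Hw Hz; apply/eqP; rewrite -subr_eq0; apply/eqP; exact: (z3 _ _ Hu Hw _ Hz).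
Qed.

End Trilinear.

(** * The obstacle problem *)

Section Obstacle.
Variable R : realType.
Local Notation P := (R * R)%type.
Variables (Om : set P) (M : R).
Hypotheses (oOm : open Om) (bOm : forall x, Om x -> `|x.1| <= M /\ `|x.2| <= M).
Implicit Types (f g u v w z phi psi chi : P -> R).
Local Notation N2 := (normL2 Om).
Local Notation EN := (seminorm (aform Om)).
Let L2p := L2_psd oOm.
Let Hp := H20_psd oOm bOm.
Let mO := measurable_Om oOm.

Lemma ev_lin (p : P) (c : R) u v : H20 Om u -> H20 Om v ->
  ev Om p (c *: u + v) = c * ev Om p u + ev Om p v.
Proof.
move=> Hu Hv; have Hw := psd_lin Hp c Hu Hv.
have [Lu Lv] := (hess_L2 true false Hu, hess_L2 true false Hv).
have Lq := L2_quad_ind oOm bOm p.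
apply: (etrans (ip_eq_normL2 oOm (hess_L2 true false Hw) (psd_lin L2p c Lu Lv) Lq
  (hess_lin oOm bOm c true false Hu Hv))).
exact: (psd_l L2p c Lu Lv Lq).
Qed.

(* A bounded sequence of [H20] converging weakly to [0] converges uniformly:
   it does so pointwise, since evaluation is represented by a vector, and the
   evaluations are equicontinuous on a compact square. *)
Lemma ess_le_weak_cvg0 (U : set_system nat) (z_ : nat -> P -> R) (B : R) :
  ProperFilter U -> (forall n, H20 Om (z_ n)) -> (forall n, EN (z_ n) <= B) ->
  (forall w, H20 Om w -> aform Om (z_ n) w @[n --> U] --> (0 : R)) ->
  forall e : R, 0 < e -> \forall n \near U, ess_le Om e (z_ n).
Proof.
move=> PU Hz zB zw e e0.
have B0 : 0 <= B := le_trans (seminorm_ge0 _ _) (zB 0).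
have e2 : 0 < e / 2 by rewrite divr_gt0.
have cev p : ev Om p (z_ n) @[n --> U] --> (0 : R).
  have bd u : H20 Om u -> `|ev Om p u| <= volume Om * EN u.
    by move=> Hu; rewrite mulrC; exact: (ev_bound oOm bOm p Hu).
  have [w Hw wE] := riesz Hp (H20_complete oOm bOm) (fun c u v => @ev_lin p c u v) bd.
  rewrite (_ : (fun n => _) = fun n => aform Om (z_ n) w); first exact: zw.
  by apply/funext => n; rewrite -(wE _ (Hz n)); exact: (psd_sym Hp Hw (Hz n)).
have /compact_near_coveringP cov := @square_compact R (0, 0) M.
have : \forall n \near U, square (0, 0) M `<=` (fun q => `|ev Om q (z_ n)| <= e).
  apply: (cov nat U (fun n q => `|ev Om q (z_ n)| <= e)) => p _.
  have B1 : 0 < B + 1 by rewrite ltr_wpDl.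
  have [r r0 hr] := quad_ind_continuous oOm bOm p (divr_gt0 e2 B1).
  have hn : \forall n \near U, `|ev Om p (z_ n)| <= e / 2.
    by move/cvgrPdist_le : (cev p) => /(_ _ e2); apply: filterS => n; rewrite sub0r normrN.
  exists (square p r, [set n | `|ev Om p (z_ n)| <= e / 2]).
    by split; [exact: square_nbhs|exact: hn].
  move=> [q n] [/= hq hnn].
  have k1 : `|ev Om q (z_ n) - ev Om p (z_ n)| <= e / 2.
    apply: (le_trans (ev_lipschitz oOm bOm p q (Hz n))).
    apply: (@le_trans _ _ ((B + 1) * (e / 2 / (B + 1)))); last by rewrite mulrC divfK// gt_eqF.
    apply: ler_pM; rewrite ?seminorm_ge0//; last exact: hr.
    by apply: (le_trans (zB n)); rewrite lerDl.
  move: k1 hnn; move: (ev Om q (z_ n)) (ev Om p (z_ n)) => a b.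
  by rewrite !ler_norml => /andP[? ?] /andP[? ?]; apply/andP; split; lra.
apply: filterS => n hn; have := ae_ev oOm bOm (Hz n); rewrite /ae_eq.
by apply: filterS => x h Ox; rewrite (h Ox); apply: hn; exact: (Om_sub_square bOm).
Qed.

Lemma Kset_convex chi u v (t : R) : 0 <= t <= 1 ->
  Kset Om chi u -> Kset Om chi v -> Kset Om chi (u + t *: (v - u)).
Proof.
move=> /andP[t0 t1] [Hu cu] [Hv cv]; split.
  exact: (psdD Hp Hu (psdZ Hp t (psdB Hp Hv Hu))).
have A : {ae mu2 R, forall x : plane R, Om x -> chi x <= u x} by exact: cu.
have B : {ae mu2 R, forall x : plane R, Om x -> chi x <= v x} by exact: cv.
have : {ae mu2 R, forall x : plane R, Om x -> chi x <= (u + t *: (v - u)) x}; last by [].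
apply: filterS2 A B => x h1 h2 Ox; have {}h1 := h1 Ox; have {}h2 := h2 Ox.
have -> : (u + t *: (v - u)) x = u x + t * (v x - u x) by [].
have : 0 <= t * (v x - chi x) + (1 - t) * (u x - chi x).
  by rewrite addr_ge0// mulr_ge0 ?subr_ge0.
by lra.
Qed.

(** Approximants with errors [1 / (n + 1)] suffice, so only countably many null sets have to be
    joined. *)
Lemma Kset_closed chi u : H20 Om u ->
  (forall e : R, 0 < e -> exists2 w, Kset Om chi w & ess_le Om e (w - u)) -> Kset Om chi u.
Proof.
move=> Hu H; split=> //.
have /choice[w_ hw] : forall n : nat, exists w, Kset Om chi w /\ ess_le Om n.+1%:R^-1 (w - u).
  move=> n; have n0 : 0 < n.+1%:R^-1 :> R by rewrite invr_gt0.
  by have [w Kw ew] := H _ n0; exists w.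
have A : {ae mu2 R, forall (x : plane R) (n : nat), Om x -> chi x <= w_ n x}.
  apply: ae_foralln => n; exact: (hw n).1.2.
have B : {ae mu2 R, forall (x : plane R) (n : nat), Om x -> `|(w_ n - u) x| <= n.+1%:R^-1}.
  apply: ae_foralln => n; exact: (hw n).2.
have : {ae mu2 R, forall x : plane R, Om x -> chi x <= u x}; last by [].
apply: filterS2 A B => x h1 h2 Ox; apply/ler_addgt0Pr => e e0.
have [n ne] : exists n : nat, n.+1%:R^-1 <= e.
  have /cvgrPdist_le/(_ _ e0) := @cvg_harmonic R.
  by move=> [n _ /(_ n (leqnn n))]; rewrite sub0r normrN => /(le_trans (ler_norm _)) ?; exists n.
have := h1 n Ox; have := h2 n Ox.
have -> : (w_ n - u) x = w_ n x - u x by [].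
move: (n.+1%:R^-1) ne => y ne; rewrite ler_norml => /andP[? ?] ?; lra.
Qed.

(* Indexing the covering property of compact sets by this filter replaces the
   finite sums of bumps: a filter is closed under finite intersections. *)
Lemma above_filter : Filter [set S : set (P -> R) | exists psi0,
  (test_fun Om psi0 /\ forall x, 0 <= psi0 x) /\
  forall psi, test_fun Om psi -> (forall x, psi0 x <= psi x) -> S psi].
Proof.
split.
- by exists 0; split; [split; [exact: test0|]|].
- move=> S1 S2 [p1 [[t1 g1] h1]] [p2 [[t2 g2] h2]]; exists (1 *: p1 + p2); split.
    split; first exact: test_lin.
    by move=> x; rewrite scale1r; exact: addr_ge0.
  move=> psi tpsi; rewrite scale1r => h; split.
    by apply: h1 => // x; apply: le_trans (h x); rewrite lerDl.
  by apply: h2 => // x; apply: le_trans (h x); rewrite lerDr.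
- move=> S1 S2 S12 [p [t h]]; exists p; split=> // psi tpsi hp.
  by apply: S12; exact: h.
Qed.

Lemma closure_compact : compact (closure Om).
Proof.
apply: (subclosed_compact (@closed_closure _ Om) (@square_compact R (0, 0) M)).
have -> : square (0, 0) M = closure (square (0 : R, 0 : R) M).
  by apply/closure_id; apply: (compact_closed (@plane_hausdorff R)); exact: square_compact.
by apply: closure_subset; exact: (Om_sub_square bOm).
Qed.

Lemma test_above chi (m : R) : {within closure Om, continuous chi} -> m < 0 ->
  (forall x, boundary Om x -> chi x <= m) ->
  exists2 psi, test_fun Om psi & forall x, closure Om x -> chi x <= psi x.
Proof.
move=> /subspace_continuousP cchi m0 chim.
have /compact_near_coveringP cov := closure_compact.
have [|psi0 [[t0 g0] h]] := cov (P -> R) _ (fun psi y => closure Om y -> chi y <= psi y) above_filter.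
- move=> x clx; have cx := cchi x clx.
  have lt c : chi x < c -> nbhs x [set y | closure Om y -> chi y < c].
    by move=> xc; exact: (cx [set t | t < c] (open_nbhs_nbhs (conj (@open_lt R c) xc))).
  (* The condition is local. Where the obstacle is negative every nonnegative function lies above it
     nearby; otherwise [x] is not on the boundary, and there is room for a bump inside [Om]. *)
  have [chix|chix] := ltP (chi x) 0.
    have A := lt _ chix.
    exists ([set y | closure Om y -> chi y < 0], [set psi | forall x, 0 <= psi x]).
      by split; [exact: A|exists 0; split; [split; [exact: test0|]|]].
    by move=> [y psi] [/= h1 h2] cly; apply: le_trans (h2 y); apply: ltW; exact: h1.
  have Ox : Om x.
    apply: contrapT => nOx; have : boundary Om x by split=> // /interior_subset.
    by move/chim => /(le_lt_trans)/(_ m0); rewrite ltNge chix.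
  have [r r0 sub] := nbhs_square (open_nbhs_nbhs (conj oOm Ox)).
  pose k := cutoff (x.1 - r) (x.1 + r) (x.2 - r) (x.2 + r) 1.
  have tk : test_fun Om k by apply: test_cutoff => //; rewrite -square_itv.
  have kx : 0 < k x by apply: cutoff_gt0 => //; split; rewrite /= in_itv /= ltrBlDr ltrDl r0.
  (* The scaled bump has value [chi x + 2] at [x]; the level [chi x + 1] then separates it from the
     obstacle on a neighbourhood. *)
  pose c := (chi x + 2) / k x.
  have c0 : 0 <= c by rewrite divr_ge0 ?(ltW kx)// addr_ge0.
  have tck : test_fun Om (c *: k + 0) by apply: test_lin => //; exact: test0.
  have ckE y : (c *: k + 0) y = c * k y by rewrite addr0.
  have A1 : nbhs x [set y | closure Om y -> chi y < chi x + 1] by apply: lt; rewrite ltrDl.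
  have A2 : nbhs x [set y | chi x + 1 < c * k y].
    have ct : continuous (c *: k + 0) by exact: test_continuous tck.
    have xc : chi x + 1 < (c *: k + 0) x by rewrite ckE divfK ?gt_eqF// ltrD2l ltr1n.
    have := ct x [set t | chi x + 1 < t] (open_nbhs_nbhs (conj (@open_gt R _) xc)).
    by rewrite (_ : (c *: k + 0) = fun y => c * k y)//; apply/funext => y; exact: ckE.
  exists ([set y | closure Om y -> chi y < chi x + 1] `&` [set y | chi x + 1 < c * k y],
          [set psi | forall y, c * k y <= psi y]).
    split; first exact: filterI.
    exists (c *: k + 0); split.
      split=> // y; rewrite ckE mulr_ge0//.
      by have /andP[] := cutoff_01 (x.1 - r) (x.1 + r) (x.2 - r) (x.2 + r) 1 y.
    by move=> psi _ hpsi y; rewrite -ckE.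
  move=> [y psi] [/= [h1 h2] h3] cly.
  by apply: le_trans (h3 y); apply: ltW; apply: lt_trans (h1 cly) h2.
by exists psi0 => // x clx; exact: (h psi0).
Qed.

Lemma Kset_nonempty chi (m : R) : {within closure Om, continuous chi} -> m < 0 ->
  (forall x, boundary Om x -> chi x <= m) -> Kset Om chi !=set0.
Proof.
move=> cchi m0 chim; have [psi tpsi h] := test_above cchi m0 chim.
exists psi; split; first exact: test_H20 oOm bOm _ tpsi.
by apply: aeW => x Ox; apply: h; exact: subset_closure.
Qed.

Lemma load_bound f u : L2 Om f -> H20 Om u ->
  `|ip Om f u| <= volume Om * Rintegral (mu2 R) Om (fun x => `|f x|) * EN u.
Proof.
move=> Lf Hu; have e0 : 0 <= EN u * volume Om by rewrite mulr_ge0 ?seminorm_ge0 ?volume_ge0.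
have [_ B] := integrable_ae_bounded_mul mO e0 (L2_integrable oOm bOm Lf) (H20_L2 Hu).1 (ae_bound oOm bOm Hu).
apply: (le_trans B); move: (EN u) (volume Om) (Rintegral _ _ _) => a b c.
by rewrite le_eqVlt; apply/orP; left; apply/eqP; ring.
Qed.

(** Riesz representation makes the [xget] in [Gop] meet its specification rather than return the
    default. *)
Lemma GopP u : H20 Om u -> H20 Om (Gop Om u) /\
  forall psi, H20 Om psi -> aform Om (Gop Om u) psi = bform Om u u psi.
Proof.
move=> Hu.
have [d Hd dE] := trilinear_riesz Hp (H20_complete oOm bOm)
  (fun x y c v w Hx Hy => @bform_linr _ _ _ oOm bOm x y c v w Hx Hy)
  (@bform_bound _ _ _ oOm bOm) Hu Hu.
exact: (@xgetPex _ (fun=> 0) [set w | H20 Om w /\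
  forall psi, H20 Om psi -> aform Om w psi = bform Om u u psi] (ex_intro _ d (conj Hd dE))).
Qed.

Lemma jfunE f u : H20 Om u ->
  jfun Om f u = energy (aform Om) (Gop Om) (ip Om f) u.
Proof.
move=> Hu; have [HG _] := GopP Hu.
exact: (congr2 (fun p q => 1 / 2 * p + 1 / 2 * q - ip Om f u)
  (sqr_seminorm Hp Hu) (sqr_seminorm Hp HG)).
Qed.

End Obstacle.

(** Turns the inequality in the direction [phi1 - u], which points into [K], into the one for
    [u - phi1]. *)
Lemma opp_variational (R : realDomainType) (p q r p' q' r' : R) :
  p' = -1 * p -> q' = -1 * q -> r' = -1 * r -> 0 <= p + 2 * q - r -> p' + 2 * q' <= r'.
Proof. by move=> -> -> ->; lra. Qed.

Theorem theorem2p2 (R : realType) (Om : set (R * R)) (f chi : R * R -> R) :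
  polygonal_domain Om ->
  L2 Om f ->
  H2 Om chi ->
  {within closure Om, continuous chi} ->
  (exists2 m : R, m < 0 & forall x, boundary Om x -> chi x <= m) ->
  (exists u, Kset Om chi u /\
     forall xi, Kset Om chi xi -> jfun Om f u <= jfun Om f xi) /\
  (forall u, Kset Om chi u ->
     (forall xi, Kset Om chi xi -> jfun Om f u <= jfun Om f xi) ->
     let v := Gop Om u in
     [/\ Kset Om chi u, H20 Om v,
         (forall phi1, Kset Om chi phi1 ->
            aform Om u (u \- phi1) + 2 * bform Om u v (u \- phi1)
              <= ip Om f (u \- phi1)) &
         (forall phi2, H20 Om phi2 ->
            aform Om v phi2 - bform Om u u phi2 = 0)]).
Proof.
move=> [oOm _ _ [M bOm] _] Lf _ cchi [m m0 chim].
have Hp := H20_psd oOm bOm; have Hc := H20_complete oOm bOm.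
have L2p := L2_psd oOm.
have KH : Kset Om chi `<=` H20 Om by move=> w [].
have [k0 Kk0] := Kset_nonempty oOm bOm cchi m0 chim.
have b_lin x y c v w (Hx : H20 Om x) (Hy : H20 Om y) := @bform_linr _ _ _ oOm bOm x y c v w Hx Hy.
have b_sym x y z (Hx : H20 Om x) (Hy : H20 Om y) (Hz : H20 Om z) : bform Om x y z = bform Om y x z.
  exact: bform_sym12.
have b_sym' := @bform_sym23 _ _ _ oOm bOm.
have b_bd := @bform_bound _ _ _ oOm bOm.
have HG u (Hu : H20 Om u) := (GopP oOm bOm Hu).1.
have aG u z (Hu : H20 Om u) (Hz : H20 Om z) := (GopP oOm bOm Hu).2 z Hz.
have F_lin c u v (Hu : H20 Om u) (Hv : H20 Om v) : ip Om f (c *: u + v) = c * ip Om f u + ip Om f v.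
  by have := formDr L2p (psdZ L2p c (H20_L2 Hu)) (H20_L2 Hv) Lf; rewrite (formZr L2p)//; exact: H20_L2.
have F_bd u (Hu : H20 Om u) := load_bound oOm bOm Lf Hu.
have Kc u v t := @Kset_convex _ _ _ oOm bOm chi u v t.
split.
  have [u Ku umin] := energy_minimizer Hp Hc b_lin b_sym b_sym' b_bd HG aG F_lin F_bd
    (fun u v z e e0 => @bform_ess_bound _ _ oOm u v z e e0)
    (@ess_le_weak_cvg0 _ _ _ oOm bOm) KH (fun u Hu => Kset_closed Hu) (ex_intro _ k0 Kk0).
  exists u; split=> // xi Kxi.
  by rewrite (jfunE oOm bOm f (KH _ Ku)) (jfunE oOm bOm f (KH _ Kxi)); exact: umin.
move=> u Ku umin v; have Hu := KH _ Ku; have Hv : H20 Om v := HG u Hu.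
split=> //.
- move=> w Kw; have Hw := KH _ Kw.
  have umin' xi : Kset Om chi xi -> energy (aform Om) (Gop Om) (ip Om f) u <= energy (aform Om) (Gop Om) (ip Om f) xi.
    by move=> Kxi; rewrite -(jfunE oOm bOm f Hu) -(jfunE oOm bOm f (KH _ Kxi)); exact: umin.
  have := energy_variational Hp Hc b_lin b_sym b_sym' b_bd HG aG F_lin KH Kc Ku umin' Kw.
  have H1 := psdB Hp Hw Hu; rewrite -/v.
  have -> : u \- w = (-1) *: (w - u) by rewrite scaleN1r opprB.
  have Ea := formZr Hp (-1) H1 Hu.
  have Eb := trilZ Hp b_lin (-1) Hu Hv H1.
  have EF := formZr L2p (-1) (H20_L2 H1) Lf.
  apply: opp_variational Ea Eb EF.
- by move=> psi Hpsi; apply/eqP; rewrite subr_eq0; apply/eqP; exact: aG.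
Qed.
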